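(* Let $\mathbf{x}_1,\ldots,\mathbf{x}_n$ be independent and identically distributed observations from $\mathcal{N}_p(\mathbf{0},\mathbf{\Sigma}_0)$, with data matrix $\mathbb{X}=(x_{ij})_{n\times p}$, where $p=p_n$ and $\mathbf{\Sigma}_0$ may vary with $n$. Assume: (1) there exists a constant $\theta>1$ such that $1/\theta<sv_p(\mathbf{\Sigma}_0)\le sv_1(\mathbf{\Sigma}_0)<\theta$; (2) the tuning parameters $\eta_j$ of the penalized regressions satisfy $\sum_{j=1}^p\eta_j=O(\log(p)/n)$, and $(s_1+p)\log(p)=o(n)$; (3) $\lambda=o((s_0+p)^{-1/2})$; (4) there are constants $\rho>0$ and $K>0$ such that for all $|t|\le\rho$, $1\le i\le n$, $1\le j\le p$, $$E\{\exp(t x_{ij}^2)\}\le K.$$ For any $m>0$, set $$\lambda=c_0^2\,\frac{\log p}{n}+c_1\Big(\frac{\log p}{n}\Big)^{1/2},$$ where $$c_0=\tfrac12 eK\rho^{1/2}+\rho^{-1/2}(m+1),\qquad c_1=2K\Big(\rho^{-1}+\tfrac14\rho\,\sigma_{max}^2\Big)\exp\Big(\tfrac12\rho\,\sigma_{max}\Big)+2\rho^{-1}(m+2).$$ Then the estimator $$\hat{\mathbf{\Sigma}}^{+}=\arg\min_{\mathbf{\Sigma}\succeq\nu\mathbf{I}}\ \frac{1}{2M}\sum_{k=1}^M\|\mathbf{\Sigma}-\hat{\mathbf{\Sigma}}_k\|_F^2+\lambda|\mathbf{\Sigma}|_1,$$ with $\nu$ an arbitrarily (sufficiently) small positive number,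 satisfies, as $n\to\infty$, $$\|\hat{\mathbf{\Sigma}}^{+}-\mathbf{\Sigma}_0\|_F\stackrel{P}{\rightarrow}0 .$$
   Context: $sv_1(\mathbf{A})\ge\cdots\ge sv_p(\mathbf{A})$ are the singular values of $\mathbf{A}$. $\|\cdot\|_F$ is the Frobenius norm; $|\mathbf{\Sigma}|_1=\sum_{i\ne j}|\sigma_{ij}|$ is the $L_1$ norm of the off-diagonal elements; $\mathbf{\Sigma}\succeq\nu\mathbf{I}$ means $\mathbf{\Sigma}-\nu\mathbf{I}$ is positive semidefinite (over symmetric matrices). $\stackrel{P}{\rightarrow}$ is convergence in probability. $e$ is Euler's number. $\sigma_{max}$ is the maximal true variance (largest diagonal entry) of $\mathbf{\Sigma}_0=(\sigma^0_{ij})_{p\times p}$, and $s_0$ is the number of nonzero off-diagonal elements of $\mathbf{\Sigma}_0$. Modified Cholesky decomposition (MCD): $\mathbf{\Sigma}=\mathbf{L}\mathbf{D}\mathbf{L}'$ with $\mathbf{L}$ unit lower triangular and $\mathbf{D}$ diagonal with positive entries. Let $\pi_1,\ldots,\pi_M$ be $M$ different permutations of $\{1,\ldots,p\}$ (variable orders) with permutation matrices $\mathbf{P}_{\pi_k}$; let $\mathbf{\Sigma}_{0\pi_k}=\mathbf{P}_{\pi_k}'\mathbf{\Sigma}_0\mathbf{P}_{\pi_k}$ be the true covariance matrix under the order $\pi_k$, with MCD $\mathbf{\Sigma}_{0\pi_k}=\mathbf{L}_{0\pi_k}\mathbf{D}_{0\pi_k}\mathbf{L}_{0\pi_k}'$.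 Let $Z_{\pi_k}=\{(j,l):l<j,\ (\mathbf{L}_{0\pi_k})_{jl}\ne0\}$ and $s_1=\max_{1\le k\le M}|Z_{\pi_k}|$. Construction of $\hat{\mathbf{\Sigma}}_k$. For each $k$, reorder the variables by $\pi_k$ (data matrix $\mathbb{X}\mathbf{P}_{\pi_k}$) and let $\mathbf{x}^{(j)}$ be the $j$th column of the reordered data. Put $\mathbf{e}^{(1)}=\mathbf{x}^{(1)}$ and, for $j=2,\ldots,p$ successively, $\mathbb{Z}^{(j)}=(\mathbf{e}^{(1)},\ldots,\mathbf{e}^{(j-1)})$, $\hat{\mathbf{l}}_j\in\arg\min_{\mathbf{l}_j}\|\mathbf{x}^{(j)}-\mathbb{Z}^{(j)}\mathbf{l}_j\|_2^2+\eta_j\|\mathbf{l}_j\|_1$ with tuning parameter $\eta_j\ge0$, and $\mathbf{e}^{(j)}=\mathbf{x}^{(j)}-\mathbb{Z}^{(j)}\hat{\mathbf{l}}_j$. Let $\hat{\mathbf{L}}_{\pi_k}$ be the unit lower triangular matrix whose $j$th row has subdiagonal entries $\hat{\mathbf{l}}_j$, let $\hat{\mathbf{D}}_{\pi_k}=\mathrm{diag}(\hat d_1^2,\ldots,\hat d_p^2)$ with $\hat d_j^2$ the sample variance of $\mathbf{e}^{(j)}$, and set $\hat{\mathbf{\Sigma}}_{\pi_k}=\hat{\mathbf{L}}_{\pi_k}\hat{\mathbf{D}}_{\pi_k}\hat{\mathbf{L}}_{\pi_k}'$ and $\hat{\mathbf{\Sigma}}_k=\mathbf{P}_{\pi_k}\hat{\mathbf{\Sigma}}_{\pi_k}\mathbf{P}_{\pi_k}'$.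 The number $M$ is fixed; asymptotics are as $n\to\infty$. *)

(* Defs.v *)
From HB Require Import structures.
From mathcomp Require Import all_boot all_order all_algebra perm.
From mathcomp Require Import polyrcf.
From mathcomp Require Import all_classical all_reals all_analysis.

Set Implicit Arguments.
Unset Strict Implicit.
Unset Printing Implicit Defensive.

Import Order.TTheory GRing.Theory Num.Theory.
Import numFieldNormedType.Exports.

Local Open Scope classical_set_scope.
Local Open Scope ring_scope.

Section Matrices.
Context {R : realType}.

(* The singular values of A, with multiplicity and in nonincreasing order, are
   the square roots of the eigenvalues of A^T A. *)
Definition sv_seq p (A : 'M[R]_p) : seq R :=
  let q := char_poly (A^T *m A) in
  sort >=%R (flatten [seq nseq (mup x q) (Num.sqrt x) | x <- rootsR q]).

(* Indexed from 1. *)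
Definition sv p (A : 'M[R]_p) (i : nat) : R := nth 0 (sv_seq A) i.-1.

Definition frobenius m p (A : 'M[R]_(m, p)) : R :=
  Num.sqrt (\sum_i \sum_j A i j ^+ 2).

Definition offdiag_l1 p (A : 'M[R]_p) : R :=
  \sum_i \sum_(j | i != j) `|A i j|.

Definition psd p (A : 'M[R]_p) : Prop :=
  A^T = A /\ forall v : 'cV[R]_p, 0 <= (v^T *m A *m v) 0 0.

Definition unit_lower p (L : 'M[R]_p) : Prop :=
  forall i j : 'I_p, (i <= j)%N -> L i j = (i == j)%:R.

Definition mcd p (S L : 'M[R]_p) (d : 'rV[R]_p) : Prop :=
  [/\ unit_lower L, forall i, 0 < d 0 i & S = L *m diag_mx d *m L^T].

Definition permuted p (s : 'S_p) (S : 'M[R]_p) : 'M[R]_p :=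
  (perm_mx s)^T *m S *m perm_mx s.

Definition strict_lower_nnz p (L : 'M[R]_p) : nat :=
  #|[set jl : 'I_p * 'I_p | (jl.2 < jl.1)%N && (L jl.1 jl.2 != 0)]%SET|.

Definition offdiag_nnz p (S : 'M[R]_p) : nat :=
  #|[set ij : 'I_p * 'I_p | (ij.1 != ij.2) && (S ij.1 ij.2 != 0)]%SET|.

(* The default value 0 of the maximum is harmless: it is only used for
   covariance matrices, whose diagonal is nonnegative. *)
Definition max_variance p (S : 'M[R]_p) : R := \big[Num.max/0]_(i < p) S i i.

Definition is_argmin (T : Type) (A : set T) (f : T -> R) (x : T) : Prop :=
  A x /\ forall y, A y -> f x <= f y.

End Matrices.

Section CholeskyRegression.
Context {R : realType} {n p : nat}.

Definition sqnorm (u : 'cV[R]_n) : R := \sum_i u i 0 ^+ 2.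

Definition sample_mean (u : 'cV[R]_n) : R := n%:R^-1 * \sum_i u i 0.

Definition sample_variance (u : 'cV[R]_n) : R :=
  n.-1%:R^-1 * \sum_i (u i 0 - sample_mean u) ^+ 2.

(* Only the entries of index k < j of the coefficient vector l are used. *)
Definition regression_residual (X E : 'M[R]_(n, p)) (j : 'I_p) (l : 'rV[R]_p) :
    'cV[R]_n :=
  col j X - \sum_(k < p | (k < j)%N) l 0 k *: col k E.

Definition lasso_loss (eta : R) (X E : 'M[R]_(n, p)) (j : 'I_p)
    (l : 'rV[R]_p) : R :=
  sqnorm (regression_residual X E j l)
  + eta * \sum_(k < p | (k < j)%N) `|l 0 k|.

(* L and d are an output of the successive penalized regressions of each column
   of X on the previous residuals; the columns of E are the residuals.  For the
   first column there is no regressor: its residual is the column itself and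
   the minimality condition is void. *)
Definition cholesky_regression (eta : 'I_p -> R) (X : 'M[R]_(n, p))
    (L : 'M[R]_p) (d : 'rV[R]_p) : Prop :=
  unit_lower L /\
  exists E : 'M[R]_(n, p), forall j : 'I_p,
    [/\ is_argmin setT (lasso_loss (eta j) X E j) (row j L),
        col j E = regression_residual X E j (row j L)
      & d 0 j = sample_variance (col j E)].

End CholeskyRegression.

Section Ensemble.
Context {R : realType} {p M : nat}.

Definition ensemble_loss (lambda : R) (Sk : 'I_M -> 'M[R]_p) (S : 'M[R]_p) : R :=
  (2 * M%:R)^-1 * \sum_(k < M) frobenius (S - Sk k) ^+ 2
  + lambda * offdiag_l1 S.

Definition ensemble_estimator (nu lambda : R) (Sk : 'I_M -> 'M[R]_p)
    (S : 'M[R]_p) : Prop :=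
  is_argmin [set S' | psd (S' - nu%:M)] (ensemble_loss lambda Sk) S.

End Ensemble.

Section Penalty.
Context {R : realType}.

Definition const_c0 (K rho m : R) : R :=
  2^-1 * expR 1 * K * Num.sqrt rho + (Num.sqrt rho)^-1 * (m + 1).

Definition const_c1 (K rho m sigma_max : R) : R :=
  2 * K * (rho^-1 + 4^-1 * rho * sigma_max ^+ 2)
    * expR (2^-1 * rho * sigma_max)
  + 2 * rho^-1 * (m + 2).

Definition penalty (K rho m sigma_max : R) (n p : nat) : R :=
  const_c0 K rho m ^+ 2 * (ln p%:R / n%:R)
  + const_c1 K rho m sigma_max * Num.sqrt (ln p%:R / n%:R).

End Penalty.

Section Probability.
Context {R : realType} {d : measure_display} {T : measurableType d}.
Variable P : probability T R.

(* Mutual independence: the product rule over every finite subfamily. *)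
Definition independent_families (I : finType) (F : I -> set (set T)) : Prop :=
  forall (J : {set I}) (A : I -> set T),
    (forall i, i \in J -> F i (A i)) ->
    P (\bigcap_(i in [set` J]) A i) = (\prod_(i in J) P (A i))%E.

(* The sigma-algebra generated by the random vector x. *)
Definition sigma_vector p (x : 'I_p -> {RV P >-> R}) : set (set T) :=
  <<s [set A | exists (j : 'I_p) (B : set R), measurable B /\ A = x j @^-1` B] >>.

(* normal_prob takes a standard deviation; its value at 0 is not a point mass,
   so that the degenerate case is treated separately. *)
Definition normal_law (v : R) (B : set R) : \bar R :=
  if v == 0 then \d_(0 : R) B else normal_prob 0 (Num.sqrt v) B.

(* x has the law N_p(0, S): every linear combination a' x is N(0, a' S a). *)
Definition centered_gaussian p (x : 'I_p -> {RV P >-> R}) (S : 'M[R]_p) : Prop :=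
  psd S /\
  forall (a : 'cV[R]_p) (B : set R), measurable B ->
    P [set w | B (\sum_(j < p) a j 0 * x j w)]
    = normal_law ((a^T *m S *m a) 0 0) B.

Definition iid_centered_gaussian n p (x : 'I_n -> 'I_p -> {RV P >-> R})
    (S : 'M[R]_p) : Prop :=
  independent_families (fun i => sigma_vector (x i)) /\
  forall i, centered_gaussian (x i) S.

Definition data_matrix n p (x : 'I_n -> 'I_p -> {RV P >-> R}) (w : T) :
    'M[R]_(n, p) :=
  \matrix_(i, j) x i j w.

Definition random_matrix m p (A : T -> 'M[R]_(m, p)) : Prop :=
  forall i j, measurable_fun setT (fun w => A w i j).

End Probability.

(* The variables Y n may live on different probability spaces. *)
Definition cvg_in_probability {R : realType} (d : nat -> measure_display)
    (T : forall n, measurableType (d n)) (P : forall n, probability (T n) R)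
    (Y : forall n, T n -> R) (c : R) : Prop :=
  forall eps : R, 0 < eps ->
    (fun n => P n [set w | eps < `|Y n w - c|]) @ \oo --> 0%E.

(* Main.v *)
Require Import Defs.
From HB Require Import structures.
From mathcomp Require Import all_boot all_order all_algebra perm.
From mathcomp Require Import all_classical all_reals all_analysis.
From mathcomp Require Import polyrcf.
From mathcomp Require Import measurable_realfun random_variable normal_distribution.
From mathcomp Require Import ring lra.

(** The penalties of one variable order add up to O(log p / n), whereas the
squared residuals are of order n.  The penalized regressions are therefore
least squares fits up to a negligible term, and least squares residuals
reproduce the data exactly: all the estimates [Sigma_hat_k] are close to the
same matrix, the sample second moment [G = X^T X / n], whatever the order.  The
last step then acts on [G] like soft thresholding at level [lambda], which is
consistent because [lambda] exceeds the deviations of the entries of [G].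

Comparison with [G] ([regression_perturbation]).  If [E] holds the residuals
then [X = E N^T] with [N = P L], so that [G = N (E^T E / n) N^T], while the
estimate is [N D N^T].  First-order optimality bounds the entries of [E^T E]
off the diagonal by [eta / 2] ([lasso_kkt]), and on the diagonal [D] differs
only by the centring of the sample variance.  The norm of [N] and the size of
the residuals are controlled by the extreme eigenvalues of [G].  These stay
between [1 / (2 theta)] and [2 theta] outside an event whose probability is
exponentially small in n up to a factor exponential in p: a quadratic form is
controlled by its values on a grid of the unit ball ([form_bound_grid]), the
grid has at most [2 ^ (27 p)] points ([card_grid]), and each point is handled
by an exponential inequality ([gram_concentration]).

Thresholding ([ensemble_basic]).  Comparing the objective at the minimizer and
at [Sigma_0] bounds the squared error by the squared deviations of [G] on the
diagonal and on the support of [Sigma_0], by the excess over [lambda] of the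
other deviations, and by [lambda ^ 2] times the size of the support.  The
expectations of the first two are O(1 / n) per entry on the diagonal and the
support, and O(1 / (n p)) per entry elsewhere: the constant [const_c1] makes
the tail at [lambda] gain a factor [1 / p] ([penalty_exponent],
[expectation_entry_excess]).

All probabilistic estimates come from one bound on the exponential moments of a
sum of products of two sub-Gaussian variables ([mgf_sum]), applied to pairs of
coordinates, to the square of a linear combination, and to a coordinate times
the constant one.  The assumed moment bound on the coordinates extends to all
directions because centred normal laws differ by a scale only
([lincomb_exp_sqr]).

Finally [lambda] is at least a constant times [sqrt (log p / n)], so that
[lambda ^ 2 (s_0 + p) -> 0] forces [(s_0 + p) log p / n -> 0] ([load_small]),
and with it all the terms above vanish. *)

Set Implicit Arguments.
Unset Strict Implicit.
Unset Printing Implicit Defensive.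
Import Order.TTheory GRing.Theory Num.Theory.
Import numFieldNormedType.Exports.
Import HBNNSimple.
Local Open Scope classical_set_scope.
Local Open Scope ring_scope.

(** * Integrals and laws *)

Section Transfer.
Context d1 d2 (T1 : measurableType d1) (T2 : measurableType d2) (R : realType).
Variables (mu : {measure set T1 -> \bar R}) (nu : {measure set T2 -> \bar R}).
Variables (Z G : T1 -> R) (H : T2 -> R) (c : R).
Hypotheses (mZ : measurable_fun setT Z) (Z0 : forall x, 0 <= Z x).
Hypotheses (mG : measurable_fun setT G) (mH : measurable_fun setT H).
Hypothesis ZG : forall B, measurable B ->
  (\int[mu]_(x in G @^-1` B) (Z x)%:E = c%:E * nu (H @^-1` B))%E.

Lemma nnsfun_integral_law (g : {nnsfun measurableTypeR R >-> R}) :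
  (\int[mu]_x (Z x * g (G x))%:E = c%:E * \int[nu]_x (g (H x))%:E)%E.
Proof.
have mI (A : set R) : measurable A -> measurable (G @^-1` A).
  by move=> mA; rewrite -[X in measurable X]setTI; exact: mG.
have mJ (A : set R) : measurable A -> measurable (H @^-1` A).
  by move=> mA; rewrite -[X in measurable X]setTI; exact: mH.
have mg r : measurable (g @^-1` [set r]) by exact: measurable_sfunP.
have gE d (T : measurableType d) (m : {measure set T -> \bar R}) (z F : T -> R) :
    measurable_fun setT z -> (forall x, 0 <= z x) -> measurable_fun setT F ->
  (\int[m]_x (z x * g (F x))%:E =
   \sum_(r \in range g) r%:E * \int[m]_(x in F @^-1` (g @^-1` [set r])) (z x)%:E)%E.
  move=> mz z0 mF.
  have mFr r : measurable (F @^-1` (g @^-1` [set r])).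
    by rewrite -[X in measurable X]setTI; exact: (mF measurableT _ (mg r)).
  transitivity (\int[m]_x
    (\sum_(r \in range g) (r * (z x * \1_(F @^-1` (g @^-1` [set r])) x))%:E))%E.
    apply: eq_integral => x _; rewrite fsumEFin// fimfunE mulr_fsumr//.
    by congr EFin; apply: eq_fsbigr => r _; rewrite mulrCA.
  rewrite ge0_integral_fsum//=; last 2 first.
  - move=> r; apply/measurable_EFinP; apply: measurable_funM => //.
    by apply: measurable_funM => //; exact: measurable_indic.
  - move=> r x _; rewrite lee_fin indicE.
    have [<-|gx] := eqVneq (g (F x)) r; first by rewrite !mulr_ge0.
    by rewrite memNset ?mulr0//=; apply/eqP.
  apply: eq_fsbigr => r /[!inE] -[y _ gyr].
  have r0 : 0 <= r by rewrite -gyr.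
  under eq_integral do rewrite EFinM.
  rewrite ge0_integralZl_EFin//; last 2 first.
  - by move=> x _; rewrite lee_fin mulr_ge0.
  - apply/measurable_EFinP; apply: measurable_funM => //.
  congr (_ * _)%E; rewrite [RHS]integral_mkcond; apply: eq_integral => x _.
  by rewrite patchE indicE; case: ifP => _; rewrite ?mulr1 ?mulr0.
rewrite gE//.
under [X in (_ * X)%E]eq_integral do rewrite -[X in X%:E]mul1r.
rewrite (gE _ _ nu (cst 1) H)//.
rewrite -[RHS]/(c%:E * _)%E ge0_mule_fsumr//; last first.
  move=> r; rewrite (integral_cst _ (mJ _ (mg r)) 1) mul1e.
  have [r0|r0] := leP 0 r; first by rewrite mule_ge0.
  have -> : g @^-1` [set r] = set0; last by rewrite preimage_set0 measure0 mule0.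
  by apply/seteqP; split => // y /= gy; move: r0; rewrite -gy ltNge fun_ge0.
apply: eq_fsbigr => r _; rewrite ZG; last exact: mg.
rewrite (integral_cst _ (mJ _ (mg r)) 1) mul1e.
by rewrite muleCA.
Qed.

(** Both sides are additive in [f] and continuous along increasing sequences, so
the case of indicators propagates to nonnegative measurable functions.  The
weight [Z] stands for the other factors of a product of independent variables,
for a density, or for the constant one when two laws are compared. *)
Lemma ge0_integral_law (f : R -> R) : measurable_fun setT f ->
  (forall y, 0 <= f y) ->
  (\int[mu]_x (Z x * f (G x))%:E = c%:E * \int[nu]_x (f (H x))%:E)%E.
Proof.
move=> mf f0.
have mF : measurable_fun (setT : set (measurableTypeR R)) (EFin \o f).
  exact/measurable_EFinP.
pose g := nnsfun_approx measurableT mF.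
have gf y : (g n y)%:E @[n --> \oo] --> (f y)%:E.
  by apply: cvg_nnsfun_approx => // x _; rewrite lee_fin.
have gnd y : {homo (fun n => g n y) : a b / (a <= b)%N >-> a <= b}.
  by move=> a b ab; exact/lefP/nd_nnsfun_approx.
have cl : (\int[mu]_x (Z x * g n (G x))%:E)%E @[n --> \oo] -->
    (\int[mu]_x (Z x * f (G x))%:E)%E.
  rewrite [X in _ --> X](_ : _ =
      \int[mu]_x (limn (fun n => (Z x * g n (G x))%:E)))%E; last first.
    apply: eq_integral => x _; apply/esym/cvg_lim => //.
    under eq_fun do rewrite EFinM; rewrite EFinM.
    by apply: cvgeZl.
  apply: cvg_monotone_convergence => //.
  - move=> n; apply/measurable_EFinP; apply: measurable_funM => //.
    exact: (measurableT_comp (measurable_funPT (g n)) mG).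
  - by move=> n x _; rewrite lee_fin mulr_ge0.
  - by move=> x _ a b ab; rewrite lee_fin ler_wpM2l//; exact: gnd.
have cr : (c%:E * \int[nu]_x (g n (H x))%:E)%E @[n --> \oo] -->
    (c%:E * \int[nu]_x (f (H x))%:E)%E.
  apply: cvgeZl => //.
  rewrite [X in _ --> X](_ : _ =
      \int[nu]_x (limn (fun n => (g n (H x))%:E)))%E; last first.
    by apply: eq_integral => x _; apply/esym/cvg_lim.
  apply: cvg_monotone_convergence => //.
  - move=> n; apply/measurable_EFinP.
    exact: (measurableT_comp (measurable_funPT (g n)) mH).
  - by move=> n x _; rewrite lee_fin.
  - by move=> x _ a b ab; rewrite lee_fin; exact: gnd.
have E : (fun n => \int[mu]_x (Z x * g n (G x))%:E)%E =
    (fun n => c%:E * \int[nu]_x (g n (H x))%:E)%E.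
  by apply/funext => n; exact: nnsfun_integral_law.
rewrite E in cl.
exact: cvg_unique cl cr.
Qed.
End Transfer.

Section NonnegativeIntegrals.
Context d (T : measurableType d) (R : realType) (P : {measure set T -> \bar R}).
Implicit Types f g : T -> R.

Lemma ge0_integralZlR f (c : R) : measurable_fun setT f ->
  (forall w, 0 <= f w) -> 0 <= c ->
  (\int[P]_w (c * f w)%:E = c%:E * \int[P]_w (f w)%:E)%E.
Proof.
move=> mf f0 c0; under eq_integral do rewrite EFinM.
apply: ge0_integralZl_EFin => //.
- by move=> w _; rewrite lee_fin.
- exact/measurable_EFinP.
Qed.

Lemma ge0_integralDR f g : measurable_fun setT f -> measurable_fun setT g ->
  (forall w, 0 <= f w) -> (forall w, 0 <= g w) ->
  (\int[P]_w (f w + g w)%:E = \int[P]_w (f w)%:E + \int[P]_w (g w)%:E)%E.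
Proof.
move=> mf mg f0 g0; under eq_integral do rewrite EFinD.
apply: ge0_integralD => //.
- by move=> w _; rewrite lee_fin.
- exact/measurable_EFinP.
- by move=> w _; rewrite lee_fin.
- exact/measurable_EFinP.
Qed.

Lemma ge0_le_integralR f g : measurable_fun setT f -> measurable_fun setT g ->
  (forall w, 0 <= f w) -> (forall w, f w <= g w) ->
  (\int[P]_w (f w)%:E <= \int[P]_w (g w)%:E)%E.
Proof.
move=> mf mg f0 fg; apply: ge0_le_integral => //.
- by move=> w _; rewrite lee_fin.
- exact/measurable_EFinP.
- exact/measurable_EFinP.
- by move=> w _; rewrite lee_fin.
Qed.
End NonnegativeIntegrals.

Lemma ge0_integral_fine d (T : measurableType d) (R : realType)
    (P : {measure set T -> \bar R}) (f : T -> R) (a : R) :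
  (forall w, 0 <= f w) -> (\int[P]_w (f w)%:E <= a%:E)%E ->
  (\int[P]_w (f w)%:E)%E \is a fin_num.
Proof.
move=> f0 fa; rewrite ge0_fin_numE; first exact: le_lt_trans fa (ltry _).
by apply: integral_ge0 => w _; rewrite lee_fin.
Qed.

Lemma ge0_bounded_integrable d (T : measurableType d) (R : realType)
    (P : {measure set T -> \bar R}) (f : T -> R) (a : R) :
  measurable_fun setT f -> (forall w, 0 <= f w) ->
  (\int[P]_w (f w)%:E <= a%:E)%E -> P.-integrable setT (EFin \o f).
Proof.
move=> mf f0 fa; apply/integrableP; split; first exact/measurable_EFinP.
under eq_integral do rewrite /= ger0_norm//.
by apply: le_lt_trans fa (ltry _).
Qed.

(** * Products of independent variables *)

Section ProductExpectation.
Context d (T : measurableType d) (R : realType) (P : probability T R) (n : nat).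
Variables (F : 'I_n -> set (set T)) (G : 'I_n -> T -> R) (e : 'I_n -> R).
Hypothesis iF : independent_families P F.
Hypothesis FT : forall i, F i setT.
Hypothesis mF : forall i A, F i A -> measurable A.
Hypothesis GF : forall i B, measurable B -> F i (G i @^-1` B).
Hypothesis G0 : forall i w, 0 <= G i w.
Hypothesis Ge : forall i, (\int[P]_w (G i w)%:E = (e i)%:E)%E.

Let mG i : measurable_fun setT (G i).
Proof. by move=> _ B mB; rewrite setTI; apply: mF (GF _ mB). Qed.

(** The indicators are replaced by the functions [G i] one index at a time.  With
all other factors frozen in a weight, the statement for arbitrary indicators at
index [k] is the hypothesis of [ge0_integral_law]. *)
Lemma expectation_prod_partial (k : nat) (A : 'I_n -> set T) :
  (forall i, F i (A i)) ->
  (\int[P]_w (\prod_(i < n) (if (i < k)%N then G i w else \1_(A i) w))%:E =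
   (\prod_(i < n) (if (i < k)%N then e i else fine (P (A i))))%:E)%E.
Proof.
elim: k A => [|k IH] A FA.
  transitivity (\int[P]_w (\1_(\bigcap_(i in [set` [set: 'I_n]%SET]) A i) w)%:E)%E.
    apply: eq_integral => w _; congr EFin; rewrite indicE.
    have [wA|wA] := boolP (w \in _).
      rewrite big1// => i _; rewrite indicE mem_set//.
      by move: wA => /[!inE]; apply => /=; rewrite inE.
    apply/eqP/prodf_eq0.
    have : ~ (forall i, A i w).
      by move=> h; move/negP: wA; apply; rewrite inE => i _.
    move=> /existsNP[i Aiw]; exists i => //.
    by rewrite indicE memNset.
  rewrite integral_indic//; last first.
    apply: fin_bigcap_measurable => // i _; exact: mF (FA i).
  rewrite setIT; apply: etrans (@iF [set: 'I_n]%SET A (fun i _ => FA i)) _ => //.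
  rewrite (eq_bigl xpredT); last by move=> i; rewrite inE.
  rewrite -prodEFin; apply: eq_bigr => i _.
  by rewrite fineK//; apply: fin_num_measure; exact: mF (FA i).
have [kn|nk] := ltnP k n; last first.
  have E (i : 'I_n) : ((i < k.+1) = (i < k))%N.
    by rewrite !(leq_trans (ltn_ord i))// (leq_trans nk).
  under eq_integral do under eq_bigr do rewrite E.
  by under [in RHS]eq_bigr do rewrite E; exact: IH.
pose o := Ordinal kn.
have E (i : 'I_n) : i != o -> ((i < k.+1) = (i < k))%N.
  by move=> io; rewrite ltnS leq_eqVlt (negbTE (_ : i != k :> nat)).
pose Z w := \prod_(i < n | i != o) (if (i < k)%N then G i w else \1_(A i) w).
pose c := \prod_(i < n | i != o) (if (i < k)%N then e i else fine (P (A i))).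
have e0 i : 0 <= e i.
  by rewrite -lee_fin -Ge; apply: integral_ge0 => w _; rewrite lee_fin.
have Z0 w : 0 <= Z w.
  by apply: prodr_ge0 => i _; case: ifP => _ //; rewrite indicE.
have mZ : measurable_fun setT Z.
  rewrite /Z; under eq_fun do rewrite big_mkcond.
  apply: measurable_prod => i _; case: (i != o) => //; case: (i < k)%N => //.
  by apply: measurable_indic; exact: mF (FA i).
have key B : measurable B ->
    (\int[P]_(w in G o @^-1` B) (Z w)%:E = c%:E * P (G o @^-1` B))%E.
  move=> mB; pose A' i := if i == o then G o @^-1` B else A i.
  have FA' i : F i (A' i).
    by rewrite /A'; case: eqP => [->|_]; [exact: GF|exact: FA].
  have := IH A' FA'; rewrite (bigD1 o)//= /A' eqxx ltnn.
  under eq_bigr => i io do rewrite (negbTE io).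
  rewrite -/c EFinM fineK ?fin_num_measure//; last exact: mF (GF _ mB).
  rewrite muleC => <-; rewrite integral_mkcond; apply: eq_integral => w _.
  rewrite (bigD1 o)//= eqxx ltnn patchE indicE.
  under eq_bigr => i io do rewrite (negbTE io).
  by rewrite -/(Z w); case: ifP => _; rewrite ?mul1r ?mul0r.
have := ge0_integral_law mZ Z0 (mG o) (mG o) key
  (f := fun y => Num.max y 0).
have m0 i w : Num.max (G i w) 0 = G i w by exact/max_idPl.
have -> : (\int[P]_w (Num.max (G o w) 0)%:E = (e o)%:E)%E.
  by rewrite -Ge; apply: eq_integral => w _; rewrite m0.
rewrite -EFinM => h.
rewrite [RHS](_ : _ = (c * e o)%:E)%E; last first.
  rewrite (bigD1 o)//= ltnSn mulrC; congr (_ * _)%:E.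
  by apply: eq_bigr => i io; rewrite E.
rewrite -h; last first.
- by move=> y; rewrite le_max lexx orbT.
- exact: measurable_maxr.
apply: eq_integral => w _; rewrite m0 (bigD1 o)//= ltnSn mulrC.
by congr (_ * _)%:E; apply: eq_bigr => i io; rewrite E.
Qed.

Lemma expectation_prod :
  (\int[P]_w (\prod_i G i w)%:E = (\prod_i e i)%:E)%E.
Proof.
have := @expectation_prod_partial n (fun=> setT) FT.
under eq_integral do under eq_bigr do rewrite ltn_ord.
by under [X in _ = X%:E]eq_bigr do rewrite ltn_ord.
Qed.
End ProductExpectation.

(** * The variance of the normal law *)

Section GaussianVariance.
Context (R : realType).
Notation mu := (@lebesgue_measure R).
Implicit Types (k x : R).

Let w k x : R := expR (- (k * x ^+ 2)).

Let dw k x : is_derive x 1 (w k) (- (2 * k * x) * w k x).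
Proof.
have dg : is_derive x 1 (fun x => - (k * x ^+ 2)) (- (2 * k * x)).
  by apply: is_derive_eq; rewrite /GRing.scale/=; ring.
by rewrite mulrC; exact: (@is_derive1_comp _ expR _ x _ _ _ dg).
Qed.

Let cw k : continuous (w k).
Proof.
by move=> x; apply: differentiable_continuous; apply/derivable1_diffP;
   exact: (@ex_derive _ _ _ _ _ _ _ (dw k x)).
Qed.

Let cxw k : continuous (fun x : R => x ^+ 2 * w k x).
Proof. by move=> x; apply: cvgM; [exact: exprn_continuous|exact: cw]. Qed.

Let mw k : measurable_fun setT (w k).
Proof. exact: continuous_measurable_fun (@cw k). Qed.

Let mxw k : measurable_fun setT (fun x : R => x ^+ 2 * w k x).
Proof. exact: continuous_measurable_fun (@cxw k). Qed.

Let by_parts k (n : nat) : 0 < k ->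
  (\int[mu]_(x in `[0%R, n.+1%:R]) (x ^+ 2 * w k x)%:E
   + ((2 * k)^-1 * (n.+1%:R * w k n.+1%:R))%:E =
   (2 * k)^-1%:E * \int[mu]_(x in `[0%R, n.+1%:R]) (w k x)%:E)%E.
Proof.
move=> k0.
pose F (x : R) := (2 * k)^-1 * (x * w k x).
pose f (x : R) := (2 * k)^-1 * w k x - x ^+ 2 * w k x.
have dF (x : R) : is_derive x 1 F (f x).
  rewrite /F /f; have := dw k x => ?; apply: is_derive_eq.
  rewrite /GRing.scale/=; field; lra.
have cF : continuous F.
  by move=> x; apply: differentiable_continuous; apply/derivable1_diffP;
    exact: (@ex_derive _ _ _ _ _ _ _ (dF x)).
have cf : continuous f.
  move=> x; apply: cvgB; last exact: cxw.
  by apply: cvgMr; exact: cw.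
have ci (g : R -> R) : continuous g -> mu.-integrable `[0, n.+1%:R] (EFin \o g).
  move=> cg; apply: continuous_compact_integrable; first exact: segment_compact.
  exact: continuous_subspaceT.
have := @continuous_FTC2 R f F 0 n.+1%:R (ltr0Sn _ _)
  (continuous_subspaceT cf).
have -> : F 0 = 0 by rewrite /F mul0r mulr0.
rewrite sube0 => h.
rewrite -[X in X%:E]/(F _) -h; last 2 first.
- split.
  + by move=> x _; exact: (@ex_derive _ _ _ _ _ _ _ (dF x)).
  + by apply: cvg_at_right_filter; exact: cF.
  + by apply: cvg_at_left_filter; exact: cF.
- by move=> x _; rewrite derive1E; exact: (@derive_val _ _ _ _ _ _ _ (dF x)).
rewrite -(@integralD_EFin _ _ _ mu _ _ (fun x => x ^+ 2 * w k x) f)//; last 2 first.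
- by apply: ci; exact: cxw.
- by apply: ci.
rewrite -integralZl//; last exact: (ci _ (@cw k)).
by apply: eq_integral => x _ /=; rewrite -EFinM; congr EFin; rewrite /f /=; ring.
Qed.

(** The derivative of [x exp (- k x ^ 2)] is [exp (- k x ^ 2)] minus [2 k] times
the integrand, and its integral over [0, n] vanishes in the limit. *)
Lemma integral_gauss_sqr k : 0 < k ->
  (\int[mu]_x (x ^+ 2 * w k x)%:E = (2 * k)^-1%:E * \int[mu]_x (w k x)%:E)%E.
Proof.
move=> k0.
have w0 x : 0 <= w k x by exact: expR_ge0.
have xw0 x : 0 <= x ^+ 2 * w k x by rewrite mulr_ge0 ?sqr_ge0.
rewrite (@ge0_symfun_integralT R (fun x => x ^+ 2 * w k x) xw0 (@cxw k)); last first.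
  by move=> x; rewrite /w /= sqrrN.
rewrite (@ge0_symfun_integralT R (w k) (w0) (@cw k)); last first.
  by move=> x; rewrite /w /= sqrrN.
rewrite muleCA; congr (_ * _)%E.
have -> : [set x : R | 0 <= x] = \bigcup_n `[0, n.+1%:R]%classic.
  apply/seteqP; split=> x /=.
    move=> x0; exists (Num.truncn x) => //=; rewrite in_itv/= x0/=.
    by rewrite ltW// truncnS_gt.
  by move=> [n _] /=; rewrite in_itv/= => /andP[].
have nd : nondecreasing_seq (fun n => `[0, n.+1%:R]%classic : set R).
  move=> a b ab; apply/subsetPset => x /=; rewrite !in_itv/= => /andP[-> xa]/=.
  by rewrite (le_trans xa)// ler_nat ltnS.
have c1 : (\int[mu]_(x in `[0%R, n.+1%:R]) (x ^+ 2 * w k x)%:E)%E @[n --> \oo] -->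
   (\int[mu]_(x in \bigcup_n `[0%R, n.+1%:R]%classic) (x ^+ 2 * w k x)%:E)%E.
  apply: (@ge0_nondecreasing_set_cvg_integral _ (measurableTypeR R) R
    (fun n => `[0, n.+1%:R]%classic) (fun x => (x ^+ 2 * w k x)%:E) mu) => //.
  - by move=> i; apply/measurable_EFinP/measurable_funTS; exact: mxw.
  - by move=> i x _; rewrite lee_fin.
have c2 : (\int[mu]_(x in `[0%R, n.+1%:R]) (w k x)%:E)%E @[n --> \oo] -->
   (\int[mu]_(x in \bigcup_n `[0%R, n.+1%:R]%classic) (w k x)%:E)%E.
  apply: (@ge0_nondecreasing_set_cvg_integral _ (measurableTypeR R) R
    (fun n => `[0, n.+1%:R]%classic) (fun x => (w k x)%:E) mu) => //.
  - by move=> i; apply/measurable_EFinP/measurable_funTS; exact: mw.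
  - by move=> i x _; rewrite lee_fin.
have c3 : ((2 * k)^-1 * (n.+1%:R * w k n.+1%:R)) @[n --> \oo] --> (0 : R).
  rewrite -[X in _ --> X](mulr0 (2 * k)^-1); apply: cvgMr.
  apply: (@squeeze_cvgr _ _ _ _ (fun=> 0) (fun n => k^-1 * n.+1%:R^-1)).
  - apply: nearW => n; rewrite mulr_ge0//=.
    have n0 : 0 < n.+1%:R :> R by rewrite ltr0n.
    have e1 := expR_ge1Dx (k * n.+1%:R ^+ 2).
    rewrite /w expRN -invfM ler_pdivrMr ?expR_gt0//.
    rewrite mulrC ler_pdivlMr ?mulr_gt0//.
    apply: le_trans e1; lra.
  - exact: cvg_cst.
  - rewrite -[X in _ --> X](mulr0 k^-1); apply: cvgMr.
    exact: cvg_harmonic.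
have c3' : ((2 * k)^-1 * (n.+1%:R * w k n.+1%:R))%:E @[n --> \oo] --> (0%:E : \bar R).
  by apply: cvg_EFin => //; exact: nearW.
have c4 := cvgeD (fin_num_adde_defl _ (isT : (0%:E : \bar R) \is a fin_num)) c1 c3'.
rewrite adde0 in c4.
have c5 : ((2 * k)^-1%:E * \int[mu]_(x in `[0%R, n.+1%:R]) (w k x)%:E)%E
    @[n --> \oo] -->
   ((2 * k)^-1%:E * \int[mu]_(x in \bigcup_n `[0%R, n.+1%:R]%classic) (w k x)%:E)%E.
  exact: cvgeZl.
rewrite -(cvg_lim _ (c4 _))// -(cvg_lim _ c5)//.
by apply: congr_lim; apply/funext => n /=; rewrite by_parts.
Qed.
End GaussianVariance.

(** * Exponential moments of sums of products *)

Section ExponentialBounds.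
Context (R : realType).
Implicit Types (u t y r s : R).

Lemma expR_le_quadratic u : expR u <= 1 + u + u ^+ 2 * expR `|u|.
Proof.
have e0 : 0 < expR u by exact: expR_gt0.
(* 1 - u <= exp (- u) gives exp u - 1 <= u * exp u *)
have h1 : expR u - 1 <= u * expR u.
  have := expR_ge1Dx (- u); rewrite expRN.
  move/(ler_wpM2l (ltW e0)); rewrite divff ?gt_eqF//; lra.
have h2 := expR_ge1Dx u.
have [u0|u0] := leP 0 u.
  rewrite ger0_norm//; have := ler_wpM2l u0 h1; lra.
have e1 : 1 <= expR `|u| by rewrite -expR0 ler_expR.
have : u * (expR u - 1) <= u ^+ 2.
  rewrite expr2; nra.
have := ler_wpM2l (sqr_ge0 u) e1; lra.
Qed.

Lemma sqr_le_expR u : 0 <= u -> u ^+ 2 <= 2 * expR u.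
Proof.
move=> u0; have := expR_ge1Dxn 1 u0; rewrite (_ : 2`!%:R = 2 :> R)//; lra.
Qed.

(** The quadratic factor of [expR_le_quadratic] is absorbed by an exponential of
rate [3 r / 4], and the tilt [t] uses up the remaining [r / 4]; the resulting
[exp (r |U V|)] is split between [U] and [V] by convexity.  The constants are
tight enough for [penalty_exponent]. *)
Lemma expR_product_quadratic (U V s0 : R) r s t : 0 < r -> `|s0| <= s ->
  `|t| <= r / 4 ->
  expR (t * (U * V - s0)) <= 1 + t * (U * V - s0)
    + t ^+ 2 * (expR (r * s / 4) * (8 / r ^+ 2 + 2 * s ^+ 2))
      * (2^-1 * (expR (r * U ^+ 2) + expR (r * V ^+ 2))).
Proof.
move=> r0 s0s tr.
have s_ge0 : 0 <= s by exact: le_trans s0s.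
have [W WE] : exists W : R, W = `|U * V| by exists `|U * V|.
set Y := U * V - s0.
have W0 : 0 <= W by rewrite WE.
have YW : `|Y| <= W + s.
  by rewrite (le_trans (ler_normB _ _))// WE lerD2l.
apply: le_trans (expR_le_quadratic _) _; rewrite lerD2l exprMn.
rewrite -[leLHS]mulrA -[leRHS]mulrA; apply: ler_wpM2l; first exact: sqr_ge0.
have Y2 : Y ^+ 2 <= 2 * W ^+ 2 + 2 * s ^+ 2.
  rewrite -real_normK ?num_real//.
  have : `|Y| ^+ 2 <= (W + s) ^+ 2 by rewrite ler_sqr ?nnegrE ?addr_ge0.
  have := sqr_ge0 (W - s); rewrite !expr2 => h1 h2; nra.
have E1 : expR `|t * Y| <= expR (r * s / 4) * expR (r * W / 4).
  rewrite -expRD ler_expR normrM.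
  have := ler_pM (normr_ge0 t) (normr_ge0 Y) tr YW; lra.
have E2 : W ^+ 2 <= 32 / 9 / r ^+ 2 * expR (3 / 4 * r * W).
  have h : 0 <= 3 / 4 * r * W by rewrite !mulr_ge0//; lra.
  have -> : W ^+ 2 = (3 / 4 * r * W) ^+ 2 * (16 / 9 / r ^+ 2) by field; lra.
  have -> : 32 / 9 / r ^+ 2 * expR (3 / 4 * r * W) =
    2 * expR (3 / 4 * r * W) * (16 / 9 / r ^+ 2) by field; lra.
  by apply: ler_wpM2r (sqr_le_expR h); rewrite divr_ge0 ?sqr_ge0//; lra.
have r2 : 0 < r ^+ 2 by rewrite exprn_gt0.
have E3 : expR (3 / 4 * r * W) * expR (r * W / 4) = expR (r * W).
  by rewrite -expRD; congr expR; field.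
have rW : 0 <= r * W by rewrite mulr_ge0// ltW.
have E4 : expR (r * W / 4) <= expR (r * W) by rewrite ler_expR; lra.
have E5 : expR (r * W) <= 2^-1 * (expR (r * U ^+ 2) + expR (r * V ^+ 2)).
  have W2 : 2 * W <= U ^+ 2 + V ^+ 2.
    have := sqr_ge0 (U - V); have := sqr_ge0 (U + V); rewrite WE.
    by case: (ger0P (U * V)) => h; lra.
  have : expR (r * W) <= expR (r * U ^+ 2 / 2) * expR (r * V ^+ 2 / 2).
    by rewrite -expRD ler_expR; have := ler_wpM2l (ltW r0) W2; lra.
  have a0 := expR_gt0 (r * U ^+ 2 / 2); have b0 := expR_gt0 (r * V ^+ 2 / 2).
  have sq y : expR y = expR (y / 2) ^+ 2.
    by rewrite expr2 -expRD; congr expR; field.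
  rewrite (sq (r * U ^+ 2)) (sq (r * V ^+ 2)).
  have := sqr_ge0 (expR (r * U ^+ 2 / 2) - expR (r * V ^+ 2 / 2)); lra.
have es0 := expR_gt0 (r * s / 4).
have ew0 := expR_gt0 (r * W / 4).
have e30 := expR_gt0 (3 / 4 * r * W).
have h6 : (2 * W ^+ 2 + 2 * s ^+ 2) * expR (r * W / 4) <=
    (8 / r ^+ 2 + 2 * s ^+ 2) * expR (r * W).
  rewrite mulrDl [leRHS]mulrDl; apply: lerD; last first.
    by apply: ler_wpM2l => //; rewrite mulr_ge0// sqr_ge0.
  rewrite -E3 [leRHS]mulrA; apply: ler_wpM2r; first exact: ltW.
  have h : 32 / 9 / r ^+ 2 * expR (3 / 4 * r * W) <= 4 / r ^+ 2 * expR (3 / 4 * r * W).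
    apply: ler_wpM2r; first exact: ltW.
    by apply: ler_wpM2r; [rewrite invr_ge0 ltW|lra].
  have -> : 8 / r ^+ 2 * expR (3 / 4 * r * W) = 2 * (4 / r ^+ 2 * expR (3 / 4 * r * W)).
    by field; lra.
  by rewrite ler_pM2l//; apply: le_trans h.
apply: le_trans (_ : (2 * W ^+ 2 + 2 * s ^+ 2) * (expR (r * s / 4) * expR (r * W / 4)) <= _).
  apply: ler_pM => //; exact: sqr_ge0.
rewrite mulrCA -[leRHS]mulrA; apply: ler_wpM2l; first exact: ltW.
apply: le_trans h6 _; apply: ler_wpM2l => //.
by rewrite addr_ge0// ?divr_ge0 ?mulr_ge0 ?sqr_ge0// ltW.
Qed.
End ExponentialBounds.

(** The logarithm of the exponential moment of [U V - E (U V)] at tilt [t] is at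
most [t ^ 2] times this quantity. *)
Definition mgf_rate (R : realType) (K r s : R) : R :=
  K * (expR (r * s / 4) * (8 / r ^+ 2 + 2 * s ^+ 2)).

Section ProductMgf.
Context d (T : measurableType d) (R : realType) (P : probability T R).
Variables (U V : T -> R) (K r s s0 : R).
Hypotheses (mU : measurable_fun setT U) (mV : measurable_fun setT V).
Hypothesis r0 : 0 < r.
Hypothesis UK : (\int[P]_w (expR (r * U w ^+ 2))%:E <= K%:E)%E.
Hypothesis VK : (\int[P]_w (expR (r * V w ^+ 2))%:E <= K%:E)%E.

Let mexp (f : T -> R) : measurable_fun setT f ->
  measurable_fun setT (fun w => expR (r * f w ^+ 2)).
Proof.
move=> mf; apply: measurableT_comp => //; apply: measurable_funM => //.
exact: measurable_funX.
Qed.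

Lemma integrable_product : P.-integrable setT (EFin \o (fun w => U w * V w)).
Proof.
apply: (@le_integrable _ _ _ P setT measurableT _
  (fun w => (r^-1 * (expR (r * U w ^+ 2) + expR (r * V w ^+ 2)))%:E)).
- by apply/measurable_EFinP; exact: measurable_funM.
- move=> w _ /=; rewrite lee_fin [leRHS]ger0_norm; last first.
    by rewrite mulr_ge0 ?addr_ge0 ?expR_ge0// invr_ge0 ltW.
  have := expR_ge1Dx (r * U w ^+ 2); have := expR_ge1Dx (r * V w ^+ 2).
  move=> h1 h2; rewrite ler_pdivlMl//.
  have h : 2 * `|U w * V w| <= U w ^+ 2 + V w ^+ 2.
    have := sqr_ge0 (U w - V w); have := sqr_ge0 (U w + V w).
    by case: (ger0P (U w * V w)) => h; lra.
  have W0 : 0 <= r * `|U w * V w| by rewrite mulr_ge0 // ltW.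
  have := ler_wpM2l (ltW r0) h; lra.
- under eq_fun do rewrite EFinM; apply: integrableZl => //.
  under eq_fun do rewrite EFinD.
  apply: integrableD => //.
  + exact: (ge0_bounded_integrable (mexp mU) (fun=> expR_ge0 _) UK).
  + exact: (ge0_bounded_integrable (mexp mV) (fun=> expR_ge0 _) VK).
Qed.

Hypothesis UVs : (\int[P]_w (U w * V w)%:E = s0%:E)%E.
Hypothesis s0s : `|s0| <= s.

(** The linear term of [expR_product_quadratic] has mean zero. *)
Lemma mgf_product t : `|t| <= r / 4 ->
  (\int[P]_w (expR (t * (U w * V w - s0)))%:E
     <= (expR (t ^+ 2 * mgf_rate K r s))%:E)%E.
Proof.
move=> tr.
pose c := t ^+ 2 * (expR (r * s / 4) * (8 / r ^+ 2 + 2 * s ^+ 2)).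
have c0 : 0 <= c.
  rewrite /c mulr_ge0 ?sqr_ge0// mulr_ge0 ?expR_ge0// addr_ge0//.
    by rewrite divr_ge0// sqr_ge0.
  by rewrite mulr_ge0// sqr_ge0.
pose H w := c * (2^-1 * (expR (r * U w ^+ 2) + expR (r * V w ^+ 2))).
pose Q w := 1 + t * (U w * V w - s0) + H w.
have mUV : measurable_fun setT (fun w => U w * V w) by exact: measurable_funM.
have mE1 := mexp mU; have mE2 := mexp mV.
have mH : measurable_fun setT H.
  apply: measurable_funM => //; apply: measurable_funM => //.
  exact: measurable_funD.
have le1 w : expR (t * (U w * V w - s0)) <= Q w by exact: expR_product_quadratic.
have iH : (\int[P]_w (H w)%:E <= (c * K)%:E)%E.
  have m12 : measurable_fun setT (fun w => expR (r * U w ^+ 2) + expR (r * V w ^+ 2)).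
    exact: measurable_funD.
  have p12 w : 0 <= expR (r * U w ^+ 2) + expR (r * V w ^+ 2).
    by rewrite addr_ge0 ?expR_ge0.
  have p3 w : 0 <= 2^-1 * (expR (r * U w ^+ 2) + expR (r * V w ^+ 2)).
    by rewrite mulr_ge0.
  rewrite (ge0_integralZlR _ _ p3 c0); last exact: measurable_funM.
  rewrite (EFinM c K); apply: lee_wpmul2l; first by rewrite lee_fin.
  rewrite ge0_integralZlR// ge0_integralDR//.
  rewrite (_ : K%:E = 2^-1%:E * (K%:E + K%:E))%E; last first.
    by rewrite -EFinD -EFinM; congr EFin; field.
  by apply: lee_wpmul2l; rewrite ?lee_fin// leeD.
have H0 w : 0 <= H w.
  by apply: mulr_ge0 => //; apply: mulr_ge0 => //; rewrite addr_ge0 ?expR_ge0.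
have intH := ge0_bounded_integrable mH H0 iH.
have intUV := integrable_product.
have intc (a : R) : P.-integrable setT (EFin \o cst a).
  exact: finite_measure_integrable_cst.
have intL : P.-integrable setT (EFin \o (fun w => 1 + t * (U w * V w - s0))).
  rewrite (_ : _ \o _ = (fun w => (1 - t * s0)%:E + t%:E * (U w * V w)%:E)%E).
    by apply: integrableD => //; [exact: intc|exact: integrableZl].
  by apply/funext => w /=; rewrite -EFinM -EFinD; congr EFin; ring.
have intLE : (\int[P]_w (1 + t * (U w * V w - s0))%:E = 1)%E.
  transitivity (\int[P]_w ((1 - t * s0)%:E + t%:E * (U w * V w)%:E))%E.
    by apply: eq_integral => w _; rewrite -EFinM -EFinD; congr EFin; ring.
  rewrite integralD//; [|exact: intc|exact: integrableZl].
  rewrite integralZl// UVs integral_cst//= probability_setT mule1.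
  by rewrite -EFinM -EFinD; congr EFin; ring.
apply: (@le_trans _ _ (\int[P]_w (Q w)%:E)%E).
  apply: ge0_le_integralR => //.
  - apply: measurableT_comp => //.
    by apply: measurable_funM => //; exact: measurable_funB.
  - apply: measurable_funD => //.
    apply: measurable_funD => //; apply: measurable_funM => //.
    exact: measurable_funB.
rewrite (_ : (fun w => _) = (fun w => (1 + t * (U w * V w - s0))%:E + (H w)%:E)%E); last first.
  by apply/funext => w; rewrite -EFinD.
rewrite integralD// intLE.
apply: (@le_trans _ _ (1 + c * K)%:E).
  by rewrite EFinD leeD2l.
rewrite lee_fin; apply: le_trans (expR_ge1Dx _) _.
rewrite ler_expR /c /mgf_rate le_eqVlt; apply/orP; left; apply/eqP; ring.
Qed.
End ProductMgf.

Section SumMgf.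
Context d (T : measurableType d) (R : realType) (P : probability T R) (n : nat).
Variables (F : 'I_n -> set (set T)).
Hypothesis iF : independent_families P F.
Hypothesis FT : forall i, F i setT.
Hypothesis mF : forall i A, F i A -> measurable A.
Variables (U V : 'I_n -> T -> R) (K r s s0 : R).
Hypotheses (mU : forall i, measurable_fun setT (U i)).
Hypotheses (mV : forall i, measurable_fun setT (V i)).
Hypothesis UVF : forall i B, measurable B ->
  F i ((fun w => U i w * V i w) @^-1` B).
Hypothesis r0 : 0 < r.
Hypothesis UK : forall i, (\int[P]_w (expR (r * U i w ^+ 2))%:E <= K%:E)%E.
Hypothesis VK : forall i, (\int[P]_w (expR (r * V i w ^+ 2))%:E <= K%:E)%E.
Hypothesis UVs : forall i, (\int[P]_w (U i w * V i w)%:E = s0%:E)%E.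
Hypothesis s0s : `|s0| <= s.

Lemma mgf_sum t : `|t| <= r / 4 ->
  (\int[P]_w (expR (t * \sum_i (U i w * V i w - s0)))%:E
     <= (expR (n%:R * (t ^+ 2 * mgf_rate K r s)))%:E)%E.
Proof.
move=> tr.
pose G i w := expR (t * (U i w * V i w - s0)).
have G0 i w : 0 <= G i w by exact: expR_ge0.
have Gle i : (\int[P]_w (G i w)%:E <= (expR (t ^+ 2 * mgf_rate K r s))%:E)%E.
  exact: mgf_product.
have Ge i := fineK (ge0_integral_fine (G0 i) (Gle i)).
have := expectation_prod iF FT mF (G := G) _ G0 (fun i => esym (Ge i)).
move=> /(_ _)/wrap[].
  move=> i B mB.
  have -> : G i @^-1` B = (fun w => U i w * V i w) @^-1`
     ((fun y => expR (t * (y - s0))) @^-1` B) by [].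
  apply: UVF; rewrite -[X in measurable X]setTI.
  suff : measurable_fun setT (fun y : R => expR (t * (y - s0))) by exact.
  apply: measurableT_comp => //; apply: measurable_funM => //.
  exact: measurable_funB.
move=> h.
under eq_integral do rewrite mulr_sumr expR_sum.
rewrite h lee_fin expRM_natl.
rewrite -[X in _ ^+ X](card_ord n) -prodr_const; apply: ler_prod => i _.
rewrite fine_ge0/=; last by apply: integral_ge0 => w _; rewrite lee_fin.
by rewrite -lee_fin Ge.
Qed.
Hypothesis n0 : (0 < n)%N.

Let dev w := n%:R^-1 * (\sum_i U i w * V i w) - s0.

Lemma measurable_mean_dev : measurable_fun setT dev.
Proof.
apply: measurable_funB => //; apply: measurable_funM => //.
by apply: measurable_sum => i; exact: measurable_funM.
Qed.

(** The second moment, the expected squared excess and the tail of the mean are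
all of this form, with different [f], [c] and [t]. *)
Lemma integral_mean_dev (f : R -> R) (c t : R) : measurable_fun setT f ->
  (forall y, 0 <= f y) -> 0 <= c -> `|t| <= r / 4 ->
  (forall y, f y <= c * (expR (t * (n%:R * y)) + expR (- t * (n%:R * y)))) ->
  (\int[P]_w (f (dev w))%:E
     <= (2 * c * expR (n%:R * (t ^+ 2 * mgf_rate K r s)))%:E)%E.
Proof.
move=> mf f0 c0 tr fc.
have mdev := measurable_mean_dev.
have mE (a : R) : measurable_fun setT (fun w => expR (a * (n%:R * dev w))).
  by apply: measurableT_comp => //; apply: measurable_funM => //; exact: measurable_funM.
have nE w : n%:R * dev w = \sum_i (U i w * V i w - s0).
  rewrite sumrB sumr_const card_ord /dev mulrBr mulVKf ?pnatr_eq0 -?lt0n//.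
  by rewrite mulr_natl.
have b a : `|a| <= r / 4 -> (\int[P]_w (expR (a * (n%:R * dev w)))%:E
     <= (expR (n%:R * (a ^+ 2 * mgf_rate K r s)))%:E)%E.
  by move=> ar; under eq_integral do rewrite nE; exact: mgf_sum.
apply: (@le_trans _ _
  (\int[P]_w (c * (expR (t * (n%:R * dev w)) + expR (- t * (n%:R * dev w))))%:E)%E).
  apply: ge0_le_integralR => //; first exact: measurableT_comp.
  by apply: measurable_funM => //; apply: measurable_funD.
have p0 w : 0 <= expR (t * (n%:R * dev w)) + expR (- t * (n%:R * dev w)).
  by rewrite addr_ge0 ?expR_ge0.
rewrite (ge0_integralZlR _ _ p0 c0); last exact: measurable_funD.
rewrite ge0_integralDR//.
rewrite (_ : 2 * c * _ = c * (expR (n%:R * (t ^+ 2 * mgf_rate K r s)) +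
     expR (n%:R * ((- t) ^+ 2 * mgf_rate K r s)))); last first.
    by rewrite sqrrN; ring.
rewrite (EFinM c); apply: lee_wpmul2l; first by rewrite lee_fin.
by rewrite EFinD; apply: leeD; apply: b; rewrite ?normrN.
Qed.

(** A tilt of order [1 / sqrt n] keeps the exponent bounded in [n]. *)
Lemma integral_mean_dev_sqr :
  (\int[P]_w (dev w ^+ 2)%:E
     <= (64 / r ^+ 2 * expR (r ^+ 2 / 16 * mgf_rate K r s) / n%:R)%:E)%E.
Proof.
have nr0 : 0 < n%:R :> R by rewrite ltr0n.
pose q := Num.sqrt n%:R : R.
have q0 : 0 < q by rewrite sqrtr_gt0.
have qE : n%:R = q ^+ 2 by rewrite sqr_sqrtr// ltW.
have q1 : 1 <= q by rewrite -sqrtr1 ler_wsqrtr// ler1n.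
pose t := r / 4 / q.
have := @integral_mean_dev (fun y => y ^+ 2) (32 / r ^+ 2 / n%:R) t.
move=> /(_ _ _ _ _ _)/wrap[].
- exact: measurable_funX.
- by move=> y; exact: sqr_ge0.
- by rewrite !divr_ge0 ?sqr_ge0.
- rewrite ger0_norm; last by rewrite !divr_ge0// ltW.
  by rewrite ler_pdivrMr// ler_peMr// divr_ge0// ltW.
- move=> y; set u := t * (n%:R * y).
  have -> : - t * (n%:R * y) = - u by rewrite /u mulNr.
  have -> : y ^+ 2 = 16 / r ^+ 2 / n%:R * u ^+ 2.
    by rewrite /u /t qE; field; rewrite ?gt_eqF.
  have -> : 32 / r ^+ 2 / n%:R * (expR u + expR (- u)) =
     16 / r ^+ 2 / n%:R * (2 * (expR u + expR (- u))) by field; rewrite ?gt_eqF.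
  apply: ler_wpM2l; first by rewrite !divr_ge0 ?sqr_ge0.
  have := sqr_le_expR (normr_ge0 u); rewrite real_normK ?num_real//.
  have := expR_gt0 u; have := expR_gt0 (- u).
  by case: (ger0P u) => _; lra.
move=> h; apply: le_trans h _; rewrite lee_fin le_eqVlt; apply/orP; left.
apply/eqP; rewrite (_ : n%:R * (t ^+ 2 * _) = r ^+ 2 / 16 * mgf_rate K r s).
  by field; rewrite ?gt_eqF.
by rewrite /t qE; field; rewrite ?gt_eqF.
Qed.

(** The squared positive part of [u] is at most [2 / s ^ 2 * exp (s u)], used with
[s = t n]. *)
Lemma integral_mean_dev_excess (t l : R) : 0 < t -> t <= r / 4 ->
  (\int[P]_w ((Num.max (`|dev w| - l) 0) ^+ 2)%:E
     <= (4 / (t * n%:R) ^+ 2 *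
         expR (n%:R * (t ^+ 2 * mgf_rate K r s) - t * (n%:R * l)))%:E)%E.
Proof.
move=> t0 tr; have nr0 : 0 < n%:R :> R by rewrite ltr0n.
pose c := 2 / (t * n%:R) ^+ 2 * expR (- (t * (n%:R * l))).
have := @integral_mean_dev (fun y => (Num.max (`|y| - l) 0) ^+ 2) c t.
have tn0 : 0 < t * n%:R by rewrite mulr_gt0.
move=> /(_ _ _ _ _ _)/wrap[].
- apply: measurable_funX; apply: measurable_maxr => //.
  by apply: measurable_funB => //; exact: measurableT_comp.
- by move=> y; exact: sqr_ge0.
- by rewrite /c mulr_ge0 ?expR_ge0// divr_ge0// sqr_ge0.
- by rewrite ger0_norm// ltW.
- move=> y.
  have hc a : c * expR a = 2 / (t * n%:R) ^+ 2 * expR (a - t * (n%:R * l)).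
    by rewrite /c -mulrA -expRD addrC.
  have e1 := expR_gt0 (t * (n%:R * y)); have e2 := expR_gt0 (- t * (n%:R * y)).
  have c0 : 0 < c by rewrite /c mulr_gt0 ?expR_gt0// divr_gt0// exprn_gt0.
  have : Num.max (`|y| - l) 0 ^+ 2 <= c * expR (t * (n%:R * `|y|)).
    rewrite hc; set z := t * (n%:R * `|y|) - _.
    have zE : `|y| - l = z / (t * n%:R) by rewrite /z; field; rewrite ?gt_eqF.
    rewrite zE; case: (leP (z / (t * n%:R)) 0) => h.
      by rewrite expr0n/= mulr_ge0 ?expR_ge0// divr_ge0// sqr_ge0.
    have z0 : 0 <= z by rewrite ltW// -(pmulr_lgt0 _ (_ : 0 < (t * n%:R)^-1))// invr_gt0.
    have := sqr_le_expR z0 => h2.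
    by rewrite expr_div_n [leRHS]mulrAC; apply: ler_wpM2r; rewrite ?invr_ge0 ?sqr_ge0.
  move=> h; apply: le_trans h _.
  apply: ler_wpM2l; first exact: ltW.
  case: (ger0P y) => _; first by rewrite lerDl ltW.
  by rewrite mulrN mulrN -mulNr lerDr ltW.
move=> h; apply: le_trans h _; rewrite lee_fin le_eqVlt; apply/orP; left.
by apply/eqP; rewrite expRD /c; ring.
Qed.

Lemma prob_mean_dev (t l : R) : 0 < t -> t <= r / 4 ->
  (P [set w | (l < `|dev w|)%R]
     <= (2 * expR (n%:R * (t ^+ 2 * mgf_rate K r s) - t * (n%:R * l)))%:E)%E.
Proof.
move=> t0 tr; have nr0 : 0 < n%:R :> R by rewrite ltr0n.
pose c := expR (- (t * (n%:R * l))).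
pose A : set R := [set y | l < `|y|].
have mA : measurable A.
  have -> : A = (@Num.norm R R) @^-1` `]l, +oo[.
    by apply/seteqP; split => y /=; rewrite in_itv/= andbT.
  rewrite -[X in measurable X]setTI.
  by have := @normr_measurable R setT; apply.
have := @integral_mean_dev (\1_A) c t.
have tn0 : 0 < t * n%:R by rewrite mulr_gt0.
move=> /(_ _ _ _ _ _)/wrap[].
- exact: measurable_indic.
- by move=> y; rewrite indicE.
- exact: expR_ge0.
- by rewrite ger0_norm// ltW.
- move=> y; rewrite mulrDr /c -!expRD indicE.
  have e1 (a : R) := expR_gt0 a.
  have [/[!inE]/= yA|yA] := boolP (y \in A); last by rewrite addr_ge0 ?expR_ge0.
  have : 1 <= expR (- (t * (n%:R * l)) + t * (n%:R * `|y|)).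
    rewrite -[leLHS]expR0 ler_expR addrC subr_ge0 ler_wpM2l ?ltW//.
    by rewrite ltr_pM2l.
  move=> h; apply: le_trans h _.
  case: (ger0P y) => _; first by rewrite lerDl ltW.
  by rewrite mulrN mulrN -mulNr lerDr ltW.
move=> h; apply: le_trans (le_trans h _); last first.
  rewrite lee_fin le_eqVlt; apply/orP; left.
  by apply/eqP; rewrite expRD /c; ring.
have mdev := measurable_mean_dev.
have mDA : measurable (dev @^-1` A).
  by rewrite -[X in measurable X]setTI; exact: mdev.
rewrite -[X in (X <= _)%E](_ : (\int[P]_w (\1_(dev @^-1` A) w)%:E = _)%E) //.
by rewrite integral_indic// setIT.
Qed.
End SumMgf.

(** * Bilinear forms *)

Section BilinearForm.
Context (R : realType) (p : nat).
Implicit Types (S A : 'M[R]_p) (u v w : 'cV[R]_p).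

Definition bil S u v : R := (u^T *m S *m v) 0 0.

Lemma bilDl S u v w : bil S (u + v) w = bil S u w + bil S v w.
Proof. by rewrite /bil linearD/= !mulmxDl mxE. Qed.
Lemma bilDr S u v w : bil S w (u + v) = bil S w u + bil S w v.
Proof. by rewrite /bil mulmxDr mxE. Qed.
Lemma bilZl S c u v : bil S (c *: u) v = c * bil S u v.
Proof. by rewrite /bil linearZ/= -!scalemxAl mxE. Qed.
Lemma bilZr S c u v : bil S u (c *: v) = c * bil S u v.
Proof. by rewrite /bil -scalemxAr mxE. Qed.
Lemma bilNl S u v : bil S (- u) v = - bil S u v.
Proof. by rewrite -scaleN1r bilZl mulN1r. Qed.
Lemma bilNr S u v : bil S u (- v) = - bil S u v.
Proof. by rewrite -scaleN1r bilZr mulN1r. Qed.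
Lemma bilBl S u v w : bil S (u - v) w = bil S u w - bil S v w.
Proof. by rewrite bilDl bilNl. Qed.
Lemma bilBr S u v w : bil S w (u - v) = bil S w u - bil S w v.
Proof. by rewrite bilDr bilNr. Qed.
Lemma bil0r S u : bil S u 0 = 0.
Proof. by rewrite /bil mulmx0 mxE. Qed.

Lemma bilC S u v : S^T = S -> bil S u v = bil S v u.
Proof.
move=> St; transitivity ((u^T *m S *m v)^T 0 0); first by rewrite mxE.
by rewrite !trmx_mul trmxK St mulmxA.
Qed.

Lemma bilBmx S A u v : bil (S - A) u v = bil S u v - bil A u v.
Proof. by rewrite /bil mulmxBr mulmxBl !mxE. Qed.
Lemma bil_delta S i j : bil S (delta_mx i 0) (delta_mx j 0) = S i j.
Proof. by rewrite /bil trmx_delta -rowE -colE !mxE. Qed.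

Lemma bilE S u v : bil S u v = \sum_i \sum_j u i 0 * S i j * v j 0.
Proof.
rewrite /bil !mxE exchange_big/=; apply: eq_bigr => j _.
by rewrite mxE mulr_suml; apply: eq_bigr => i _; rewrite mxE.
Qed.

Definition sqn u : R := \sum_i u i 0 ^+ 2.

Lemma sqn_ge0 u : 0 <= sqn u.
Proof. by apply: sumr_ge0 => i _; exact: sqr_ge0. Qed.

Lemma bil1 u v : bil 1%:M u v = \sum_i u i 0 * v i 0.
Proof. by rewrite /bil mulmx1 mxE; apply: eq_bigr => i _; rewrite mxE. Qed.

Lemma sqnE u : sqn u = bil 1%:M u u.
Proof. by rewrite bil1; apply: eq_bigr => i _; rewrite expr2. Qed.

Lemma bil_scalar (c : R) u v : bil c%:M u v = c * bil 1%:M u v.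
Proof. by rewrite /bil mul_mx_scalar -scalemxAl mulmx1 mxE. Qed.

Lemma sqn_eq0 u : sqn u = 0 -> u = 0.
Proof.
move=> h; apply/matrixP => i j; rewrite (ord1 j) mxE; apply/eqP.
have : u i 0 ^+ 2 <= 0.
  by rewrite -h /sqn (bigD1 i)//= lerDl sumr_ge0// => k _; exact: sqr_ge0.
by move=> h2; rewrite -sqrf_eq0 eq_le h2 sqr_ge0.
Qed.

Lemma sqnZ c u : sqn (c *: u) = c ^+ 2 * sqn u.
Proof. by rewrite !sqnE bilZl bilZr mulrA expr2. Qed.

Lemma sqn_delta (j : 'I_p) : sqn (delta_mx j 0) = 1.
Proof.
rewrite /sqn (bigD1 j)//= mxE !eqxx expr1n big1 ?addr0// => k kj.
by rewrite mxE (negbTE kj) expr0n.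
Qed.

Lemma sqn_parallelogram u v : sqn (u + v) + sqn (u - v) = 2 * sqn u + 2 * sqn v.
Proof. rewrite !sqnE !bilDl !bilDr !bilNl !bilNr; ring. Qed.
End BilinearForm.

(** * Linear combinations of a Gaussian sample *)

Section SameLaw.
Context d1 d2 (T1 : measurableType d1) (T2 : measurableType d2) (R : realType).
Variables (P : probability T1 R) (Q : probability T2 R) (U : T1 -> R) (V : T2 -> R).

Lemma integral_same_law : measurable_fun setT U -> measurable_fun setT V ->
  (forall B, measurable B -> P (U @^-1` B) = Q (V @^-1` B)) ->
  forall f : R -> R, measurable_fun setT f -> (forall y, 0 <= f y) ->
  (\int[P]_w (f (U w))%:E = \int[Q]_w (f (V w))%:E)%E.
Proof.
move=> mU mV UV f mf f0.
have := @ge0_integral_law _ _ T1 T2 R P Q (cst 1) U V 1.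
move=> /(_ _ _ mU mV _ f mf f0)/wrap[] //.
  move=> B mB; have mUB : measurable (U @^-1` B).
    by rewrite -[X in measurable X]setTI; exact: mU.
  by rewrite (integral_cst _ mUB 1) !mul1e; exact: UV.
by rewrite mul1e => <-; apply: eq_integral => w _; rewrite mul1r.
Qed.
End SameLaw.

(** The law is either a point mass, when [v = 0], or has the normal density, and
then [integral_gauss_sqr] applies. *)
Lemma normal_law_second_moment d (T : measurableType d) (R : realType)
    (P : probability T R) (X : T -> R) (v : R) :
  0 <= v -> measurable_fun setT X ->
  (forall B, measurable B -> P (X @^-1` B) = normal_law v B) ->
  (\int[P]_w (X w ^+ 2)%:E = v%:E)%E.
Proof.
move=> v0 mX XB; have msq : measurable_fun setT (fun y : R => y ^+ 2).
  exact: measurable_funX.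
have sq0 (y : R) : 0 <= y ^+ 2 by exact: sqr_ge0.
have [v_eq0|v_neq0] := eqVneq v 0.
  have := @ge0_integral_law _ _ _ T R (@dirac _ R 0 R) P (cst 1) id X 1.
  move=> /(_ _ _ _ mX _ _ msq sq0)/wrap[] //.
    by move=> B mB; rewrite preimage_id (integral_cst _ mB 1) !mul1e; apply/esym;
       apply: etrans (XB _ mB) _; rewrite /normal_law v_eq0 eqxx.
  rewrite mul1e => <-; rewrite integral_dirac//=.
    by rewrite v_eq0 expr0n/= mulr0 mule0.
  by apply/measurable_EFinP; exact: measurable_funM.
pose s := Num.sqrt v.
have s0 : s != 0 by rewrite gt_eqF// sqrtr_gt0 lt_neqAle eq_sym v_neq0.
have sv : s ^+ 2 = v by rewrite sqr_sqrtr.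
have vgt0 : 0 < v by rewrite lt_neqAle eq_sym v_neq0.
have := @ge0_integral_law _ _ (measurableTypeR R) T R lebesgue_measure P
  (normal_pdf 0 s) id X 1.
move=> /(_ _ _ _ mX _ _ msq sq0)/wrap[] //.
- exact: measurable_normal_pdf.
- by move=> y; exact: normal_pdf_ge0.
- move=> B mB; rewrite preimage_id mul1e; apply/esym.
  by apply: etrans (XB _ mB) _; rewrite /normal_law (negbTE v_neq0).
rewrite mul1e => <-.
have k0 : 0 < (2 * v)^-1 by rewrite invr_gt0 mulr_gt0.
have wE y : normal_pdf 0 s y = normal_peak s * expR (- ((2 * v)^-1 * y ^+ 2)).
  rewrite normal_pdfE// /normal_fun subr0; congr (_ * expR _).
  by rewrite -mulr_natl sv mulNr mulrC.
have pk := normal_peak_ge0 s.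
have mw : measurable_fun setT (fun y : R => expR (- ((2 * v)^-1 * y ^+ 2))).
  apply: measurableT_comp => //; apply: measurableT_comp => //.
  by apply: measurable_funM => //.
have e0 (y : R) : 0 <= expR (- ((2 * v)^-1 * y ^+ 2)) by exact: expR_ge0.
transitivity (\int[lebesgue_measure]_(y in [set: R])
   (normal_peak s * (y ^+ 2 * expR (- ((2 * v)^-1 * y ^+ 2))))%:E)%E.
  by apply: eq_integral => y _; rewrite wE; congr EFin; ring.
rewrite (@ge0_integralZlR _ (measurableTypeR R) R lebesgue_measure)//; last 2 first.
- exact: measurable_funM.
- by move=> y; rewrite mulr_ge0.
rewrite integral_gauss_sqr//.
have := @integral_normal_pdf R 0 s.
under eq_integral do rewrite wE.
rewrite (@ge0_integralZlR _ (measurableTypeR R) R lebesgue_measure)// => h.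
by rewrite muleCA h mule1; congr EFin; field.
Qed.

Section GaussianSample.
Context d (T : measurableType d) (R : realType) (P : probability T R) (n p : nat).
Variables (x : 'I_n -> 'I_p -> {RV P >-> R}) (S : 'M[R]_p).
Hypothesis sample : iid_centered_gaussian x S.
Implicit Types (a b : 'cV[R]_p) (i : 'I_n) (j : 'I_p).

Definition lincomb a i (w : T) : R := \sum_j a j 0 * x i j w.

Lemma measurable_lincomb a i : measurable_fun setT (lincomb a i).
Proof. by apply: measurable_sum => j; exact: measurable_funM. Qed.

Lemma lincomb_law a i B : measurable B ->
  P (lincomb a i @^-1` B) = normal_law (bil S a a) B.
Proof. by move=> mB; have [_ /(_ i)[_ ->]] := sample. Qed.

Lemma iid_psd : (0 < n)%N -> psd S.
Proof. by move=> n0; have [_ /(_ (Ordinal n0))[]] := sample. Qed.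

Lemma lincomb_sqr a i : (\int[P]_w (lincomb a i w ^+ 2)%:E =
  (bil S a a)%:E)%E.
Proof.
apply: normal_law_second_moment; last by move=> B; exact: lincomb_law.
- by have [_ /(_ i)[[_ h] _]] := sample; exact: h.
- exact: measurable_lincomb.
Qed.

Lemma lincomb_integrable a i : P.-integrable setT (EFin \o lincomb a i).
Proof.
apply: (@le_integrable _ _ _ P setT measurableT _
  (fun w => (1 + lincomb a i w ^+ 2)%:E)).
- by apply/measurable_EFinP; exact: measurable_lincomb.
- move=> w _ /=; rewrite lee_fin [leRHS]ger0_norm ?addr_ge0 ?sqr_ge0//.
  have := sqr_ge0 (lincomb a i w - 1); have := sqr_ge0 (lincomb a i w + 1).
  by case: (ger0P (lincomb a i w)) => _; nra.
- under eq_fun do rewrite EFinD; apply: integrableD => //.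
    exact: finite_measure_integrable_cst.
  apply: (@ge0_bounded_integrable _ _ _ _ _ (bil S a a)).
  + by apply: measurable_funX; exact: measurable_lincomb.
  + by move=> w; exact: sqr_ge0.
  + by rewrite lincomb_sqr.
Qed.

(** The coefficients [a] and [- a] give the same variance, hence the same law:
the linear combination is symmetric.  The factor one matches the products of
[mgf_sum]. *)
Lemma lincomb_mean a i : (\int[P]_w (lincomb a i w * 1)%:E = 0)%E.
Proof.
have ilc := lincomb_integrable.
have E : (\int[P]_w (lincomb a i w)%:E = \int[P]_w (- lincomb a i w)%:E)%E.
  have lN w : - lincomb a i w = lincomb (- a) i w.
    by rewrite /lincomb -sumrN; apply: eq_bigr => j _; rewrite mxE mulNr.
  have law B : measurable B ->
      P (lincomb a i @^-1` B) = P (lincomb (- a) i @^-1` B).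
    move=> mB; rewrite (lincomb_law a i mB) (lincomb_law (- a) i mB).
    by rewrite bilNl bilNr opprK.
  have mp : measurable_fun setT (fun y : R => Num.max y 0) by exact: measurable_maxr.
  have mn : measurable_fun setT (fun y : R => Num.max (- y) 0).
    by apply: measurable_maxr => //; exact: measurableT_comp.
  have max0 (y : R) : 0 <= Num.max y 0 by rewrite le_max lexx orbT.
  have h f := integral_same_law (measurable_lincomb a i) (measurable_lincomb (- a) i) law (f := f).
  rewrite [LHS]integralE [RHS]integralE; congr (_ - _)%E.
    have := h _ mp max0.
    move=> hh; rewrite (eq_integral (fun w => (Num.max (lincomb a i w) 0)%:E)); last first.
      by move=> w _; rewrite funeposE -EFin_max.
    rewrite hh; apply: eq_integral => w _.
    by rewrite funeposE -EFin_max lN.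
  have := h _ mn (fun y => max0 (- y)).
  move=> hh; rewrite (eq_integral (fun w => (Num.max (- lincomb a i w) 0)%:E)); last first.
    by move=> w _; rewrite funenegE -EFinN -EFin_max.
  rewrite hh; apply: eq_integral => w _.
  by rewrite funenegE lN -EFinN -EFin_max.
have iN : (\int[P]_w (- lincomb a i w)%:E = - \int[P]_w (lincomb a i w)%:E)%E.
  under eq_integral do rewrite -mulN1r EFinM.
  by rewrite integralZl// ?mulN1e//; exact: ilc.
under eq_integral do rewrite mulr1.
have fin : (\int[P]_w (lincomb a i w)%:E)%E \is a fin_num.
  by apply: integrable_fin_num => //; exact: ilc.
move: E; rewrite iN -(fineK fin) => /eqP; rewrite -EFinN eqe => /eqP h.
by congr EFin; lra.
Qed.

(** By polarization, from the variances of the combinations with coefficients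
[a + b] and [a - b]. *)
Lemma lincomb_product a b i : (\int[P]_w (lincomb a i w * lincomb b i w)%:E =
  (bil S a b)%:E)%E.
Proof.
have lD w : lincomb (a + b) i w = lincomb a i w + lincomb b i w.
  by rewrite /lincomb -big_split; apply: eq_bigr => j _; rewrite mxE mulrDl.
have lB w : lincomb (a - b) i w = lincomb a i w - lincomb b i w.
  by rewrite /lincomb -sumrB; apply: eq_bigr => j _; rewrite !mxE mulrBl.
have isq c : P.-integrable setT (EFin \o (fun w => lincomb c i w ^+ 2)).
  apply: (@ge0_bounded_integrable _ _ _ _ _ (bil S c c)).
  - by apply: measurable_funX; exact: measurable_lincomb.
  - by move=> w; exact: sqr_ge0.
  - by rewrite lincomb_sqr.
have [_ /(_ i)[[St _] _]] := sample.
transitivity (\int[P]_w (4^-1%:E * ((lincomb (a + b) i w ^+ 2)%:E -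
    (lincomb (a - b) i w ^+ 2)%:E)))%E.
  apply: eq_integral => w _; rewrite lD lB -EFinB -EFinM; congr EFin.
  by field.
rewrite integralZl//; last exact: (integrableB measurableT (isq _) (isq _)).
rewrite (integralB measurableT (isq _) (isq _)).
rewrite !lincomb_sqr -EFinB -EFinM; congr EFin.
by rewrite !(bilBl, bilDl) !(bilBr, bilDr) (bilC b a St); field.
Qed.

(** Centred normal laws differ by a scale only: the linear combination has the law
of a multiple of coordinate [j], so that a bound for one coordinate serves all
directions, without computing any normal integral. *)
Lemma lincomb_exp_sqr (K rho r : R) a i j :
  0 < S j j -> 0 <= r -> r * bil S a a <= rho * S j j ->
  (forall t, `|t| <= rho -> (\int[P]_w (expR (t * x i j w ^+ 2))%:E <= K%:E)%E) ->
  (\int[P]_w (expR (r * lincomb a i w ^+ 2))%:E <= K%:E)%E.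
Proof.
move=> Sj r0 rq xK.
have [_ /(_ i)[[_ Sge0] _]] := sample.
set q := bil S a a in rq *.
have q0 : 0 <= q by exact: Sge0.
pose c := Num.sqrt (q / S j j).
have c2 : c ^+ 2 = q / S j j by rewrite sqr_sqrtr// divr_ge0// ltW.
pose e : 'cV[R]_p := c *: delta_mx j 0.
have le w : lincomb e i w = c * x i j w.
  rewrite /lincomb (bigD1 j)//= big1 ?addr0.
    by rewrite !mxE !eqxx mulr1.
  by move=> k kj; rewrite !mxE (negbTE kj) mulr0 mul0r.
have qe : bil S e e = q.
  rewrite bilZl bilZr bil_delta mulrA -expr2 c2 divfK//.
  by rewrite gt_eqF.
have law B : measurable B -> P (lincomb a i @^-1` B) = P (lincomb e i @^-1` B).
  by move=> mB; rewrite (lincomb_law a i mB) (lincomb_law e i mB) qe.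
have mf : measurable_fun setT (fun y : R => expR (r * y ^+ 2)).
  by apply: measurableT_comp => //; apply: measurable_funM.
rewrite (integral_same_law (measurable_lincomb a i) (measurable_lincomb e i) law mf).
  under eq_integral do rewrite le exprMn mulrA.
  apply: xK; rewrite ger0_norm; last by rewrite mulr_ge0// sqr_ge0.
  by rewrite c2 mulrA ler_pdivrMr.
by move=> y; exact: expR_ge0.
Qed.

Lemma sigma_vectorT i : sigma_vector (x i) setT.
Proof. exact: (@measurableT _ (g_sigma_algebraType _)). Qed.

Lemma sigma_vector_measurable i A : sigma_vector (x i) A -> measurable A.
Proof.
apply: smallest_sub; first exact: sigma_algebra_measurable.
by move=> _ [j [B [mB ->]]]; rewrite -[X in measurable X]setTI; exact: measurable_funPT.
Qed.

Lemma measurable_lincomb_sigma_vector a i :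
  measurable_fun setT (lincomb a i : g_sigma_algebraType
    [set A | exists (j : 'I_p) (B : set R), measurable B /\ A = x i j @^-1` B] -> R).
Proof.
apply: measurable_sum => j; apply: measurable_funM => //.
move=> _ C mC; rewrite setTI; apply: sub_sigma_algebra.
by exists j, C.
Qed.

Lemma sigma_vector_lincomb a i B : measurable B ->
  sigma_vector (x i) (lincomb a i @^-1` B).
Proof.
move=> mB; rewrite -[X in sigma_vector _ X]setTI.
exact: measurable_lincomb_sigma_vector.
Qed.

Lemma sigma_vector_lincomb_product a b i B : measurable B ->
  sigma_vector (x i) ((fun w => lincomb a i w * lincomb b i w) @^-1` B).
Proof.
move=> mB; rewrite -[X in sigma_vector _ X]setTI.
have m c := @measurable_lincomb_sigma_vector c i.
exact: (measurable_funM (m a) (m b)).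
Qed.
End GaussianSample.

(** * A grid on the unit ball *)

Section SphereGrid.
Context (R : realType) (p : nat).
Hypothesis p_gt0 : (0 < p)%N.

(** A coordinate is stored as an absolute value and a sign, because rounding
towards zero keeps a grid point inside the unit ball. *)
Definition grid_index := {ffun 'I_p -> 'I_(25 * p).+1 * bool}.

Definition grid_weight (g : grid_index) : nat := \sum_i (g i).1.

(** Rounding the [p] coordinates at this scale moves a vector by at most [1 / 5]. *)
Definition grid_mesh : R := (5 * Num.sqrt p%:R)^-1.

Definition grid_point (g : grid_index) : 'cV[R]_p :=
  \col_i ((-1) ^+ (g i).2 * ((g i).1%:R * grid_mesh)).

Let p0 : 0 < p%:R :> R. Proof. by rewrite ltr0n. Qed.

Lemma grid_mesh_gt0 : 0 < grid_mesh.
Proof. by rewrite invr_gt0 mulr_gt0// sqrtr_gt0. Qed.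

Lemma grid_mesh_sqr : p%:R * grid_mesh ^+ 2 = 25^-1.
Proof.
rewrite exprVn exprMn sqr_sqrtr ?ltW//; field; by rewrite gt_eqF.
Qed.

(** The multiples [k_i] of the mesh are integers, so their sum is at most the sum
of their squares, which is [25 p] times the squared norm of the rounded
vector. *)
Lemma grid_approx (u : 'cV[R]_p) : sqn u = 1 ->
  exists g : grid_index, [/\ (grid_weight g <= 25 * p)%N,
    sqn (grid_point g) <= 1 & sqn (u - grid_point g) <= 25^-1].
Proof.
move=> u1; have h0 := grid_mesh_gt0; have hp := grid_mesh_sqr.
set h := grid_mesh in h0 hp *.
pose k i : nat := Num.truncn (`|u i 0| / h).
have klb i : (k i)%:R * h <= `|u i 0|.
  by rewrite -ler_pdivlMr// truncn_le// divr_ge0// ltW.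
have kub i : `|u i 0| <= (k i)%:R * h + h.
  rewrite -[X in _ + X]mul1r -mulrDl natr1 -ler_pdivrMr// ltW//.
  exact: truncnS_gt.
have ksq i : (k i)%:R ^+ 2 * h ^+ 2 <= u i 0 ^+ 2.
  by rewrite -exprMn -[leRHS]real_normK ?num_real// ler_sqr ?nnegrE// mulr_ge0// ltW.
have ksum : \sum_i (k i)%:R ^+ 2 <= (25 * p)%:R :> R.
  rewrite -(ler_pM2r (_ : 0 < h ^+ 2)) ?exprn_gt0// natrM -mulrA hp divff//.
  by rewrite mulr_suml; apply: (@le_trans _ _ (sqn u)); [apply: ler_sum|rewrite u1].
have kle : (\sum_i k i <= 25 * p)%N.
  rewrite -(ler_nat R); apply: le_trans ksum; rewrite natr_sum.
  by apply: ler_sum => i _; rewrite -natrX ler_nat; case: (k i) => // m; rewrite leq_pmulr.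
have kb i : (k i < (25 * p).+1)%N.
  by rewrite ltnS (leq_trans _ kle)// (bigD1 i)//= leq_addr.
exists [ffun i => (Ordinal (kb i), u i 0 < 0)].
have gE i : grid_point [ffun i => (Ordinal (kb i), u i 0 < 0)] i 0 =
    (-1) ^+ (u i 0 < 0)%R * ((k i)%:R * h) by rewrite mxE ffunE.
split.
- by rewrite /grid_weight; under eq_bigr do rewrite ffunE.
- apply: (@le_trans _ _ (sqn u)); [apply: ler_sum => i _|by rewrite u1].
  by rewrite gE exprMn sqrr_sign mul1r exprMn; exact: ksq.
- have -> : 25^-1 = \sum_(i < p) h ^+ 2 :> R.
    by rewrite sumr_const card_ord -[RHS]mulr_natl hp.
  apply: ler_sum => i _; rewrite mxE [X in _ + X]mxE gE.
  have := klb i; have := kub i; set a := (k i)%:R * h => h1 h2.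
  have b : `|u i 0| - a <= h by lra.
  have b0 : 0 <= `|u i 0| - a by lra.
  have -> : (u i 0 - (-1) ^+ (u i 0 < 0)%R * a) ^+ 2 = (`|u i 0| - a) ^+ 2.
    case: (ltP (u i 0) 0) => s.
      by rewrite ltr0_norm// expr1; ring.
    by rewrite ger0_norm// expr0 mul1r.
  by rewrite ler_sqr ?nnegrE// ltW.
Qed.

(** By polarization and the parallelogram identity. *)
Lemma bil_le_mean (A : 'M[R]_p) (a : R) (u v : 'cV[R]_p) : A^T = A ->
  (forall w, `|bil A w w| <= a * sqn w) -> `|bil A u v| <= a / 2 * (sqn u + sqn v).
Proof.
move=> At Aa.
have e : 4 * bil A u v = bil A (u + v) (u + v) - bil A (u - v) (u - v).
  by rewrite !(bilBl, bilDl) !(bilBr, bilDr) (bilC v u At); ring.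
have := Aa (u + v); have := Aa (u - v); rewrite !ler_norml.
have := sqn_parallelogram u v.
set s1 := sqn (u + v); set s2 := sqn (u - v) => ps /andP[h1 h2] /andP[h3 h4].
have : a * s1 + a * s2 = a * (2 * sqn u + 2 * sqn v) by rewrite -mulrDr ps.
by move=> h5; apply/andP; split; lra.
Qed.

(** A unit vector [u] is so close to a grid point [z] that the form changes by
at most half of its supremum over the sphere between [z] and [u], so that this
supremum is at most twice the maximum over the grid. *)
Lemma form_bound_grid (A : 'M[R]_p) (e : R) : A^T = A ->
  (forall g : grid_index, (grid_weight g <= 25 * p)%N ->
     sqn (grid_point g) <= 1 ->
     `|bil A (grid_point g) (grid_point g)| <= e) ->
  forall u, `|bil A u u| <= 2 * e * sqn u.
Proof.
move=> At Ae.
have e0 : 0 <= e.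
  pose g0 : grid_index := [ffun=> (ord0, false)].
  have g00 : grid_point g0 = 0.
    by apply/matrixP => i j; rewrite !mxE ffunE/= mul0r mulr0.
  have := Ae g0; rewrite g00 bil0r normr0; apply.
    by rewrite /grid_weight big1// => i _; rewrite ffunE.
  by rewrite /sqn big1// => i _; rewrite mxE expr0n.
pose E := [set a : R | exists u, sqn u = 1 /\ a = `|bil A u u|].
have scale a : (forall u, sqn u = 1 -> `|bil A u u| <= a) ->
    forall u, `|bil A u u| <= a * sqn u.
  move=> ha u; have [u0|u0] := eqVneq (sqn u) 0.
    by rewrite u0 mulr0 (sqn_eq0 u0) bil0r normr0.
  have su : 0 < sqn u by rewrite lt_neqAle eq_sym u0 sqn_ge0.
  pose c := (Num.sqrt (sqn u))^-1.
  have c2 : c ^+ 2 = (sqn u)^-1 by rewrite exprVn sqr_sqrtr// ltW.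
  have := ha (c *: u); rewrite sqnZ c2 mulVf// bilZl bilZr mulrA -expr2 c2.
  move=> /(_ erefl); rewrite normrM ger0_norm ?invr_ge0; last exact: ltW.
  by move=> h; rewrite -ler_pdivrMr// mulrC.
have [i0 _] : exists i0 : 'I_p, True by exists (Ordinal p_gt0).
have E0 : E !=set0.
  by exists `|bil A (delta_mx i0 0) (delta_mx i0 0)|, (delta_mx i0 0); rewrite sqn_delta.
pose a0 := \sum_i \sum_j `|A i j|.
have Eub : has_ubound E.
  exists a0 => _ [u [u1 ->]]; rewrite bilE.
  have u_le i : `|u i 0| <= 1.
    rewrite -sqrtr_sqr -[leRHS]sqrtr1 ler_wsqrtr// -u1 /sqn (bigD1 i)//= lerDl.
    by apply: sumr_ge0 => k _; exact: sqr_ge0.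
  apply: le_trans (ler_norm_sum _ _ _) _; apply: ler_sum => i _.
  apply: le_trans (ler_norm_sum _ _ _) _; apply: ler_sum => j _.
  rewrite !normrM -[leRHS]mul1r -[leRHS]mulr1.
  by apply: ler_pM => //; apply: ler_pM.
have supE : has_sup E by split.
pose a := sup E.
have aE u : sqn u = 1 -> `|bil A u u| <= a.
  by move=> u1; apply: sup_ubound => //; exists u.
have a_ge0 : 0 <= a.
  by have [b [u [u1 _]]] := E0; exact: le_trans (normr_ge0 _) (aE u u1).
have aS := scale _ aE.
suff : a <= 2 * e.
  move=> ae; apply: scale => u u1; exact: le_trans (aE _ u1) ae.
suff : a <= e + a / 2 by lra.
apply: ge_sup => // _ [u [u1 ->]].
have [g [g1 g2 g3]] := grid_approx u1.
set z := grid_point g in g2 g3.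
have zE : bil A u u = bil A z z + bil A (u - z) (u + z).
  by rewrite !(bilBl, bilDl) !(bilBr, bilDr) (bilC z u At); ring.
rewrite zE; apply: le_trans (ler_normD _ _) _; apply: lerD; first exact: Ae.
have uz : sqn (u + z) <= 4.
  have := sqn_parallelogram u z; have := sqn_ge0 (u - z); rewrite u1; lra.
(* the factor 3 balances the squared norms, at most 1/25 and 4 *)
have -> : bil A (u - z) (u + z) = bil A (3 *: (u - z)) (3^-1 *: (u + z)).
  by rewrite bilZl bilZr mulrA divff// mul1r.
apply: le_trans (bil_le_mean _ _ At aS) _; rewrite !sqnZ.
have : 3 ^+ 2 * sqn (u - z) + 3^-1 ^+ 2 * sqn (u + z) <= 1 by lra.
by move=> h; rewrite -[leRHS]mulr1 ler_wpM2l// divr_ge0.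
Qed.

(** The weight of the grid points bounds their number: the sum over the grid of
[2 ^ - weight] factors over the coordinates. *)
Lemma card_grid : (#|[set g : grid_index | (grid_weight g <= 25 * p)%N]%SET|%:R : R)
  <= (2 ^+ 27) ^+ p.
Proof.
pose f (kb : 'I_(25 * p).+1 * bool) : R := 2^-1 ^+ kb.1.
have f0 kb : 0 <= f kb by rewrite exprn_ge0// invr_ge0.
apply: (@le_trans _ _ (\sum_(g : grid_index) 2 ^+ (25 * p) * \prod_i f (g i))).
  rewrite -sum1_card natr_sum big_mkcond/=; apply: ler_sum => g _.
  have F : \prod_i f (g i) = 2^-1 ^+ grid_weight g by rewrite /f prodrXr.
  rewrite inE F; case: ifPn => h; last by rewrite mulr_ge0// exprn_ge0.
  by rewrite -(subnK h) exprD exprVn mulfK ?expf_neq0 ?pnatr_eq0 ?exprn_ege1 ?ler1n.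
rewrite -mulr_sumr -(bigA_distr_bigA (fun _ => f)) prodr_const card_ord.
have F4 : \sum_kb f kb <= 4.
  rewrite (eq_bigr (fun kb => f (kb.1, kb.2))); last by case.
  rewrite -(pair_bigA _ (fun k b => f (k, b)))/=.
  under eq_bigr do rewrite big_bool /f/=.
  rewrite (_ : \sum_(i < (25 * p).+1) _ = 2 * \sum_(i < (25 * p).+1) 2^-1 ^+ i); last first.
    by rewrite mulr_sumr; apply: eq_bigr => i _; ring.
  suff : \sum_(i < (25 * p).+1) 2^-1 ^+ i <= 2 :> R by lra.
  elim: (25 * p).+1 => [|n IH]; first by rewrite big_ord0.
  rewrite big_ord_recl expr0.
  under eq_bigr do rewrite exprS.
  by rewrite -mulr_sumr; lra.
have F0 : 0 <= \sum_kb f kb by apply: sumr_ge0.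
rewrite exprM -exprMn; apply: lerXn2r; rewrite ?nnegrE ?mulr_ge0 ?exprn_ge0//.
rewrite (exprD 2 25 2) ler_wpM2l ?exprn_ge0//.
apply: le_trans F4 _; lra.
Qed.
End SphereGrid.

(** * Singular values and quadratic forms *)

Lemma continuous_bigsum (R : realType) (X : topologicalType) (I : Type) (r : seq I)
    (f : I -> X -> R) : (forall i, continuous (f i)) ->
  continuous (fun v => \sum_(i <- r) f i v).
Proof.
move=> cf; elim: r => [|i r IH].
  by under eq_fun do rewrite big_nil; move=> v; exact: cvg_cst.
under eq_fun do rewrite big_cons.
by move=> v; apply: cvgD; [exact: cf|exact: IH].
Qed.

Section SymmetricExtremes.
Context (R : realType) (p : nat).
Implicit Types (A S : 'M[R]_p) (u v : 'cV[R]_p).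

(** The unit sphere is compact. *)
Lemma symmetric_maximizer S : (0 < p)%N ->
  exists2 u, sqn u = 1 & forall v, bil S v v <= bil S u u * sqn v.
Proof.
move=> p0; pose q (v : 'rV[R]_p) : R := \sum_i \sum_j v 0 i * S i j * v 0 j.
pose nrm (v : 'rV[R]_p) : R := \sum_i v 0 i ^+ 2.
have cc i : continuous (fun v : 'rV[R]_p => v 0 i) by exact: coord_continuous.
have cq : continuous q.
  apply: continuous_bigsum => i; apply: continuous_bigsum => j v.
  exact: (cvgM (cvgM (cc i v) (cvg_cst (S i j))) (cc j v)).
have cn : continuous nrm.
  apply: continuous_bigsum => i; under eq_fun do rewrite expr2.
  by move=> v; exact: (cvgM (cc i v) (cc i v)).
pose A : set 'rV[R]_p := [set v | nrm v = 1].
have coA : compact A.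
  apply: bounded_closed_compact.
    exists 1; split; first exact: num_real.
    move=> M M1 v /= v1.
    rewrite [leLHS]/Num.norm /= mx_normrE; apply/bigmax_leP; split.
      exact: ltW (lt_trans ltr01 M1).
    move=> [i j] _ /=; rewrite (ord1 i).
    apply: le_trans (ltW M1).
    rewrite -sqrtr_sqr -[leRHS]sqrtr1 ler_wsqrtr// -v1 /nrm (bigD1 j)//= lerDl.
    by apply: sumr_ge0 => k _; exact: sqr_ge0.
  have -> : A = nrm @^-1` [set 1] by [].
  by apply: closed_comp => //; exact: closed_eq.
have A0 : A !=set0.
  exists (delta_mx 0 (Ordinal p0)) => /=.
  rewrite /A /= /nrm (bigD1 (Ordinal p0))//= big1 ?addr0; first by rewrite mxE !eqxx expr1n.
  by move=> k ki; rewrite mxE (negbTE ki) andbF expr0n.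
have [c cA cmax] := EVT_max_rV A0 coA (continuous_subspaceT cq).
have qb v : bil S v v = q v^T.
  by rewrite bilE; apply: eq_bigr => i _; apply: eq_bigr => j _; rewrite !mxE.
have nb v : sqn v = nrm v^T.
  by apply: eq_bigr => i _; rewrite mxE.
exists c^T; first by rewrite nb trmxK; move: cA => /[!inE].
move=> v; have [v0|v0] := eqVneq (sqn v) 0.
  by rewrite v0 mulr0 (sqn_eq0 v0) bil0r.
have su : 0 < sqn v by rewrite lt_neqAle eq_sym v0 sqn_ge0.
pose k := (Num.sqrt (sqn v))^-1.
have k2 : k ^+ 2 = (sqn v)^-1 by rewrite exprVn sqr_sqrtr// ltW.
have := cmax (k *: v)^T; rewrite -qb bilZl bilZr mulrA -expr2 k2 inE /A /= -nb sqnZ k2.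
rewrite mulVf// => /(_ erefl) h.
by rewrite (qb c^T) trmxK -ler_pdivrMr// mulrC.
Qed.

(** The vector [u] minimizes the form, so that the first variation in every
direction vanishes. *)
Lemma psd_null A u : psd A -> bil A u u = 0 -> A *m u = 0.
Proof.
move=> [At A0] Au.
have null v : bil A v u = 0.
  set b := bil A v u; set c := bil A v v.
  have c0 : 0 <= c by exact: A0.
  pose s := (c + 1)^-1.
  have s0 : 0 < s by rewrite invr_gt0; lra.
  have : 0 <= bil A (u - (b * s) *: v) (u - (b * s) *: v) by exact: A0.
  rewrite !bilBl !bilBr !bilZl !bilZr Au (bilC u v At) -/b -/c.
  have cE : c = s^-1 - 1 by rewrite invrK addrK.
  rewrite cE => h.
  have h2 : 0 <= - b ^+ 2 * s * (1 + s).
    apply: le_trans h _; rewrite le_eqVlt; apply/orP; left; apply/eqP.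
    by field; rewrite gt_eqF.
  have b2 : b ^+ 2 <= 0.
    have s1 : 0 < s * (1 + s) by rewrite mulr_gt0// addr_gt0.
    by rewrite -oppr_ge0 -(pmulr_lge0 _ s1) mulrA.
  by apply/eqP; rewrite -sqrf_eq0 eq_le b2 sqr_ge0.
apply/matrixP => i j; rewrite (ord1 j) [RHS]mxE.
transitivity (bil A (delta_mx i 0) u); last exact: null.
by rewrite /bil trmx_delta -mulmxA -rowE [RHS]mxE.
Qed.

Lemma maximizer_eigen S u : S^T = S -> sqn u = 1 ->
  (forall v, bil S v v <= bil S u u * sqn v) -> S *m u = bil S u u *: u.
Proof.
move=> St u1 umax.
suff : ((bil S u u)%:M - S) *m u = 0.
  by rewrite mulmxBl mul_scalar_mx => /eqP; rewrite subr_eq0 => /eqP.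
apply: psd_null.
  split; first by rewrite linearB/= tr_scalar_mx St.
  move=> v; rewrite -[X in _ <= X]/(bil _ v v) bilBmx bil_scalar -sqnE subr_ge0.
  exact: umax.
by rewrite bilBmx bil_scalar -sqnE u1 mulr1 subrr.
Qed.
End SymmetricExtremes.

Section SingularValues.
Context (R : realType) (p : nat).
Implicit Types (S : 'M[R]_p) (u v : 'cV[R]_p).

(** The powers of distinct linear factors are coprime, so their product divides
[q]. *)
Lemma sum_mup (q : {poly R}) (s : seq R) : q != 0 -> uniq s ->
  (\sum_(x <- s) mup x q <= (size q).-1)%N.
Proof.
move=> q0 us; pose r := flatten [seq nseq (mup x q) x | x <- s].
have rE : \prod_(y <- r) ('X - y%:P) = \prod_(x <- s) ('X - x%:P) ^+ mup x q.
  by rewrite big_flatten big_map; apply: eq_bigr => x _; rewrite big_nseq iter_mulr_1.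
have rS : size r = (\sum_(x <- s) mup x q)%N.
  by rewrite size_flatten /shape -map_comp sumnE big_map; apply: eq_bigr => x _ /=; rewrite size_nseq.
suff : \prod_(y <- r) ('X - y%:P) %| q.
  by move/(dvdp_leq q0); rewrite size_prod_XsubC rS; case: (size q).
rewrite rE; elim: s us {r rE rS} => [|x s IH] /=; first by rewrite big_nil dvd1p.
move=> /andP[xs us]; rewrite big_cons Gauss_dvdp; last first.
  rewrite big_seq; apply: (big_ind (fun t => coprimep _ t)).
  - exact: coprimep1.
  - by move=> t1 t2 h1 h2; rewrite coprimepMr h1.
  - move=> y ys; apply: coprimep_expr; rewrite coprimep_sym; apply: coprimep_expr.
    by rewrite coprimep_XsubC root_XsubC; apply: contraNneq xs => ->.
by rewrite IH// andbT -mup_geq.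
Qed.

(** This makes the singular value of index [p] the least element of the whole
sequence. *)
Lemma size_sv_seq S : (size (sv_seq S) <= p)%N.
Proof.
rewrite size_sort size_flatten /shape -map_comp sumnE big_map.
under eq_bigr do rewrite /= size_nseq.
set q := char_poly _; have q0 : q != 0 by rewrite monic_neq0// char_poly_monic.
apply: leq_trans (sum_mup q0 _) _; first exact: uniq_roots.
by rewrite size_char_poly.
Qed.

Lemma eigenvalue_mem_sv_seq S u (m : R) : S^T = S -> u != 0 -> 0 <= m ->
  S *m u = m *: u -> m \in sv_seq S.
Proof.
move=> St u0 m0 Su.
set q := char_poly (S^T *m S).
have q0 : q != 0 by rewrite monic_neq0// char_poly_monic.
have rq : root q (m ^+ 2).
  rewrite -eigenvalue_root_char; apply/eigenvalueP; exists u^T; last first.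
    by apply: contra_neq u0 => h; rewrite -[u]trmxK h trmx0.
  by rewrite mulmxA St -[S in _ *m S *m _]St -trmx_mul Su linearZ/= -scalemxAl
    -[S in _ *m S]St -trmx_mul Su linearZ/= scalerA.
rewrite /sv_seq mem_sort; apply/flattenP.
exists (nseq (mup (m ^+ 2) q) (Num.sqrt (m ^+ 2))).
  apply/mapP; exists (m ^+ 2) => //.
  by have := roots_on_rootsR q0 => /(_ (m ^+ 2)) <-; rewrite in_itv/=.
rewrite mem_nseq -XsubC_dvd// dvdp_XsubCl rq/=.
by rewrite sqrtr_sqr ger0_norm.
Qed.

(** The eigenvalues of a positive semidefinite matrix are among its singular
values, so that the latter bound its quadratic form. *)
Lemma sv_form_bounds S (a b : R) : (0 < p)%N -> psd S -> 0 <= a ->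
  a < sv S p -> sv S 1 < b ->
  forall u, a * sqn u <= bil S u u <= b * sqn u.
Proof.
move=> p0 [St S0] a0 ap b1.
have nz u : sqn u = 1 -> u != 0.
  move=> u1; apply/eqP => u0; move: u1; rewrite u0 /sqn big1 => [/eqP|i _].
    by rewrite eq_sym oner_eq0.
  by rewrite mxE expr0n.
have srt : sorted >=%R (sv_seq S) by apply: sort_sorted => x y; exact: le_total.
have szp : (p.-1 < size (sv_seq S))%N.
  rewrite ltnNge; apply/negP => h; move: ap; rewrite /sv nth_default//.
  by rewrite ltNge a0.
have nth_le (i j : nat) : (i <= j)%N -> (j < size (sv_seq S))%N ->
    nth 0 (sv_seq S) j <= nth 0 (sv_seq S) i.
  move=> ij js; apply: (sorted_leq_nth _ _ 0 srt) => //.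
  - by move=> x y z xy yz; exact: le_trans yz xy.
  - by move=> x; exact: lexx.
  - by rewrite inE (leq_ltn_trans ij).
have bnd m u : sqn u = 1 -> S *m u = m *: u -> a <= m <= b.
  move=> u1 Su; have mE : m = bil S u u.
    by rewrite /bil -mulmxA Su -scalemxAr mxE -(mulmx1 u^T) -/(bil 1%:M u u) -sqnE u1 mulr1.
  have m0 : 0 <= m by rewrite mE; exact: S0.
  have /(nthP 0)[i isz <-] := eigenvalue_mem_sv_seq St (nz _ u1) m0 Su.
  apply/andP; split.
    apply: le_trans (ltW ap) _; apply: nth_le => //.
    by rewrite -ltnS prednK// (leq_trans isz)// size_sv_seq.
  by apply: le_trans (ltW b1); apply: nth_le.
move=> u; apply/andP; split.
  have [v v1 vmin] := @symmetric_maximizer _ _ (- S) p0.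
  have NS w z : bil (- S) w z = - bil S w z by rewrite /bil mulmxN mulNmx mxE.
  have := maximizer_eigen _ v1 vmin; rewrite linearN/= St => /(_ erefl).
  rewrite NS scaleNr mulNmx => /oppr_inj Sv.
  have /andP[h _] := bnd _ _ v1 Sv.
  have := vmin u; rewrite !NS mulNr lerN2; apply: le_trans.
  by rewrite ler_wpM2r// sqn_ge0.
have [v v1 vmax] := symmetric_maximizer S p0.
have Sv := maximizer_eigen St v1 vmax.
have /andP[_ h] := bnd _ _ v1 Sv.
by apply: le_trans (vmax u) _; rewrite ler_wpM2r// sqn_ge0.
Qed.
End SingularValues.

(** * Regression estimates and the sample second moments *)

Section Frobenius.
Context (R : realType).

Definition sqfro m p (A : 'M[R]_(m, p)) : R := \sum_i \sum_j A i j ^+ 2.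

Lemma sqfro_ge0 m p (A : 'M[R]_(m, p)) : 0 <= sqfro A.
Proof. by apply: sumr_ge0 => i _; apply: sumr_ge0 => j _; exact: sqr_ge0. Qed.

Lemma frobenius_sqr m p (A : 'M[R]_(m, p)) : frobenius A ^+ 2 = sqfro A.
Proof. by rewrite /frobenius sqr_sqrtr// sqfro_ge0. Qed.

Lemma sqfro_cols m p (A : 'M[R]_(m, p)) : sqfro A = \sum_j sqn (col j A).
Proof.
rewrite /sqfro exchange_big/=; apply: eq_bigr => j _.
by apply: eq_bigr => i _; rewrite mxE.
Qed.

Lemma sqfro_tr m p (A : 'M[R]_(m, p)) : sqfro A^T = sqfro A.
Proof.
rewrite /sqfro exchange_big/=; apply: eq_bigr => j _.
by apply: eq_bigr => i _; rewrite mxE.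
Qed.

Lemma sqfroB_le m p (A B : 'M[R]_(m, p)) : sqfro (A - B) <= 2 * sqfro A + 2 * sqfro B.
Proof.
rewrite /sqfro !mulr_sumr -big_split; apply: ler_sum => i _ /=.
rewrite !mulr_sumr -big_split; apply: ler_sum => j _ /=; rewrite !mxE.
by have := sqr_ge0 (A i j + B i j); lra.
Qed.

Lemma sqfro_mull p q (N : 'M[R]_p) (A : 'M[R]_(p, q)) (c : R) :
  (forall u, sqn (N *m u) <= c * sqn u) -> sqfro (N *m A) <= c * sqfro A.
Proof.
move=> Nc; rewrite !sqfro_cols mulr_sumr; apply: ler_sum => j _.
by rewrite !colE -mulmxA.
Qed.

(** Conjugating by [N] multiplies the squared norm by at most the square of
the squared operator norm, once for the columns and once for the rows. *)
Lemma sqfro_conj p (N A : 'M[R]_p) (c : R) : 0 <= c ->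
  (forall u, sqn (N *m u) <= c * sqn u) -> sqfro (N *m A *m N^T) <= c ^+ 2 * sqfro A.
Proof.
move=> c0 Nc; rewrite -mulmxA; apply: le_trans (sqfro_mull _ Nc) _.
rewrite expr2 -mulrA; apply: ler_wpM2l => //.
rewrite -[in leLHS]sqfro_tr trmx_mul trmxK -[in leRHS]sqfro_tr.
exact: sqfro_mull.
Qed.

Lemma bil1_young p (u v : 'cV[R]_p) (t : R) : 0 < t ->
  bil 1%:M u v <= t / 2 * sqn u + (2 * t)^-1 * sqn v.
Proof.
move=> t0; have := sqn_ge0 (t *: u - v); rewrite sqnE !bilBl !bilBr !bilZl !bilZr.
rewrite -!sqnE (bilC v u (trmx1 _ _)) => h.
rewrite -(ler_pM2l (_ : 0 < 2 * t)); last by rewrite mulr_gt0.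
have -> : 2 * t * (t / 2 * sqn u + (2 * t)^-1 * sqn v) = t * (t * sqn u) + sqn v.
  by field; rewrite gt_eqF.
lra.
Qed.

(** A matrix and its transpose have the same operator norm. *)
Lemma sqn_mul_tr p (N : 'M[R]_p) (c : R) : 0 < c ->
  (forall u, sqn (N^T *m u) <= c * sqn u) -> forall u, sqn (N *m u) <= c * sqn u.
Proof.
move=> c0 Nc u.
have e : sqn (N *m u) = bil 1%:M (N^T *m (N *m u)) u.
  by rewrite sqnE /bil !mulmx1 [in RHS]trmx_mul trmxK mulmxA.
have := bil1_young (N^T *m (N *m u)) u (_ : 0 < c^-1).
rewrite invr_gt0 -e => /(_ c0) h.
have : c^-1 / 2 * sqn (N^T *m (N *m u)) <= c^-1 / 2 * (c * sqn (N *m u)).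
  by apply: ler_wpM2l; rewrite // divr_ge0// invr_ge0 ltW.
have -> : c^-1 / 2 * (c * sqn (N *m u)) = 2^-1 * sqn (N *m u).
  by field; rewrite gt_eqF.
rewrite invfM invrK in h; lra.
Qed.

Lemma bil_small p (A : 'M[R]_p) (w : R) u : (forall i j, `|A i j| <= w) ->
  `|bil A u u| <= p%:R * w * sqn u.
Proof.
move=> Aw; have [p0|p0] := posnP p.
  have -> : u = 0.
    by apply/matrixP => i; have := ltn_ord i; rewrite [X in (_ < X)%N]p0.
  by rewrite bil0r normr0 /sqn big1 ?mulr0// => i _; rewrite mxE expr0n.
have w0 : 0 <= w by apply: le_trans (Aw (Ordinal p0) (Ordinal p0)).
rewrite bilE; apply: le_trans (ler_norm_sum _ _ _) _.
apply: (@le_trans _ _ (\sum_(i < p) \sum_(j < p) (w / 2 * u i 0 ^+ 2 + w / 2 * u j 0 ^+ 2))).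
  apply: ler_sum => i _; apply: le_trans (ler_norm_sum _ _ _) _.
  apply: ler_sum => j _; rewrite mulrAC normrM.
  have h : `|u i 0 * u j 0| <= 2^-1 * u i 0 ^+ 2 + 2^-1 * u j 0 ^+ 2.
    have := sqr_ge0 (u i 0 - u j 0); have := sqr_ge0 (u i 0 + u j 0).
    by case: (ger0P (u i 0 * u j 0)) => _; lra.
  apply: le_trans (ler_pM _ _ h (Aw i j)) _ => //; lra.
under eq_bigr do rewrite big_split/= sumr_const card_ord -mulr_sumr -/(sqn u).
rewrite big_split/= sumr_const card_ord sumrMnl -mulr_sumr -/(sqn u).
set a := sqn u; rewrite -[X in X + _]mulr_natl -[X in _ + X]mulr_natl; lra.
Qed.
End Frobenius.

Section UnitLower.
Context (R : realType) (p : nat).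
Implicit Types (L : 'M[R]_p).

Lemma unit_lower_unitmx L : unit_lower L -> L \in unitmx.
Proof.
move=> uL; rewrite unitmxE det_trig; last first.
  by apply/is_trig_mxP => i j ij; rewrite uL ?(ltnW ij)//; case: eqP ij => // ->; rewrite ltnn.
by rewrite big1 ?unitr1// => i _; rewrite uL// eqxx.
Qed.

(** The last nonzero coordinate of a solution of [L^T c = e_j] equals the same
coordinate of [e_j], hence is equal to one. *)
Lemma unit_lower_solve_delta L j (c : 'cV[R]_p) : unit_lower L ->
  L^T *m c = delta_mx j 0 -> 1 <= sqn c.
Proof.
move=> uL Lc.
have /existsP[i0 ci0] : [exists i, c i 0 != 0].
  apply/existsP/not_existsP => h.
  have c0 : c = 0.
    apply/matrixP => i k; rewrite (ord1 k) [RHS]mxE; apply/eqP.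
    by have /negP := h i; rewrite negbK.
  move/matrixP: Lc => /(_ j 0); rewrite c0 mulmx0 !mxE !eqxx => /eqP.
  by rewrite eq_sym oner_eq0.
pose i := [arg max_(i > i0 | c i 0 != 0) (i : nat)].
have [ci imax] : c i 0 != 0 /\ forall k : 'I_p, (i < k)%N -> c k 0 = 0.
  rewrite /i; case: arg_maxnP => // m cm mmax; split=> // k mk.
  apply/eqP; apply: contraTT mk => ck; rewrite -leqNgt; exact: mmax.
have Lci : (L^T *m c) i 0 = c i 0.
  rewrite mxE (bigD1 i)//= mxE uL// eqxx mul1r big1 ?addr0// => k ki.
  rewrite mxE; have [ik|ik] := ltnP i k; first by rewrite imax// mulr0.
  by rewrite uL// (negbTE ki) mul0r.
move: ci; rewrite -Lci Lc mxE eqxx andbT => /eqP hij.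
have ij : i = j by apply/eqP; move: hij; case: (i == j).
have ci1 : c i 0 = 1 by rewrite -Lci Lc ij mxE !eqxx.
by rewrite /sqn (bigD1 i)//= ci1 expr1n lerDl; apply: sumr_ge0 => k _; exact: sqr_ge0.
Qed.
End UnitLower.

Section Lasso.
Context (R : realType) (n p : nat).
Implicit Types (X E : 'M[R]_(n, p)) (L : 'M[R]_p) (eta : R).

Lemma lasso_residual_le eta X E j (l : 'rV[R]_p) : 0 <= eta ->
  is_argmin setT (lasso_loss eta X E j) l ->
  sqnorm (regression_residual X E j l) <= sqnorm (col j X).
Proof.
move=> eta0 [_ /(_ 0 I)]; rewrite /lasso_loss.
have -> : regression_residual X E j 0 = col j X.
  by rewrite /regression_residual big1 ?subr0// => k _; rewrite mxE scale0r.
have -> : \sum_(k < p | (k < j)%N) `|(0 : 'rV[R]_p) 0 k| = 0.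
  by rewrite big1// => k _; rewrite mxE normr0.
rewrite mulr0 addr0; apply: le_trans; rewrite lerDl mulr_ge0//.
by apply: sumr_ge0.
Qed.

(** First-order optimality: moving coefficient [k] by [t] changes the loss by
at most [- 2 t <e_k, e_j> + t^2 |e_k|^2 + eta |t|], which stays nonnegative for
small [t] of either sign only if the inner product is at most [eta / 2]. *)
Lemma lasso_kkt eta X E (j k : 'I_p) (l : 'rV[R]_p) : 0 <= eta -> (k < j)%N ->
  is_argmin setT (lasso_loss eta X E j) l ->
  `|\sum_i E i k * regression_residual X E j l i 0| <= eta / 2.
Proof.
move=> eta0 kj [_ lmin].
set e := regression_residual X E j l; set a := \sum_i _.
pose b := \sum_i E i k ^+ 2.
have b0 : 0 <= b by apply: sumr_ge0 => i _; exact: sqr_ge0.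
have step t : 2 * t * a <= t ^+ 2 * b + eta * `|t|.
  have := lmin (l + t *: delta_mx 0 k) I; rewrite /lasso_loss.
  have -> : regression_residual X E j (l + t *: delta_mx 0 k) = e - t *: col k E.
    rewrite /regression_residual /e /regression_residual -[RHS]addrA -opprD.
    congr (_ - _); under eq_bigr do rewrite !mxE scalerDl.
    rewrite big_split/=; congr (_ + _); rewrite (bigD1 k)//= eqxx mulr1 big1 ?addr0//.
    by move=> k' /andP[_ k'k]; rewrite (negbTE k'k) mulr0 scale0r.
  have -> : sqnorm (e - t *: col k E) = sqnorm e - 2 * t * a + t ^+ 2 * b.
    rewrite /sqnorm /a /b !mulr_sumr -sumrB -big_split; apply: eq_bigr => i _ /=.
    by rewrite !mxE -/e; ring.
  have : \sum_(k0 < p | (k0 < j)%N) `|(l + t *: delta_mx 0 k) 0 k0| <=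
         \sum_(k0 < p | (k0 < j)%N) `|l 0 k0| + `|t|.
    have -> : `|t| = \sum_(k0 < p | (k0 < j)%N) `|(t *: (delta_mx 0 k : 'rV[R]_p)) 0 k0|.
      rewrite (bigD1 k)//= !mxE !eqxx mulr1 big1 ?addr0// => k' /andP[_ k'k].
      by rewrite !mxE (negbTE k'k) andbF mulr0 normr0.
    by rewrite -big_split; apply: ler_sum => k0 _; rewrite mxE ler_normD.
  by move=> /(ler_wpM2l eta0) h1 h2; lra.
rewrite leNgt; apply/negP => h.
pose D := 2 * `|a| - eta; have D0 : 0 < D by rewrite /D; lra.
pose s := D / (2 * (b + 1)).
have s0 : 0 < s by rewrite divr_gt0// mulr_gt0//; lra.
have sE : s * (2 * (b + 1)) = D by rewrite divfK// gt_eqF// mulr_gt0//; lra.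
have : 2 * s * `|a| <= s ^+ 2 * b + eta * s.
  case: (ger0P a) => _; first by have := step s; rewrite gtr0_norm.
  by have := step (- s); rewrite normrN gtr0_norm// sqrrN; lra.
have -> : 2 * s * `|a| = s * (D + eta) by rewrite /D; ring.
have -> : s ^+ 2 * b + eta * s = s * (s * b + eta) by ring.
rewrite ler_pM2l// => h2.
have sb : 0 <= s * b by rewrite mulr_ge0// ltW.
have : s * (2 * (b + 1)) = 2 * (s * b) + 2 * s by ring.
lra.
Qed.

Lemma regression_factorization X E L : unit_lower L ->
  (forall j, col j E = regression_residual X E j (row j L)) -> X = E *m L^T.
Proof.
move=> uL regE; apply/matrixP => i j.
have := congr1 (fun c : 'cV[R]_n => c i 0) (regE j).
rewrite /regression_residual !mxE summxE => Eij.
rewrite (bigD1 j)//= !mxE uL// eqxx mulr1 Eij -[LHS]addr0 -addrA; congr (_ + _).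
apply/esym/eqP; rewrite addrC subr_eq0; apply/eqP.
rewrite [in RHS]big_mkcond/= [RHS](bigD1 j)//= ltnn add0r.
apply: eq_bigr => k kj; rewrite !mxE; case: ltnP => jk; first by rewrite mulrC.
by rewrite uL// eq_sym (negbTE kj) mulr0.
Qed.
End Lasso.

Section RegressionPerturbation.
Context (R : realType) (n p : nat).
Variables (X : 'M[R]_(n, p)) (s : 'S_p) (eta : 'I_p -> R) (L : 'M[R]_p) (d : 'rV[R]_p).
Hypothesis eta_ge0 : forall j, 0 <= eta j.
Hypothesis p_gt0 : (0 < p)%N.
Hypothesis n_gt1 : (1 < n)%N.
Hypothesis reg : cholesky_regression eta (X *m perm_mx s) L d.

Definition gram : 'M[R]_p := n%:R^-1 *: (X^T *m X).
Definition col_means : 'cV[R]_p := \col_j (n%:R^-1 * \sum_i X i j).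

Variables (k1 k2 : R).
Hypothesis k1_gt0 : 0 < k1.
Hypothesis gram_bounds : forall u, k1 * sqn u <= bil gram u u <= k2 * sqn u.

Let n0 : 0 < n%:R :> R. Proof. by rewrite ltr0n (ltn_trans _ n_gt1). Qed.
Let n10 : 0 < n.-1%:R :> R. Proof. by rewrite ltr0n -subn1 subn_gt0. Qed.

Let Pm : 'M[R]_p := perm_mx s.
Let PPt : Pm *m Pm^T = 1%:M.
Proof. by rewrite /Pm tr_perm_mx -perm_mxM mulgV perm_mx1. Qed.
Let PtP : Pm^T *m Pm = 1%:M.
Proof. by rewrite /Pm tr_perm_mx -perm_mxM mulVg perm_mx1. Qed.

Let N : 'M[R]_p := Pm *m L.
Let w : R := (\sum_j eta j) / (2 * n%:R).

Hypothesis penalty_small : p%:R * w <= k1 / 2.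

(** With [G' = E^T E / n] for the residuals [E], the difference is
[N (D - G') N^T].  The hypothesis on the sample second moments bounds the
diagonal of [G'] from below, since a residual is a combination of the data in
which one variable has coefficient one, and from above, since a residual is
shorter than the variable it comes from.  As [G'] is nearly diagonal, it is then
well conditioned, and so is [N].  The three terms of the bound come from the
divisor [n - 1] of the sample variance, from its centring, and from the entries
of [G'] off the diagonal. *)
Lemma regression_perturbation :
  sqfro (Pm *m (L *m diag_mx d *m L^T) *m Pm^T - gram)
  <= (2 * k2 / k1) ^+ 2 *
     (8 * p%:R * (k2 / n.-1%:R) ^+ 2 + 32 * (2 * k2 / k1 * sqn col_means) ^+ 2
      + 2 * (p%:R * w) ^+ 2).
Proof.
have [uL [E regE]] := reg.
have XE : X = E *m N^T.
  have XPE : X *m Pm = E *m L^T.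
    by apply: regression_factorization => // j; have [] := regE j.
  by rewrite /N trmx_mul mulmxA -XPE -mulmxA PPt mulmx1.
pose G : 'M[R]_p := n%:R^-1 *: (E^T *m E).
have SG : gram = N *m G *m N^T.
  by rewrite /gram {1}XE XE /G trmx_mul trmxK -scalemxAr -scalemxAl !mulmxA.
have bilSG u v : bil gram u v = bil G (N^T *m u) (N^T *m v).
  by rewrite /bil SG (trmx_mul N^T u) trmxK !mulmxA.
have gramE u : n%:R * bil gram u u = sqnorm (X *m u).
  rewrite /bil /gram -scalemxAr -scalemxAl mxE mulVKf ?gt_eqF//.
  rewrite mulmxA -(trmx_mul X u) -mulmxA mxE.
  by apply: eq_bigr => i _; rewrite [_^T _ _]mxE expr2.
have Gt : G^T = G by rewrite /G linearZ/= trmx_mul trmxK.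
have GE i j : G i j = n%:R^-1 * \sum_r E r i * E r j.
  by rewrite /G !mxE; congr (_ * _); apply: eq_bigr => r _; rewrite mxE.
have sqnormE j : sqnorm (col j E) = n%:R * G j j.
  rewrite GE mulVKf ?gt_eqF//; apply: eq_bigr => r _; by rewrite mxE expr2.
have Nunit : N \in unitmx.
  by rewrite unitmx_mul unitmx_perm unit_lower_unitmx.
have sqnP u : sqn (Pm^T *m u) = sqn u.
  by rewrite !sqnE /bil !mulmx1 (trmx_mul Pm^T u) trmxK -mulmxA (mulmxA Pm) PPt mul1mx.
have k12 : k1 <= k2.
  have /andP[h1 h2] := gram_bounds (delta_mx (Ordinal p_gt0) 0).
  by move: (le_trans h1 h2); rewrite sqn_delta !mulr1.
have k2_gt0 : 0 < k2 by exact: lt_le_trans k1_gt0 k12.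
have solve u : exists2 c, N^T *m c = u & k1 * sqn c <= bil G u u.
  exists (invmx N^T *m u); first by rewrite mulKVmx// unitmx_tr.
  have /andP[+ _] := gram_bounds (invmx N^T *m u).
  by rewrite bilSG mulKVmx// unitmx_tr.
have v_ge j : k1 <= G j j.
  have [c Nc] := solve (delta_mx j 0); rewrite bil_delta; apply: le_trans.
  rewrite -[leLHS]mulr1 ler_pM2l// -sqnP.
  apply: (unit_lower_solve_delta uL (j := j)).
  by rewrite -Nc /N trmx_mul mulmxA.
have v_le j : G j j <= k2.
  have [lj Ej _] := regE j; have := lasso_residual_le (eta_ge0 j) lj.
  rewrite -Ej sqnormE => h; rewrite -(ler_pM2l n0); apply: le_trans h _.
  have -> : sqnorm (col j (X *m perm_mx s)) = n%:R * bil gram (Pm *m delta_mx j 0) (Pm *m delta_mx j 0).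
    by rewrite gramE mulmxA -colE.
  rewrite ler_pM2l//; have /andP[_] := gram_bounds (Pm *m delta_mx j 0).
  by rewrite -sqnP mulmxA PtP mul1mx sqn_delta mulr1.
have w_ge0 : 0 <= w by rewrite divr_ge0 ?mulr_ge0// sumr_ge0.
have off_lt (k j : 'I_p) : (k < j)%N -> `|G k j| <= w.
  move=> kj; have [lj Ej _] := regE j.
  have := lasso_kkt (eta_ge0 j) kj lj; rewrite -Ej.
  under eq_bigr do rewrite [col _ _ _ _]mxE.
  move=> h; rewrite GE normrM ger0_norm; last by rewrite invr_ge0 ltW.
  rewrite [leLHS]mulrC ler_pdivrMr//; apply: le_trans h _.
  have -> : w * n%:R = (\sum_j eta j) / 2 by rewrite /w; field; rewrite gt_eqF.
  rewrite ler_pM2r ?invr_gt0// (bigD1 j)//= lerDl; exact: sumr_ge0.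
pose v : 'rV[R]_p := \row_j G j j.
pose O := G - diag_mx v.
have O_le i j : `|O i j| <= w.
  have -> : O i j = G i j - G i i *+ (i == j).
    by rewrite /O mxE [X in _ + X]mxE [diag_mx _ _ _]mxE [v _ _]mxE.
  have [ij|ij|ij] := ltngtP i j.
  - by rewrite -val_eqE/= ltn_eqF// mulr0n subr0 off_lt.
  - rewrite -val_eqE/= gtn_eqF// mulr0n subr0.
    have -> : G i j = G j i by rewrite -{1}Gt mxE.
    exact: off_lt.
  - by rewrite (val_inj ij) eqxx mulr1n subrr normr0.
have O_bil u : `|bil O u u| <= k1 / 2 * sqn u.
  apply: le_trans (bil_small u O_le) _.
  by apply: ler_wpM2r; [exact: sqn_ge0|exact: penalty_small].
have Gdec u : bil G u u = \sum_j G j j * u j 0 ^+ 2 + bil O u u.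
  rewrite /O bilBmx addrC.
  suff -> : bil (diag_mx v) u u = \sum_j G j j * u j 0 ^+ 2 by rewrite subrK.
  rewrite bilE; apply: eq_bigr => j _; rewrite (bigD1 j)//= big1 ?addr0.
    by rewrite mxE eqxx mulr1n [v _ _]mxE; ring.
  by move=> k kj; rewrite mxE eq_sym (negbTE kj) mulr0n mulr0 mul0r.
have G_ge u : k1 / 2 * sqn u <= bil G u u.
  have := O_bil u; rewrite ler_norml => /andP[h _].
  have : k1 * sqn u <= \sum_j G j j * u j 0 ^+ 2.
    rewrite /sqn mulr_sumr; apply: ler_sum => j _.
    by apply: ler_wpM2r => //; exact: sqr_ge0.
  rewrite Gdec; lra.
have G_le u : bil G u u <= 2 * k2 * sqn u.
  have := O_bil u; rewrite ler_norml => /andP[_ h].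
  have : \sum_j G j j * u j 0 ^+ 2 <= k2 * sqn u.
    rewrite /sqn mulr_sumr; apply: ler_sum => j _.
    by apply: ler_wpM2r => //; exact: sqr_ge0.
  have : k1 * sqn u <= k2 * sqn u by apply: ler_wpM2r => //; exact: sqn_ge0.
  have : 0 <= k2 * sqn u by rewrite mulr_ge0 ?sqn_ge0// ltW.
  rewrite Gdec; lra.
set C := 2 * k2 / k1.
have C0 : 0 < C by rewrite divr_gt0// mulr_gt0.
have Nt_le u : sqn (N^T *m u) <= C * sqn u.
  have := G_ge (N^T *m u); rewrite -bilSG; have /andP[_] := gram_bounds u.
  move=> h1 h2; have h3 := le_trans h2 h1.
  rewrite -(ler_pM2l (_ : 0 < k1 / 2)) ?divr_gt0//.
  apply: le_trans h3 _; rewrite le_eqVlt; apply/orP; left; apply/eqP.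
  by rewrite /C; field; rewrite gt_eqF.
have N_le := sqn_mul_tr C0 Nt_le.
pose eb : 'cV[R]_p := \col_j (n%:R^-1 * \sum_i E i j).
have meanE : col_means = N *m eb.
  apply/matrixP => j k; rewrite /col_means /eb mxE [RHS]mxE {1}XE.
  under eq_bigr do rewrite mxE.
  rewrite exchange_big/= mulr_sumr; apply: eq_bigr => r _.
  rewrite [in RHS]mxE -mulr_suml [N^T _ _]mxE; ring.
have eb_le : sqn eb <= C * sqn col_means.
  have [c Nc hc] := solve eb.
  have ebE : sqn eb = bil 1%:M col_means c.
    by rewrite meanE sqnE /bil !mulmx1 (trmx_mul N eb) -mulmxA Nc.
  have h1 := bil1_young col_means c C0; rewrite -ebE in h1.
  have h2 : sqn c <= C * sqn eb.
    rewrite -(ler_pM2l k1_gt0); apply: le_trans hc (le_trans (G_le eb) _).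
    by rewrite /C le_eqVlt; apply/orP; left; apply/eqP; field; rewrite gt_eqF.
  have h3 : (2 * C)^-1 * sqn c <= (2 * C)^-1 * (C * sqn eb).
    by apply: ler_wpM2l => //; rewrite invr_ge0 mulr_ge0// ltW.
  have h4 : (2 * C)^-1 * (C * sqn eb) = 2^-1 * sqn eb by field; rewrite gt_eqF.
  lra.
pose beta : 'rV[R]_p := \row_j (d 0 j - G j j).
have betaE j : beta 0 j = G j j / n.-1%:R - n%:R / n.-1%:R * eb j 0 ^+ 2.
  have [_ _ dj] := regE j; rewrite mxE dj /sample_variance.
  have eE : sample_mean (col j E) = eb j 0.
    by rewrite /sample_mean mxE; congr (_ * _); apply: eq_bigr => i _; rewrite mxE.
  rewrite eE.
  have sE : \sum_i E i j = n%:R * eb j 0 by rewrite mxE mulVKf ?gt_eqF.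
  have -> : \sum_i (col j E i 0 - eb j 0) ^+ 2 = n%:R * G j j - n%:R * eb j 0 ^+ 2.
    rewrite -sqnormE /sqnorm.
    under eq_bigr do rewrite sqrrB.
    rewrite !big_split/= sumrN sumr_const card_ord -[X in _ + X]mulr_natl.
    under [X in _ - X + _]eq_bigr do rewrite mxE.
    rewrite sumrMnl -mulr_suml sE; ring.
  have nn : n%:R = n.-1%:R + 1 :> R by rewrite natr1 prednK// (ltn_trans _ n_gt1).
  by rewrite nn; field; rewrite gt_eqF.
have -> : Pm *m (L *m diag_mx d *m L^T) *m Pm^T - gram = N *m (diag_mx beta - O) *m N^T.
  have -> : diag_mx beta - O = diag_mx d - G.
    rewrite /O /beta opprB addrA.
    have -> : diag_mx (\row_j (d 0 j - G j j)) = diag_mx d - diag_mx v.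
      rewrite -linearB/=; congr diag_mx; apply/matrixP => i j.
      by rewrite !mxE (ord1 i).
    by rewrite subrK.
  by rewrite mulmxBr mulmxBl -SG /N trmx_mul !mulmxA.
apply: le_trans (sqfro_conj _ (ltW C0) N_le) _.
apply: ler_wpM2l; first exact: sqr_ge0.
apply: le_trans (sqfroB_le _ _) _.
have -> : sqfro (diag_mx beta) = \sum_j beta 0 j ^+ 2.
  apply: eq_bigr => i _; rewrite (bigD1 i)//= mxE eqxx mulr1n big1 ?addr0//.
  by move=> j ji; rewrite mxE eq_sym (negbTE ji) mulr0n expr0n.
have O_fro : sqfro O <= (p%:R * w) ^+ 2.
  apply: (@le_trans _ _ (\sum_(i < p) \sum_(j < p) w ^+ 2)).
    apply: ler_sum => i _; apply: ler_sum => j _.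
    by rewrite -[leLHS]real_normK ?num_real// ler_sqr ?nnegrE.
  rewrite !sumr_const !card_ord -mulrnA -[leLHS]mulr_natl natrM le_eqVlt.
  by apply/orP; left; apply/eqP; ring.
have sq_le : \sum_j (eb j 0 ^+ 2) ^+ 2 <= sqn eb ^+ 2.
  have h j : eb j 0 ^+ 2 <= sqn eb.
    rewrite /sqn (bigD1 j)//= lerDl; apply: sumr_ge0 => k _; exact: sqr_ge0.
  rewrite [leRHS]expr2 {1}/sqn mulr_suml; apply: ler_sum => j _.
  by rewrite [leLHS]expr2; apply: ler_wpM2l => //; exact: sqr_ge0.
have n2 : n%:R / n.-1%:R <= 2 :> R.
  rewrite ler_pdivrMr// -natrM ler_nat; case: n n_gt1 => [|[|m]]//= _.
  by rewrite mul2n -addnn addSn addnS !ltnS leq_addr.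
have beta_le : \sum_j beta 0 j ^+ 2 <=
    2 * (p%:R * (k2 / n.-1%:R) ^+ 2) + 8 * \sum_j (eb j 0 ^+ 2) ^+ 2.
  have -> : p%:R * (k2 / n.-1%:R) ^+ 2 = \sum_(j < p) (k2 / n.-1%:R) ^+ 2.
    by rewrite sumr_const card_ord mulr_natl.
  rewrite !mulr_sumr -big_split; apply: ler_sum => j _ /=; rewrite betaE.
  set a := G j j / n.-1%:R; set q := n%:R / n.-1%:R * eb j 0 ^+ 2.
  have ha : a ^+ 2 <= (k2 / n.-1%:R) ^+ 2.
    have Gj0 : 0 <= G j j by exact: le_trans (ltW k1_gt0) (v_ge j).
    rewrite ler_sqr ?nnegrE; first by rewrite ler_pM2r ?invr_gt0.
      by rewrite divr_ge0// ltW.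
    by rewrite divr_ge0// ltW.
  have hq : q ^+ 2 <= 4 * (eb j 0 ^+ 2) ^+ 2.
    rewrite /q exprMn; apply: ler_wpM2r; first exact: sqr_ge0.
    have -> : 4 = 2 ^+ 2 :> R by ring.
    by rewrite ler_sqr ?nnegrE// divr_ge0.
  by have := sqr_ge0 (a + q); lra.
have eb2 : sqn eb ^+ 2 <= (C * sqn col_means) ^+ 2.
  by rewrite ler_sqr ?nnegrE ?sqn_ge0// mulr_ge0 ?sqn_ge0// ltW.
have p_ge0 : 0 <= p%:R * (k2 / n.-1%:R) ^+ 2 by rewrite mulr_ge0// sqr_ge0.
have := sqr_ge0 (C * sqn col_means); lra.
Qed.
End RegressionPerturbation.

(** * The penalized projection *)

Section BasicInequality.
Context (R : realType) (p M : nat).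
Variables (nu l : R) (Sk : 'I_M -> 'M[R]_p) (S0 Sh G : 'M[R]_p).
Hypothesis M_gt0 : (0 < M)%N.
Hypothesis l_ge0 : 0 <= l.

(** The error of entry [(i, j)] of [G] that survives the penalty: off the
support of [S0] only the excess of the deviation over [l] does. *)
Definition entry_excess (i j : 'I_p) : R :=
  if (i == j) || (S0 i j != 0) then (G i j - S0 i j) ^+ 2
  else (Num.max (`|G i j - S0 i j| - l) 0) ^+ 2.

Let supp (i j : 'I_p) : bool := (i != j) && (S0 i j != 0).

(** The three cases are a diagonal entry, where nothing is penalized, an entry off
the support, where the penalty cancels the deviation up to [l], and an entry of
the support, where the penalty may act against [x].  The quarter of the
squared error is later absorbed on the left. *)
Lemma entry_inequality (i j : 'I_p) (x : R) :
  (x - S0 i j) * (G i j - S0 i j) - (if i != j then l * (`|x| - `|S0 i j|) else 0)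
  <= 4^-1 * (x - S0 i j) ^+ 2 + 2 * entry_excess i j + (if supp i j then 2 * l ^+ 2 else 0).
Proof.
set y := x - S0 i j; rewrite /entry_excess /supp; set W := G i j - S0 i j.
have [_|ij] /= := eqVneq i j.
  by have := sqr_ge0 (y - 2 * W); have := sqr_ge0 W; lra.
have [s0|s0] /= := eqVneq (S0 i j) 0; last first.
  have h : `|S0 i j| - `|x| <= `|y| by rewrite /y distrC lerB_dist.
  have yW : y * W <= `|y| * `|W| by rewrite -normrM ler_norm.
  have h1 := ler_wpM2l l_ge0 h.
  have := sqr_ge0 (`|y| - 2 * (`|W| + l)); have := sqr_ge0 (`|W| - l).
  have : `|W| ^+ 2 = W ^+ 2 by rewrite real_normK// num_real.
  have : `|y| ^+ 2 = y ^+ 2 by rewrite real_normK// num_real.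
  rewrite mulrBr in h1; lra.
have yx : y = x by rewrite /y s0 subr0.
rewrite s0 normr0 subr0 -yx.
set m := Num.max _ _.
have m0 : 0 <= m by rewrite /m le_max lexx orbT.
have Wm : `|W| - l <= m by rewrite /m le_max lexx.
have yW : y * W <= `|y| * `|W| by rewrite -normrM ler_norm.
have h := ler_wpM2l (normr_ge0 y) Wm.
have := sqr_ge0 (`|y| - 2 * m); have := sqr_ge0 m.
have : `|y| ^+ 2 = y ^+ 2 by rewrite real_normK// num_real.
lra.
Qed.

Lemma sum_supp (c : R) :
  \sum_i \sum_j (if supp i j then c else 0) = c * (offdiag_nnz S0)%:R.
Proof.
rewrite pair_big/= -big_mkcond/= sumr_const -[LHS]mulr_natr; congr (_ * _%:R).
by rewrite /offdiag_nnz; apply: eq_card => -[i j]; rewrite !inE.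
Qed.

(** The objective at the minimizer is at most its value at [S0].  Each [Sk] is
replaced by [G] at the price of [Sk - G] and of a part of the squared error, and
the rest is compared entry by entry. *)
Lemma ensemble_basic : psd (S0 - nu%:M) -> ensemble_estimator nu l Sk Sh ->
  sqfro (Sh - S0) <= 16 * (M%:R^-1 * \sum_k sqfro (Sk k - G))
    + 16 * (\sum_i \sum_j entry_excess i j) + 16 * (l ^+ 2 * (offdiag_nnz S0)%:R).
Proof.
move=> pS0 [_ /(_ S0 pS0)]; rewrite /ensemble_loss => opt.
have M0 : 0 < M%:R :> R by rewrite ltr0n.
pose Y i j := Sh i j - S0 i j; pose W i j := G i j - S0 i j.
pose rho := M%:R^-1 * \sum_k sqfro (Sk k - G).
have h1 : \sum_i \sum_j (3 / 8 * Y i j ^+ 2 - Y i j * W i j) - 2 * rho <=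
    (2 * M%:R)^-1 * (\sum_(k < M) frobenius (Sh - Sk k) ^+ 2
                     - \sum_(k < M) frobenius (S0 - Sk k) ^+ 2).
  have e k : 2 * (\sum_i \sum_j (3 / 8 * Y i j ^+ 2 - Y i j * W i j)) - 4 * sqfro (Sk k - G)
     <= frobenius (Sh - Sk k) ^+ 2 - frobenius (S0 - Sk k) ^+ 2.
    rewrite !frobenius_sqr /sqfro !mulr_sumr -!sumrB; apply: ler_sum => i _.
    rewrite !mulr_sumr -!sumrB; apply: ler_sum => j _; rewrite !mxE /Y /W.
    by have := sqr_ge0 (Sh i j - S0 i j - 4 * (Sk k i j - G i j)); lra.
  rewrite -sumrB -(ler_pM2l (_ : 0 < 2 * M%:R)) ?mulr_gt0//.
  rewrite [leRHS]mulrA divff ?mul1r; last by rewrite gt_eqF// mulr_gt0.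
  apply: le_trans (ler_sum _ (fun k _ => e k)).
  rewrite sumrB sumr_const card_ord -mulr_sumr -[X in _ <= X - _]mulr_natl.
  rewrite /rho le_eqVlt; apply/orP; left; apply/eqP; field.
  by rewrite gt_eqF.
have h2 : l * offdiag_l1 Sh - l * offdiag_l1 S0 =
    \sum_i \sum_j (if i != j then l * (`|Sh i j| - `|S0 i j|) else 0).
  rewrite /offdiag_l1 -mulrBr -sumrB mulr_sumr; apply: eq_bigr => i _.
  by rewrite -sumrB mulr_sumr big_mkcond.
have h3 : \sum_i \sum_j (3 / 8 * Y i j ^+ 2 - Y i j * W i j) +
    \sum_i \sum_j (if i != j then l * (`|Sh i j| - `|S0 i j|) else 0) <= 2 * rho.
  by rewrite -h2; rewrite mulrBr in h1; lra.
have h4 : \sum_i \sum_j (8^-1 * Y i j ^+ 2 - 2 * entry_excess i j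
     - (if supp i j then 2 * l ^+ 2 else 0)) <= 2 * rho.
  apply: le_trans h3; rewrite -big_split; apply: ler_sum => i _ /=.
  rewrite -big_split; apply: ler_sum => j _ /=.
  have := entry_inequality i j (Sh i j); rewrite /= -/(Y i j) -/(W i j).
  by case: (i != j); case: (supp i j); lra.
have h5 : \sum_i \sum_j (8^-1 * Y i j ^+ 2 - 2 * entry_excess i j
     - (if supp i j then 2 * l ^+ 2 else 0)) =
   8^-1 * sqfro (Sh - S0) - 2 * (\sum_i \sum_j entry_excess i j)
   - 2 * l ^+ 2 * (offdiag_nnz S0)%:R.
  rewrite -sum_supp /sqfro !mulr_sumr -!sumrB; apply: eq_bigr => i _.
  rewrite !mulr_sumr -!sumrB; apply: eq_bigr => j _.
  by rewrite /Y !mxE.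
rewrite h5 in h4; rewrite -/rho; lra.
Qed.
End BasicInequality.

(** * Concentration of the sample second moments *)

Lemma measure_bigsetU_le d (T : measurableType d) (R : realType)
    (P : {measure set T -> \bar R}) (I : Type) (r : seq I) (Q : pred I) (B : I -> set T) :
  (forall i, measurable (B i)) ->
  (P (\big[setU/set0]_(i <- r | Q i) B i) <= \sum_(i <- r | Q i) P (B i))%E.
Proof.
move=> mB; elim: r => [|i r IH]; first by rewrite !big_nil measure0.
rewrite !big_cons; case: (Q i) => //.
apply: le_trans (measureU2 _ _ _) _ => //; first exact: bigsetU_measurable.
by rewrite leeD2l.
Qed.

Lemma measurable_superlevel d (T : measurableType d) (R : realType)
    (f : T -> R) (e : R) : measurable_fun setT f ->
  measurable [set w | e < f w].
Proof.
move=> mf; have -> : [set w | e < f w] = f @^-1` `]e, +oo[%classic.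
  by apply/seteqP; split => y /=; rewrite in_itv/= andbT.
by rewrite -[X in measurable X]setTI; exact: mf.
Qed.

Lemma markov_ge0 d (T : measurableType d) (R : realType) (P : probability T R)
    (f : T -> R) (a e : R) : measurable_fun setT f -> (forall w, 0 <= f w) -> 0 < e ->
  (\int[P]_w (f w)%:E <= a%:E)%E -> (P [set w | (e < f w)%R] <= (a / e)%:E)%E.
Proof.
move=> mf f0 e0 fa.
have mA := measurable_superlevel e mf.
have h : (\int[P]_w (e * \1_[set w | (e < f w)%R] w)%:E <= a%:E)%E.
  apply: le_trans fa; apply: ge0_le_integralR => //.
  - by apply: measurable_funM => //; apply/measurable_indicP.
  - by move=> w; rewrite mulr_ge0// ltW.
  - move=> w; rewrite indicE; have [/[!inE]/= h|h] := boolP (w \in _).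
      by rewrite mulr1 ltW.
    by rewrite mulr0.
move: h; rewrite ge0_integralZlR//; last exact: ltW.
by rewrite integral_indic// setIT => h; rewrite mulrC EFinM lee_pdivlMl.
Qed.

Section SampleBounds.
Context d (T : measurableType d) (R : realType) (P : probability T R) (n p : nat).
Variables (x : 'I_n -> 'I_p -> {RV P >-> R}) (S : 'M[R]_p).
Hypothesis sample : iid_centered_gaussian x S.
Variables (theta rho K : R).
Hypotheses (p_gt0 : (0 < p)%N) (n_gt0 : (0 < n)%N).
Hypotheses (theta_gt1 : 1 < theta) (rho_gt0 : 0 < rho) (K_gt0 : 0 < K).
Hypothesis S_bounds : forall u, theta^-1 * sqn u <= bil S u u <= theta * sqn u.
Hypothesis xK : forall t, `|t| <= rho -> forall i j,
  (\int[P]_w (expR (t * x i j w ^+ 2))%:E <= K%:E)%E.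

Let X w := data_matrix x w.
Let iF : independent_families P (fun i => sigma_vector (x i)).
Proof. by have [] := sample. Qed.
Let FT i : sigma_vector (x i) setT.
Proof. exact: sigma_vectorT. Qed.
Let mF i A : sigma_vector (x i) A -> measurable A.
Proof. exact: sigma_vector_measurable. Qed.
Let t0 : 0 < theta. Proof. exact: lt_trans theta_gt1. Qed.

Lemma bil_gram a b w : bil (gram (X w)) a b =
  n%:R^-1 * \sum_i lincomb x a i w * lincomb x b i w.
Proof.
rewrite /bil /gram -scalemxAr -scalemxAl mxE; congr (_ * _).
rewrite mulmxA -(trmx_mul (X w) a) -mulmxA mxE.
have lc c i : (X w *m c) i 0 = lincomb x c i w.
  by rewrite mxE; apply: eq_bigr => j _; rewrite mxE mulrC.
by apply: eq_bigr => i _; rewrite [_^T _ _]mxE !lc.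
Qed.

Lemma lincomb_delta j i w : lincomb x (delta_mx j 0) i w = x i j w.
Proof.
rewrite /lincomb (bigD1 j)//= mxE !eqxx mul1r big1 ?addr0// => k kj.
by rewrite mxE (negbTE kj) mul0r.
Qed.

Lemma variance_bounds j : theta^-1 <= S j j <= theta.
Proof. by have := S_bounds (delta_mx j 0); rewrite sqn_delta bil_delta !mulr1. Qed.

Lemma xK_rho i j : (\int[P]_w (expR (rho * x i j w ^+ 2))%:E <= K%:E)%E.
Proof. by apply: xK; rewrite ger0_norm// ltW. Qed.

Let r1 := rho / theta ^+ 2.
Let r1_gt0 : 0 < r1. Proof. by rewrite divr_gt0// exprn_gt0. Qed.

(** On the unit ball the variance is at most [theta], and at least [1 / theta] for
a coordinate, whence the loss of a factor [theta ^ 2] in the rate. *)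
Lemma lincomb_exp_unit z i : sqn z <= 1 ->
  (\int[P]_w (expR (r1 * lincomb x z i w ^+ 2))%:E <= K%:E)%E.
Proof.
move=> z1; pose j := Ordinal p_gt0.
have /andP[Sj _] := variance_bounds j.
have Sj0 : 0 < S j j by apply: lt_le_trans Sj; rewrite invr_gt0.
apply: (lincomb_exp_sqr (rho := rho) sample Sj0 (ltW r1_gt0)); last by move=> t tr; apply: xK.
have /andP[_ h] := S_bounds z.
have h2 : bil S z z <= theta by apply: le_trans h _; rewrite ler_piMr// ltW.
apply: (@le_trans _ _ (r1 * theta)); first by rewrite ler_pM2l.
have -> : r1 * theta = rho * theta^-1 by rewrite /r1; field; rewrite gt_eqF.
by rewrite ler_pM2l.
Qed.

Lemma mgf_rate_gt0 (r s : R) : 0 < r -> 0 < mgf_rate K r s.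
Proof.
move=> r0; rewrite mulr_gt0// mulr_gt0 ?expR_gt0// ltr_pwDl ?divr_gt0 ?exprn_gt0//.
by rewrite mulr_ge0// sqr_ge0.
Qed.

Lemma quadratic_deviation z (e t : R) : sqn z <= 1 -> 0 < t -> t <= r1 / 4 ->
  t * mgf_rate K r1 theta <= e / 2 ->
  (P [set w | (e < `|bil (gram (X w)) z z - bil S z z|)%R]
     <= (2 * expR (- (n%:R * (t * e / 2))))%:E)%E.
Proof.
move=> z1 tp tr te.
have S0 : 0 <= bil S z z.
  by have [_ /(_ (Ordinal n_gt0))[[_ h] _]] := sample; exact: h.
have := @prob_mean_dev _ T R P n _ iF FT mF
  (lincomb x z) (lincomb x z) K r1 theta (bil S z z).
move=> /(_ (measurable_lincomb x z) (measurable_lincomb x z)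
  (@sigma_vector_lincomb_product _ _ _ _ _ _ x z z) r1_gt0 _ _ _ _ n_gt0 t e tp tr)/wrap[].
- by move=> i; exact: lincomb_exp_unit.
- by move=> i; exact: lincomb_exp_unit.
- by move=> i; exact: lincomb_product.
- rewrite ger0_norm//; have /andP[_ h] := S_bounds z.
  by apply: le_trans h _; rewrite ler_piMr// ltW.
under eq_set => w do rewrite -bil_gram.
move=> h; apply: le_trans h _; rewrite lee_fin ler_pM2l// ler_expR.
have n0 : 0 < n%:R :> R by rewrite ltr0n.
have := ler_wpM2l (ltW n0) (ler_wpM2l (ltW tp) te); lra.
Qed.

Definition concentration_radius : R := (4 * theta)^-1.

(** Small enough for the quadratic term of the exponent to use at most half of the
linear one. *)
Definition concentration_tilt : R :=
  Num.min (r1 / 4) (concentration_radius / 2 / mgf_rate K r1 theta).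

Definition concentration_rate : R := concentration_tilt * concentration_radius / 2.

Lemma concentration_tilt_gt0 : 0 < concentration_tilt.
Proof.
rewrite lt_min divr_gt0//= divr_gt0 ?mgf_rate_gt0// divr_gt0// invr_gt0.
by rewrite mulr_gt0.
Qed.

Lemma concentration_rate_gt0 : 0 < concentration_rate.
Proof.
by rewrite divr_gt0// mulr_gt0 ?concentration_tilt_gt0// invr_gt0 mulr_gt0.
Qed.

(** The union bound over the grid costs a factor exponential in [p], against a
probability exponentially small in [n] at each grid point.  The radius
[1 / (4 theta)] on the grid becomes [1 / (2 theta)] for all directions. *)
Lemma gram_concentration : exists A : set T, [/\ measurable A,
  (P A <= (2 * ((2 ^+ 27) ^+ p * expR (- (n%:R * concentration_rate))))%:E)%E &
  forall w, ~ A w -> forall u,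
    (2 * theta)^-1 * sqn u <= bil (gram (X w)) u u <= 2 * theta * sqn u].
Proof.
set e := concentration_radius.
pose D : {set grid_index p} := [set g : grid_index p | (grid_weight g <= 25 * p)%N
   && (sqn (grid_point R g) <= 1)]%SET.
pose B g := [set w | (e < `|bil (gram (X w)) (grid_point R g) (grid_point R g)
   - bil S (grid_point R g) (grid_point R g)|)%R].
have mB g : measurable (B g).
  apply: measurable_superlevel; under eq_fun do rewrite bil_gram.
  apply: measurableT_comp => //; apply: measurable_funB => //.
  apply: measurable_funM => //; apply: measurable_sum => i.
  by apply: measurable_funM; exact: measurable_lincomb.
exists (\big[setU/set0]_(g in D) B g); split.
- by apply: bigsetU_measurable.
- have hB g : g \in D -> (P (B g) <= (2 * expR (- (n%:R * concentration_rate)))%:E)%E.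
    rewrite inE => /andP[_ g1].
    apply: (quadratic_deviation g1 concentration_tilt_gt0).
      by rewrite /concentration_tilt ge_min lexx.
    rewrite -ler_pdivlMr ?mgf_rate_gt0//.
    by rewrite /concentration_tilt ge_min lexx orbT.
  apply: (@le_trans _ _ (\sum_(g in D) (2 * expR (- (n%:R * concentration_rate)))%:E)%E).
    apply: le_trans (_ : (\sum_(g in D) P (B g) <= _)%E).
      exact: measure_bigsetU_le.
    exact: lee_sum.
  rewrite sumEFin lee_fin sumr_const -[leLHS]mulr_natl.
  rewrite [leLHS]mulrCA ler_pM2l// ler_wpM2r ?expR_ge0//.
  apply: le_trans _ (card_grid R p); rewrite ler_nat; apply: subset_leq_card.
  by apply/fintype.subsetP => g; rewrite !inE => /andP[].
- move=> w wB.
  have [St _] := iid_psd sample n_gt0.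
  have Gt : (gram (X w) - S)^T = gram (X w) - S.
    by rewrite linearB/= St /gram linearZ/= trmx_mul trmxK.
  have key := form_bound_grid p_gt0 Gt (e := e).
  move=> u; have := key _ u; move=> /(_ _)/wrap[].
    move=> g g1 g2; rewrite leNgt; apply/negP => h; apply: wB.
    by rewrite (bigD1 g) ?inE ?g1//=; left; rewrite /B/= -bilBmx.
  rewrite bilBmx ler_norml => /andP[h1 h2].
  have /andP[h3 h4] := S_bounds u.
  have e2 : 2 * e = (2 * theta)^-1.
    by rewrite /e /concentration_radius; field; rewrite gt_eqF.
  have th : theta^-1 = 2 * (2 * theta)^-1 by field; rewrite gt_eqF.
  have th2 : (2 * theta)^-1 * sqn u <= theta * sqn u.
    apply: ler_wpM2r; first exact: sqn_ge0.
    apply: (@le_trans _ _ 1); last exact: ltW.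
    have h5 : 0 < 2 * theta by rewrite mulr_gt0.
    have h6 : 1 <= 2 * theta by move: theta_gt1; lra.
    by rewrite invf_le1.
  rewrite e2 in h1 h2; rewrite th in h3.
  by apply/andP; split; lra.
Qed.

(** The means are those of products whose second factor is the constant one; the
summand [expR rho] in the moment bound accounts for this factor. *)
Lemma expectation_col_means :
  (\int[P]_w (sqn (col_means (X w)))%:E <=
   (p%:R * (64 / rho ^+ 2 * expR (rho ^+ 2 / 16 * mgf_rate (K + expR rho) rho 0) / n%:R))%:E)%E.
Proof.
set c := 64 / rho ^+ 2 * _ / n%:R.
have xE i j : (fun w => x i j w * 1) = lincomb x (delta_mx j 0) i.
  by apply/funext => w; rewrite lincomb_delta mulr1.
have colE j w : col_means (X w) j 0 = n%:R^-1 * (\sum_i (x i j w * 1)) - 0.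
  rewrite mxE subr0; congr (_ * _); apply: eq_bigr => i _.
  by rewrite mxE mulr1.
have KK : (K%:E <= (K + expR rho)%:E)%E by rewrite lee_fin lerDl expR_ge0.
have hj j : (\int[P]_w (col_means (X w) j 0 ^+ 2)%:E <= c%:E)%E.
  under eq_integral do rewrite colE.
  apply: (integral_mean_dev_sqr (U := fun i => x i j) (V := fun i _ => 1) iF FT mF) => //.
  - by move=> i B mB; rewrite xE; exact: sigma_vector_lincomb.
  - by move=> i; apply: le_trans KK; exact: xK_rho.
  - move=> i; rewrite expr1n mulr1 integral_cst//= probability_setT mule1.
    by rewrite lee_fin lerDr ltW.
  - move=> i; apply: etrans (lincomb_mean sample (delta_mx j 0) i).
    by apply: eq_integral => w _; rewrite lincomb_delta.
  - by rewrite normr0.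
have mj j : measurable_fun setT (fun w => col_means (X w) j 0 ^+ 2).
  under eq_fun do rewrite colE.
  apply: measurable_funX; apply: measurable_funB => //; apply: measurable_funM => //.
  by apply: measurable_sum => i; exact: measurable_funM.
rewrite /sqn; under eq_integral do rewrite -sumEFin.
rewrite ge0_integral_sum//; last 2 first.
- by move=> j; apply/measurable_EFinP; exact: mj.
- by move=> j w _; rewrite lee_fin sqr_ge0.
apply: (@le_trans _ _ (\sum_(j < p) c%:E)%E); first exact: lee_sum.
by rewrite sumEFin sumr_const card_ord mulr_natl.
Qed.

Lemma measurable_col_means : measurable_fun setT (fun w => sqn (col_means (X w))).
Proof.
apply: measurable_sum => j; apply: measurable_funX.
rewrite (_ : (fun w => _) = (fun w => n%:R^-1 * \sum_i x i j w)); last first.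
  by apply/funext => w; rewrite mxE; congr (_ * _); apply: eq_bigr => i _; rewrite mxE.
by apply: measurable_funM => //; exact: measurable_sum.
Qed.
End SampleBounds.

Lemma max_variance_ge0 (R : realType) p (S : 'M[R]_p) : 0 <= max_variance S.
Proof. exact: bigmax_ge_id. Qed.

Lemma psd_entry_le (R : realType) p (S : 'M[R]_p) (i j : 'I_p) : psd S ->
  `|S i j| <= max_variance S.
Proof.
move=> [St S0].
have d k : S k k <= max_variance S by apply/bigmax_geP; right; exists k.
have h1 : 0 <= bil S (delta_mx i 0 + delta_mx j 0) (delta_mx i 0 + delta_mx j 0) by exact: S0.
have h2 : 0 <= bil S (delta_mx i 0 - delta_mx j 0) (delta_mx i 0 - delta_mx j 0) by exact: S0.
move: h1 h2; rewrite !bilDl !bilDr !bilNl !bilNr !bil_delta.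
have -> : S j i = S i j by rewrite -{1}St mxE.
have := d i; have := d j; rewrite ler_norml => *; apply/andP; split; lra.
Qed.

Lemma max_variance_le (R : realType) p (S : 'M[R]_p) (a : R) : 0 <= a ->
  (forall i, S i i <= a) -> max_variance S <= a.
Proof. by move=> a0 Sa; apply/bigmax_leP; split. Qed.

(** At the tilt [rho / 4 * sqrt (log p / n)] the exponent of the tail bound for
[integral_mean_dev_excess] is at most [log p] times the left-hand side.  The
first term of [const_c1] outweighs the rate and the second one contributes
[- (m + 2) / 2]. *)
Lemma penalty_exponent (R : realType) (K rho m s : R) : 0 < K -> 0 < rho ->
  0 <= s -> 0 < m ->
  rho ^+ 2 / 16 * mgf_rate K rho s - rho / 4 * const_c1 K rho m s <= - 1.
Proof.
move=> K0 r0 s0 m0; rewrite /mgf_rate /const_c1.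
have rs : 0 <= rho * s by rewrite mulr_ge0// ltW.
have e12 : expR (rho * s / 4) <= expR (2^-1 * rho * s) by rewrite ler_expR; lra.
have k0 : 0 <= K * (2^-1 + rho ^+ 2 * s ^+ 2 / 8).
  rewrite mulr_ge0 ?addr_ge0 ?invr_ge0 ?divr_ge0 ?mulr_ge0 ?sqr_ge0//; exact: ltW.
have h := ler_wpM2l k0 e12.
have -> : rho ^+ 2 / 16 * (K * (expR (rho * s / 4) * (8 / rho ^+ 2 + 2 * s ^+ 2))) =
  K * (2^-1 + rho ^+ 2 * s ^+ 2 / 8) * expR (rho * s / 4) by field; rewrite gt_eqF.
have -> : rho / 4 * (2 * K * (rho^-1 + 4^-1 * rho * s ^+ 2) * expR (2^-1 * rho * s)
    + 2 * rho^-1 * (m + 2)) =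
  K * (2^-1 + rho ^+ 2 * s ^+ 2 / 8) * expR (2^-1 * rho * s) + (m + 2) / 2.
  by field; rewrite gt_eqF.
lra.
Qed.

Lemma const_c1_ge (R : realType) (K rho m s : R) : 0 < K -> 0 < rho ->
  2 * rho^-1 * (m + 2) <= const_c1 K rho m s.
Proof.
move=> K0 r0; rewrite /const_c1 lerDr mulr_ge0 ?expR_ge0// mulr_ge0 ?mulr_ge0 ?(ltW K0)//.
have i0 : 0 < rho^-1 by rewrite invr_gt0.
by rewrite addr_ge0 ?(ltW i0)// mulr_ge0 ?sqr_ge0// mulr_ge0 ?(ltW r0).
Qed.

Lemma penalty_ge (R : realType) (K rho m s : R) (n p : nat) : 0 < K -> 0 < rho ->
  (0 < p)%N ->
  const_c1 K rho m s * Num.sqrt (ln p%:R / n%:R) <= penalty K rho m s n p.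
Proof.
move=> K0 r0 p0; rewrite /penalty lerDr mulr_ge0 ?sqr_ge0// divr_ge0// ln_ge0//.
by rewrite ler1n.
Qed.

Section ExcessExpectation.
Context d (T : measurableType d) (R : realType) (P : probability T R) (n p : nat).
Variables (x : 'I_n -> 'I_p -> {RV P >-> R}) (S : 'M[R]_p).
Hypothesis sample : iid_centered_gaussian x S.
Variables (theta rho K m : R).
Hypotheses (p_gt0 : (0 < p)%N) (n_gt0 : (0 < n)%N).
Hypotheses (theta_gt1 : 1 < theta) (rho_gt0 : 0 < rho) (K_gt0 : 0 < K) (m_gt0 : 0 < m).
Hypothesis S_bounds : forall u, theta^-1 * sqn u <= bil S u u <= theta * sqn u.
Hypothesis xK : forall t, `|t| <= rho -> forall i j,
  (\int[P]_w (expR (t * x i j w ^+ 2))%:E <= K%:E)%E.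
Hypothesis lnp_le : ln p%:R <= n%:R :> R.

Let X w := data_matrix x w.
Let iF : independent_families P (fun i => sigma_vector (x i)).
Proof. by have [] := sample. Qed.
Let FT i : sigma_vector (x i) setT.
Proof. exact: sigma_vectorT. Qed.
Let mF i A : sigma_vector (x i) A -> measurable A.
Proof. exact: sigma_vector_measurable. Qed.
Let n0 : 0 < n%:R :> R. Proof. by rewrite ltr0n. Qed.

Let l := penalty K rho m (max_variance S) n p.

Lemma gram_entry j k w : gram (X w) j k = n%:R^-1 * \sum_i x i j w * x i k w.
Proof.
rewrite -bil_delta bil_gram; congr (_ * _); apply: eq_bigr => i _.
by rewrite !lincomb_delta.
Qed.

Let moment j k i : (\int[P]_w (x i j w * x i k w)%:E = (S j k)%:E)%E.
Proof.
rewrite -(bil_delta S j k) -(lincomb_product sample _ _ i).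
by apply: eq_integral => w _; rewrite !lincomb_delta.
Qed.

Let prod_sigma j k i B : measurable B ->
  sigma_vector (x i) ((fun w => x i j w * x i k w) @^-1` B).
Proof.
move=> mB; rewrite (_ : (fun w => _) =
    (fun w => lincomb x (delta_mx j 0) i w * lincomb x (delta_mx k 0) i w)).
  exact: sigma_vector_lincomb_product.
by apply/funext => w; rewrite !lincomb_delta.
Qed.

Let xKr i j : (\int[P]_w (expR (rho * x i j w ^+ 2))%:E <= K%:E)%E.
Proof. by apply: xK; rewrite ger0_norm// ltW. Qed.

Let pS : psd S. Proof. exact: iid_psd sample n_gt0. Qed.

Let mv_le : max_variance S <= theta.
Proof.
apply: max_variance_le; first by apply: ltW; apply: lt_trans theta_gt1.
by move=> i; have /andP[] := variance_bounds S_bounds i.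
Qed.

Definition entry_mse : R := 64 / rho ^+ 2 * expR (rho ^+ 2 / 16 * mgf_rate K rho theta).

Lemma expectation_entry_sqr j k :
  (\int[P]_w ((gram (X w) j k - S j k) ^+ 2)%:E <= (entry_mse / n%:R)%:E)%E.
Proof.
under eq_integral do rewrite gram_entry.
apply: (integral_mean_dev_sqr (U := fun i => x i j) (V := fun i => x i k) iF FT mF) => //.
- by move=> i B; exact: prod_sigma.
- by apply: le_trans (psd_entry_le j k pS) mv_le.
Qed.

(** The tail bound gains a factor [1 / p] at the level [l], so that the [p ^ 2]
entries together contribute at most a multiple of [p / n]. *)
Lemma expectation_entry_excess j k : j != k ->
  (\int[P]_w ((Num.max (`|gram (X w) j k - S j k| - l) 0) ^+ 2)%:E
     <= (64 / (rho ^+ 2 * ln 2) / (n%:R * p%:R))%:E)%E.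
Proof.
move=> jk.
have p2 : (1 < p)%N.
  rewrite ltnNge; apply: contra jk => p1; apply/eqP/val_inj.
  have := leq_trans (ltn_ord j) p1; have := leq_trans (ltn_ord k) p1.
  by rewrite !ltnS !leqn0 => /eqP k0 /eqP j0; rewrite /= j0 k0.
have ln2 : 0 < ln 2 :> R by rewrite ln_gt0// ltr1n.
have lnp : ln 2 <= ln p%:R :> R by rewrite ler_ln ?posrE ?ltr0n// ler_nat.
have lnp0 : 0 < ln p%:R :> R by apply: lt_le_trans lnp.
pose q : R := Num.sqrt (ln p%:R / n%:R).
have q0 : 0 < q by rewrite sqrtr_gt0 divr_gt0.
have q2 : q ^+ 2 = ln p%:R / n%:R by rewrite sqr_sqrtr// ltW// divr_gt0.
have q1 : q <= 1.
  by rewrite -[leRHS]sqrtr1 ler_wsqrtr// ler_pdivrMr// mul1r.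
pose t := rho / 4 * q.
have tp : 0 < t by rewrite mulr_gt0// divr_gt0.
have tr : t <= rho / 4 by rewrite ler_piMr// divr_ge0// ltW.
under eq_integral do rewrite gram_entry.
have h := @integral_mean_dev_excess _ T R P n _ iF FT mF (fun i => x i j) (fun i => x i k)
  K rho (max_variance S) (S j k) (fun i => measurable_funPT _) (fun i => measurable_funPT _)
  (prod_sigma j k) rho_gt0 (fun i => xKr i j) (fun i => xKr i k) (moment j k)
  (psd_entry_le j k pS) n_gt0 t l tp tr.
apply: le_trans h _; rewrite lee_fin.
have le1 : n%:R * (t ^+ 2 * mgf_rate K rho (max_variance S)) - t * (n%:R * l) <= - ln p%:R.
  have h1 := penalty_ge m (max_variance S) n K_gt0 rho_gt0 p_gt0.
  have h2 : t * (n%:R * (const_c1 K rho m (max_variance S) * q)) <= t * (n%:R * l).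
    by rewrite ler_pM2l// ler_pM2l.
  have h3 := ler_wpM2l (ltW lnp0) (penalty_exponent K_gt0 rho_gt0 (max_variance_ge0 S) m_gt0).
  have nq : n%:R * q ^+ 2 = ln p%:R by rewrite q2 mulrC divfK// gt_eqF.
  have e1 : n%:R * (t ^+ 2 * mgf_rate K rho (max_variance S)) =
     ln p%:R * (rho ^+ 2 / 16 * mgf_rate K rho (max_variance S)).
    by rewrite -nq /t; field.
  have e2 : t * (n%:R * (const_c1 K rho m (max_variance S) * q)) =
     ln p%:R * (rho / 4 * const_c1 K rho m (max_variance S)).
    by rewrite -nq /t; field.
  by rewrite e1; rewrite e2 in h2; lra.
have p0 : 0 < p%:R :> R by rewrite ltr0n.
have e3 : expR (- ln p%:R) = p%:R^-1 :> R by rewrite expRN lnK// posrE.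
apply: (@le_trans _ _ (4 / (t * n%:R) ^+ 2 * p%:R^-1)).
  by apply: ler_wpM2l; [rewrite divr_ge0// sqr_ge0|rewrite -e3 ler_expR].
have -> : 4 / (t * n%:R) ^+ 2 * p%:R^-1 = 64 / (rho ^+ 2 * ln p%:R) / (n%:R * p%:R).
  have -> : (t * n%:R) ^+ 2 = rho ^+ 2 / 16 * (ln p%:R * n%:R).
    rewrite (_ : ln p%:R = n%:R * q ^+ 2); first by rewrite /t; field.
    by rewrite q2 mulrC divfK// gt_eqF.
  by field; rewrite !gt_eqF.
apply: ler_wpM2r; first by rewrite invr_ge0 mulr_ge0// ltW.
apply: ler_wpM2l => //.
by rewrite lef_pV2 ?posrE ?mulr_gt0 ?exprn_gt0// ler_pM2l ?exprn_gt0.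
Qed.

Lemma measurable_entry_excess j k :
  measurable_fun setT (fun w => entry_excess l S (gram (X w)) j k).
Proof.
have mg : measurable_fun setT (fun w => gram (X w) j k - S j k).
  under eq_fun do rewrite gram_entry.
  apply: measurable_funB => //; apply: measurable_funM => //.
  by apply: measurable_sum => i; exact: measurable_funM.
rewrite /entry_excess; case: ((j == k) || _); first exact: measurable_funX.
apply: measurable_funX; apply: measurable_maxr => //; apply: measurable_funB => //.
exact: measurableT_comp.
Qed.

Lemma entry_excess_ge0 (G : 'M[R]_p) j k : 0 <= entry_excess l S G j k.
Proof. by rewrite /entry_excess; case: ifP => _; exact: sqr_ge0. Qed.

Lemma expectation_total_excess :
  (\int[P]_w (\sum_j \sum_k entry_excess l S (gram (X w)) j k)%:E
   <= ((entry_mse + 64 / (rho ^+ 2 * ln 2)) * (p%:R / n%:R)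
       + entry_mse * ((offdiag_nnz S)%:R / n%:R))%:E)%E.
Proof.
set c := entry_mse; set e := 64 / _.
have c0 : 0 <= c / n%:R.
  by rewrite divr_ge0 ?(ltW n0)// mulr_ge0 ?expR_ge0 ?divr_ge0 ?sqr_ge0.
have ln2 : 0 < ln 2 :> R by rewrite ln_gt0// ltr1n.
have e0 : 0 <= e / (n%:R * p%:R).
  apply: divr_ge0; last by rewrite mulr_ge0.
  by apply: divr_ge0 => //; rewrite mulr_ge0 ?sqr_ge0// ltW.
pose b j k : R := (if j == k then c / n%:R else 0)
  + (if (j != k) && (S j k != 0) then c / n%:R else 0) + e / (n%:R * p%:R).
have eb j k : (\int[P]_w (entry_excess l S (gram (X w)) j k)%:E <= (b j k)%:E)%E.
  rewrite /entry_excess /b; case: (eqVneq j k) => [->|jk] /=.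
    apply: le_trans (expectation_entry_sqr k k) _; rewrite lee_fin addr0.
    by rewrite lerDl.
  case: (eqVneq (S j k) 0) => s0 /=.
    by apply: le_trans (expectation_entry_excess jk) _; rewrite lee_fin !add0r.
  apply: le_trans (expectation_entry_sqr j k) _; rewrite lee_fin add0r.
  by rewrite lerDl.
have e1 : (\int[P]_w (\sum_j \sum_k entry_excess l S (gram (X w)) j k)%:E =
   \sum_j \sum_k \int[P]_w (entry_excess l S (gram (X w)) j k)%:E)%E.
  under eq_integral do rewrite -sumEFin.
  rewrite ge0_integral_sum//; last 2 first.
  - move=> j; apply/measurable_EFinP; apply: measurable_sum => k.
    exact: measurable_entry_excess.
  - by move=> j w _; rewrite lee_fin sumr_ge0// => k _; exact: entry_excess_ge0.
  apply: eq_bigr => j _; under eq_integral do rewrite -sumEFin.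
  rewrite ge0_integral_sum//.
  - by move=> k; apply/measurable_EFinP; exact: measurable_entry_excess.
  - by move=> k w _; rewrite lee_fin entry_excess_ge0.
rewrite e1; apply: (@le_trans _ _ (\sum_j \sum_k (b j k)%:E)%E).
  by apply: lee_sum => j _; exact: lee_sum.
under eq_bigr do rewrite sumEFin.
rewrite sumEFin lee_fin /b.
have b1 : \sum_j \sum_(k < p) (if j == k then c / n%:R else 0) = p%:R * (c / n%:R).
  rewrite (eq_bigr (fun=> c / n%:R)) ?sumr_const ?card_ord ?mulr_natl// => j _.
  by rewrite (bigD1 j)//= eqxx big1 ?addr0// => k kj; rewrite eq_sym (negbTE kj).
have b3 : \sum_(j < p) \sum_(k < p) e / (n%:R * p%:R) = e * (p%:R / n%:R).
  have p0 : 0 < p%:R :> R by rewrite ltr0n.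
  rewrite !sumr_const !card_ord -mulrnA -[LHS]mulr_natl natrM.
  by field; rewrite !gt_eqF.
have -> : \sum_j \sum_k ((if j == k then c / n%:R else 0)
  + (if (j != k) && (S j k != 0) then c / n%:R else 0) + e / (n%:R * p%:R)) =
  p%:R * (c / n%:R) + c / n%:R * (offdiag_nnz S)%:R + e * (p%:R / n%:R).
  rewrite -b1 -b3 -sum_supp -!big_split; apply: eq_bigr => j _ /=.
  by rewrite -!big_split; apply: eq_bigr.
by rewrite le_eqVlt; apply/orP; left; apply/eqP; field; rewrite gt_eqF.
Qed.
End ExcessExpectation.

(** * The error for a fixed sample size *)

Section SampleError.
Context d (T : measurableType d) (R : realType) (P : probability T R) (n p M : nat).
Variables (x : 'I_n -> 'I_p -> {RV P >-> R}) (S : 'M[R]_p).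
Hypothesis sample : iid_centered_gaussian x S.
Variables (theta rho K m : R).
Hypotheses (p_gt0 : (0 < p)%N) (n_gt1 : (1 < n)%N) (M_gt0 : (0 < M)%N).
Hypotheses (theta_gt1 : 1 < theta) (rho_gt0 : 0 < rho) (K_gt0 : 0 < K) (m_gt0 : 0 < m).
Hypothesis S_bounds : forall u, theta^-1 * sqn u <= bil S u u <= theta * sqn u.
Hypothesis xK : forall t, `|t| <= rho -> forall i j,
  (\int[P]_w (expR (t * x i j w ^+ 2))%:E <= K%:E)%E.
Variables (pi : 'I_M -> 'S_p) (eta : 'I_M -> 'I_p -> R)
  (Lhat : 'I_M -> T -> 'M[R]_p) (Dhat : 'I_M -> T -> 'rV[R]_p).
Hypothesis eta_ge0 : forall k j, 0 <= eta k j.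
Hypothesis regression : forall k w, cholesky_regression (eta k)
  (data_matrix x w *m perm_mx (pi k)) (Lhat k w) (Dhat k w).
Let l := penalty K rho m (max_variance S) n p.
Variables (nu : R) (Splus : T -> 'M[R]_p).
Hypothesis nu_lt : nu < theta^-1.
Hypothesis Splus_meas : random_matrix Splus.
Hypothesis estimator : forall w, ensemble_estimator nu l
  (fun k => perm_mx (pi k) *m (Lhat k w *m diag_mx (Dhat k w) *m (Lhat k w)^T)
            *m (perm_mx (pi k))^T) (Splus w).

Variable eps : R.
Hypothesis eps_gt0 : 0 < eps.
Let C : R := 8 * theta ^+ 2.
Let pw k : R := p%:R * ((\sum_j eta k j) / (2 * n%:R)).
Hypothesis lnp_le : ln p%:R <= n%:R :> R.
Hypothesis pw_le : forall k, pw k <= (4 * theta)^-1.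
Hypothesis pw_small : forall k, 16 * (C ^+ 2 * (2 * pw k ^+ 2)) <= eps ^+ 2 / 8.
Hypothesis p_small :
  16 * (C ^+ 2 * (8 * p%:R * (2 * theta / n.-1%:R) ^+ 2)) <= eps ^+ 2 / 8.
Hypothesis l_small : 16 * (l ^+ 2 * (offdiag_nnz S)%:R) <= eps ^+ 2 / 8.

(** The summands bound the probabilities that the eigenvalues of the sample second
moments, the column means, or the total excess of the entries are not
controlled. *)
Definition sample_error_probability : R :=
  2 * ((2 ^+ 27) ^+ p * expR (- (n%:R * concentration_rate theta rho K)))
  + p%:R * (64 / rho ^+ 2 * expR (rho ^+ 2 / 16 * mgf_rate (K + expR rho) rho 0) / n%:R)
    / (eps / (64 * C ^+ 2))
  + ((entry_mse theta rho K + 64 / (rho ^+ 2 * ln 2)) * (p%:R / n%:R)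
      + entry_mse theta rho K * ((offdiag_nnz S)%:R / n%:R)) / (eps ^+ 2 / 128).

(** Outside the three events of [sample_error_probability] the squared error is at
most [eps ^ 2], by [ensemble_basic] and [regression_perturbation]. *)
Lemma sample_error_bound :
  (P [set w | (eps < `|frobenius (Splus w - S) - 0|)%R] <=
   sample_error_probability%:E)%E.
Proof.
have n_gt0 : (0 < n)%N by exact: ltn_trans n_gt1.
have t0 : 0 < theta by exact: lt_trans theta_gt1.
have l0 : 0 <= l.
  apply: le_trans (penalty_ge _ _ _ K_gt0 rho_gt0 p_gt0).
  rewrite mulr_ge0 ?sqrtr_ge0//; apply: le_trans (const_c1_ge _ _ K_gt0 rho_gt0).
  by rewrite mulr_ge0 ?mulr_ge0 ?invr_ge0 ?addr_ge0// ltW.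
have pS : psd S by exact: iid_psd sample n_gt0.
have pSnu : psd (S - nu%:M).
  have [St _] := pS; split; first by rewrite linearB/= St tr_scalar_mx.
  move=> u; rewrite -[X in _ <= X]/(bil (S - nu%:M) u u) bilBmx bil_scalar -sqnE.
  have /andP[h _] := S_bounds u; have h2 : nu * sqn u <= theta^-1 * sqn u.
    by apply: ler_wpM2r; [exact: sqn_ge0|exact: ltW].
  by rewrite subr_ge0; exact: le_trans h2 h.
have C0 : 0 < C by rewrite mulr_gt0// exprn_gt0.
have [A [mA PA hA]] := gram_concentration sample p_gt0 n_gt0 theta_gt1 rho_gt0 K_gt0 S_bounds xK.
pose d1 := eps / (64 * C ^+ 2); pose d2 := eps ^+ 2 / 128.
have d10 : 0 < d1 by rewrite divr_gt0// mulr_gt0// exprn_gt0.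
have d20 : 0 < d2 by rewrite divr_gt0// exprn_gt0.
pose B := [set w | (d1 < sqn (col_means (data_matrix x w)))%R].
pose tot w := \sum_j \sum_k entry_excess l S (gram (data_matrix x w)) j k.
pose D := [set w | (d2 < tot w)%R].
have mtot : measurable_fun setT tot.
  apply: measurable_sum => j; apply: measurable_sum => k.
  exact: measurable_entry_excess.
have mB : measurable B by apply: measurable_superlevel; exact: measurable_col_means.
have mD : measurable D by exact: measurable_superlevel.
have PB : (P B <= (p%:R * (64 / rho ^+ 2 * expR (rho ^+ 2 / 16 * mgf_rate (K + expR rho) rho 0) / n%:R) / d1)%:E)%E.
  apply: markov_ge0 => //; first exact: measurable_col_means.
    by move=> w; exact: sqn_ge0.
  exact: (expectation_col_means sample n_gt0 rho_gt0 K_gt0 xK).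
have PD : (P D <= (((entry_mse theta rho K + 64 / (rho ^+ 2 * ln 2)) * (p%:R / n%:R)
      + entry_mse theta rho K * ((offdiag_nnz S)%:R / n%:R)) / d2)%:E)%E.
  apply: markov_ge0 => //.
    by move=> w; apply: sumr_ge0 => j _; apply: sumr_ge0 => k _; exact: entry_excess_ge0.
  exact: (expectation_total_excess sample _ _ theta_gt1 _ _ _ S_bounds xK).
have evE : [set w | (eps < `|frobenius (Splus w - S) - 0|)%R] =
    [set w | (eps ^+ 2 < sqfro (Splus w - S))%R].
  apply/funext => w /=; congr is_true.
  rewrite subr0 ger0_norm ?sqrtr_ge0// -frobenius_sqr ltr_sqr ?nnegrE ?sqrtr_ge0//.
  exact: ltW.
have mev : measurable [set w | (eps ^+ 2 < sqfro (Splus w - S))%R].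
  apply: measurable_superlevel; apply: measurable_sum => i; apply: measurable_sum => j.
  apply: measurable_funX; rewrite (_ : (fun w => _) = (fun w => Splus w i j - S i j)).
    by apply: measurable_funB => //; exact: Splus_meas.
  by apply/funext => w; rewrite !mxE.
rewrite evE; apply: (@le_trans _ _ (P (A `|` B `|` D))).
  apply: le_measure; rewrite ?inE//; first by apply: measurableU => //; exact: measurableU.
  move=> w /= ew; apply: contrapT => /not_orP[/not_orP[nA nB] nD].
  have gb := hA w nA.
  have hB : sqn (col_means (data_matrix x w)) <= d1 by rewrite leNgt; apply/negP.
  have hD : tot w <= d2 by rewrite leNgt; apply/negP.
  have Cc : 2 * (2 * theta) / (2 * theta)^-1 = C.
    by rewrite /C; field; rewrite gt_eqF.
  have hR k : sqfro (perm_mx (pi k) *m (Lhat k w *m diag_mx (Dhat k w) *m (Lhat k w)^T)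
            *m (perm_mx (pi k))^T - gram (data_matrix x w)) <= 3 / 128 * eps ^+ 2.
    have k10 : 0 < (2 * theta)^-1 by rewrite invr_gt0 mulr_gt0.
    have h := @regression_perturbation _ _ _ (data_matrix x w) (pi k) (eta k)
      (Lhat k w) (Dhat k w) (eta_ge0 k) p_gt0 n_gt1 (regression k w)
      (2 * theta)^-1 (2 * theta) k10 gb.
    have hw : p%:R * ((\sum_j eta k j) / (2 * n%:R)) <= (2 * theta)^-1 / 2.
      apply: le_trans (pw_le k) _; rewrite le_eqVlt; apply/orP; left; apply/eqP.
      by field; rewrite gt_eqF.
    move: (h hw); rewrite Cc => h2; apply: le_trans h2 _.
    have h3 := pw_small k; rewrite /pw in h3.
    have h4 : C ^+ 2 * (32 * (C * sqn (col_means (data_matrix x w))) ^+ 2) <=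
        eps ^+ 2 / 128.
      have h5 : (C * sqn (col_means (data_matrix x w))) ^+ 2 <= (C * d1) ^+ 2.
        rewrite ler_sqr ?nnegrE; first by rewrite ler_pM2l.
          by apply: mulr_ge0; [exact: ltW|exact: sqn_ge0].
        by apply: mulr_ge0; exact: ltW.
      have cE c : 0 < c -> c ^+ 2 * (32 * (c * (eps / (64 * c ^+ 2))) ^+ 2) = eps ^+ 2 / 128.
        by move=> c0; field; rewrite gt_eqF.
      rewrite -(cE C C0); apply: ler_wpM2l; first exact: sqr_ge0.
      by apply: ler_wpM2l.
    have sum3 (c a b g e : R) : 16 * (c * a) <= e / 8 -> c * b <= e / 128 ->
        16 * (c * g) <= e / 8 -> c * (a + b + g) <= 3 / 128 * e.
      by rewrite !mulrDr; lra.
    exact: sum3 p_small h4 h3.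
  have := ensemble_basic (gram (data_matrix x w)) M_gt0 l0 pSnu (estimator w).
  have M0 : 0 < M%:R :> R by rewrite ltr0n.
  have hav : M%:R^-1 * \sum_k sqfro (perm_mx (pi k) *m
      (Lhat k w *m diag_mx (Dhat k w) *m (Lhat k w)^T)
            *m (perm_mx (pi k))^T - gram (data_matrix x w)) <= 3 / 128 * eps ^+ 2.
    rewrite ler_pdivrMl//.
    apply: le_trans (ler_sum _ (fun k _ => hR k)) _.
    by rewrite sumr_const card_ord -[leLHS]mulr_natl.
  have e2 : 0 < eps ^+ 2 by rewrite exprn_gt0.
  move: hD; rewrite /tot /d2 => hD h; move: ew l_small h hav; rewrite -/l; lra.
rewrite /sample_error_probability EFinD EFinD -/d1 -/d2.
apply: le_trans (measureU2 _ _ _) _ => //; first exact: measurableU.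
apply: leeD => //; apply: le_trans (measureU2 _ _ _) _ => //.
exact: leeD.
Qed.
End SampleError.

(** * Rates *)

Section Asymptotics.
Context (R : realType).

Lemma littleo_le (f g : nat -> R) : f =o_\oo g ->
  forall e, 0 < e -> \forall n \near \oo, `|f n| <= e * `|g n|.
Proof. by move/eqoP => h e e0; exact: h. Qed.

Lemma bigO_le (f g : nat -> R) : f =O_\oo g ->
  exists2 c, 0 < c & \forall n \near \oo, `|f n| <= c * `|g n|.
Proof. by move/eqO_exP => [c [c0 h]]; exists c. Qed.

Lemma ln2_gt0 : 0 < ln 2 :> R. Proof. by rewrite ln_gt0// ltr1n. Qed.

(** The order of the squared error: each of the [s + p] entries that are not
thresholded away costs [log p / n]. *)
Definition load (s p n : nat) : R := (s + p)%:R * (ln p%:R / n%:R).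

Lemma load_ge0 s p n : 0 <= load s p n.
Proof.
rewrite mulr_ge0// divr_ge0//; have [->|p0] := posnP p; first by rewrite ln0.
by rewrite ln_ge0// ler1n.
Qed.

Definition load_const : R := 1 + (ln 2)^-1.

(** For [p >= 2] the logarithm is bounded below; for [p = 1] the load vanishes and
the term [1 / n] takes over. *)
Lemma dim_le_load (q s p n : nat) : (0 < p)%N -> (q <= s + p)%N ->
  (p = 1%N -> (q <= 1)%N) ->
  q%:R / n%:R <= load_const * (n%:R^-1 + load s p n).
Proof.
move=> p0 qsp q1; have l2 := ln2_gt0; have l0 := load_ge0 s p n.
have n0 : 0 <= n%:R^-1 :> R by rewrite invr_ge0.
have i2 : 0 <= (ln 2)^-1 :> R by rewrite invr_ge0 ltW.
have [p1|p1] := leqP p 1.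
  have {q1} : q%:R / n%:R <= n%:R^-1 :> R.
    by rewrite ler_piMl// (_ : 1 = 1%:R)// ler_nat q1//; apply/eqP; rewrite eqn_leq p1.
  move=> h; apply: le_trans h _; rewrite /load_const mulrDl mul1r.
  have : 0 <= (ln 2)^-1 * (n%:R^-1 + load s p n) by rewrite mulr_ge0// addr_ge0.
  lra.
have lnp : ln 2 <= ln p%:R :> R by rewrite ler_ln ?posrE ?ltr0n// ler_nat.
have h : q%:R / n%:R <= (ln 2)^-1 * load s p n.
  rewrite ler_pdivlMl// /load mulrCA; apply: ler_pM => //.
  - by rewrite mulr_ge0// ltW.
  - by rewrite ler_nat.
  - by rewrite ler_wpM2r.
apply: le_trans h _; rewrite /load_const mulrDl mul1r mulrDr.
have : 0 <= (ln 2)^-1 * n%:R^-1 :> R by rewrite mulr_ge0.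
lra.
Qed.

Section PenaltyRate.
Variables (s p : nat -> nat) (lam : nat -> R) (c : R).
Hypotheses (c0 : 0 < c) (p0 : forall n, (0 < p n)%N).
Hypothesis lam_ge : forall n, c * Num.sqrt (ln (p n)%:R / n%:R) <= lam n.
Hypothesis lam_o : lam =o_\oo (fun n => (Num.sqrt (s n + p n)%:R)^-1).

Let lam_ge0 n : 0 <= lam n.
Proof. by apply: le_trans (lam_ge n); rewrite mulr_ge0 ?sqrtr_ge0// ltW. Qed.

(** This squares the hypothesis on [lam]. *)
Lemma penalty_sqr_small e : 0 < e ->
  \forall n \near \oo, lam n ^+ 2 * (s n + p n)%:R <= e.
Proof.
move=> e0; have se : 0 < Num.sqrt e by rewrite sqrtr_gt0.
apply: filterS (littleo_le lam_o se) => n.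
have q0 : 0 < (s n + p n)%:R :> R by rewrite ltr0n addn_gt0 p0 orbT.
have sq0 : 0 < Num.sqrt (s n + p n)%:R :> R by rewrite sqrtr_gt0.
rewrite (ger0_norm (lam_ge0 n)) ger0_norm ?invr_ge0 ?sqrtr_ge0// ler_pdivlMr// => h.
have -> : lam n ^+ 2 * (s n + p n)%:R = (lam n * Num.sqrt (s n + p n)%:R) ^+ 2.
  by rewrite exprMn sqr_sqrtr// ltW.
have -> : e = Num.sqrt e ^+ 2 by rewrite sqr_sqrtr// ltW.
by rewrite ler_sqr ?nnegrE ?mulr_ge0 ?sqrtr_ge0.
Qed.

(** The penalty dominates a multiple of [sqrt (log p / n)]. *)
Lemma load_small e : 0 < e -> \forall n \near \oo, load (s n) (p n) n <= e.
Proof.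
move=> e0; have e1 : 0 < c ^+ 2 * e by rewrite mulr_gt0// exprn_gt0.
apply: filterS (penalty_sqr_small e1) => n h.
rewrite -(ler_pM2l (_ : 0 < c ^+ 2)) ?exprn_gt0//; apply: le_trans h.
rewrite /load mulrC -mulrA [leRHS]mulrC; apply: ler_wpM2l => //.
have d0 : 0 <= ln (p n)%:R / n%:R :> R by rewrite divr_ge0// ln_ge0// ler1n.
rewrite mulrC -{1}(sqr_sqrtr d0) -exprMn.
by rewrite ler_sqr ?nnegrE ?mulr_ge0 ?sqrtr_ge0// ltW.
Qed.
End PenaltyRate.

Lemma offdiag_nnz1 p (S : 'M[R]_p) : p = 1%N -> offdiag_nnz S = 0%N.
Proof.
move=> p1; apply/eqP; rewrite /offdiag_nnz cards_eq0; apply/eqP/setP => -[i j].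
rewrite !inE/=; have -> : i = j.
  by apply: val_inj => /=; have := ltn_ord i; have := ltn_ord j; rewrite [X in (_ < X)%N -> (_ < X)%N -> _]p1 !ltnS !leqn0 => /eqP -> /eqP ->.
by rewrite eqxx.
Qed.

Definition error_const (theta rho K eps : R) : R :=
  4 / concentration_rate theta rho K
  + load_const * (64 / rho ^+ 2 * expR (rho ^+ 2 / 16 * mgf_rate (K + expR rho) rho 0)
      / (eps / (64 * (8 * theta ^+ 2) ^+ 2))
    + (entry_mse theta rho K + 64 / (rho ^+ 2 * ln 2) + entry_mse theta rho K)
      / (eps ^+ 2 / 128)).

(** Once [p / n] is small, half of the exponential rate in [n] absorbs the number
of grid points. *)
Lemma sample_error_probability_le n p (S : 'M[R]_p) (theta rho K eps : R) :
  (0 < n)%N -> (0 < p)%N -> 0 < theta -> 0 < rho -> 0 < K -> 0 < eps ->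
  0 < concentration_rate theta rho K ->
  p%:R / n%:R * (27 * ln 2) <= concentration_rate theta rho K / 2 ->
  sample_error_probability n S theta rho K eps <=
  error_const theta rho K eps * (n%:R^-1 + load (offdiag_nnz S) p n).
Proof.
move=> n0 p0 th0 rho0 K0 eps0 rate0 pn.
set rate := concentration_rate theta rho K in rate0 pn *.
set v := n%:R^-1 + load (offdiag_nnz S) p n.
have nr0 : 0 < n%:R :> R by rewrite ltr0n.
have v0 : 0 <= v by rewrite addr_ge0 ?invr_ge0 ?load_ge0.
have nv : n%:R^-1 <= v by rewrite lerDl load_ge0.
have pv : p%:R / n%:R <= load_const * v.
  by apply: dim_le_load => //; [rewrite leq_addl|move=> ->].
have sv : (offdiag_nnz S)%:R / n%:R <= load_const * v.
  by apply: dim_le_load => //; [rewrite leq_addr|move=> p1; rewrite offdiag_nnz1].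
have h1 : (2 ^+ 27) ^+ p * expR (- (n%:R * rate)) <= 2 / rate * n%:R^-1.
  have -> : (2 ^+ 27) ^+ p = expR (p%:R * (27 * ln 2)) :> R.
    by rewrite expRM_natl expRM_natl lnK// posrE.
  rewrite -expRD.
  have le : p%:R * (27 * ln 2) - n%:R * rate <= - (n%:R * rate / 2).
    have h : p%:R * (27 * ln 2) <= n%:R * (rate / 2).
      rewrite -ler_pdivrMl//; apply: le_trans pn; rewrite le_eqVlt.
      by apply/orP; left; apply/eqP; field; rewrite gt_eqF.
    by rewrite mulrA in h; lra.
  apply: (@le_trans _ _ (expR (- (n%:R * rate / 2)))); first by rewrite ler_expR.
  rewrite expRN.
  have -> : 2 / rate * n%:R^-1 = (n%:R * rate / 2)^-1 by field; rewrite !gt_eqF.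
  have nr : 0 < n%:R * rate / 2 by rewrite divr_gt0// mulr_gt0.
  rewrite lef_pV2 ?posrE ?expR_gt0//.
  by apply: le_trans (expR_ge1Dx _); rewrite lerDr.
have t1 : 2 * ((2 ^+ 27) ^+ p * expR (- (n%:R * rate))) <= 4 / rate * v.
  have : 2 / rate * n%:R^-1 <= 2 / rate * v by apply: ler_wpM2l => //; rewrite divr_ge0// ltW.
  have -> : 4 / rate * v = 2 * (2 / rate * v) by field; rewrite gt_eqF.
  by lra.
rewrite /sample_error_probability /error_const -/rate.
set a := 64 / rho ^+ 2 * expR _; set b := entry_mse theta rho K.
set g := 64 / (rho ^+ 2 * ln 2).
set d1 := eps / _; set d2 := eps ^+ 2 / 128.
have a0 : 0 <= a by rewrite mulr_ge0 ?expR_ge0// divr_ge0// sqr_ge0.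
have b0 : 0 <= b by rewrite /b /entry_mse mulr_ge0 ?expR_ge0// divr_ge0// sqr_ge0.
have g0 : 0 <= g by rewrite /g divr_ge0// mulr_ge0 ?sqr_ge0// ltW// ln2_gt0.
have d10 : 0 < d1 by rewrite /d1 divr_gt0// mulr_gt0// exprn_gt0// mulr_gt0// exprn_gt0.
have d20 : 0 < d2 by rewrite /d2 divr_gt0// exprn_gt0.
have t2 : p%:R * (a / n%:R) / d1 <= load_const * v * (a / d1).
  have -> : p%:R * (a / n%:R) / d1 = p%:R / n%:R * (a / d1).
    by field; rewrite !gt_eqF.
  by apply: ler_wpM2r => //; rewrite divr_ge0// ltW.
have t3 : ((b + g) * (p%:R / n%:R) + b * ((offdiag_nnz S)%:R / n%:R)) / d2 <=
    load_const * v * ((b + g + b) / d2).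
  rewrite mulrA ler_pM2r ?invr_gt0//.
  have e1 := ler_wpM2l (addr_ge0 b0 g0) pv; have e2 := ler_wpM2l b0 sv.
  have -> : load_const * v * (b + g + b) = (b + g) * (load_const * v) + b * (load_const * v) by ring.
  exact: lerD.
apply: le_trans (lerD (lerD t1 t2) t3) _.
by rewrite le_eqVlt; apply/orP; left; apply/eqP; ring.
Qed.
End Asymptotics.

Lemma inv_nat_small (R : realType) (e : R) : 0 < e ->
  \forall n \near \oo, n%:R^-1 <= e.
Proof.
move=> e0; exists (Num.truncn e^-1).+1 => // n /= hn.
have h : e^-1 < n%:R by apply: lt_le_trans (truncnS_gt _) _; rewrite ler_nat.
have n0 : 0 < n%:R :> R by apply: lt_trans h; rewrite invr_gt0.
by rewrite -[leRHS]invrK lef_pV2 ?posrE ?invr_gt0// ltW.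
Qed.

Theorem theorem2 (R : realType)
  (* the triangular array of samples *)
  (d : nat -> measure_display) (T : forall n, measurableType (d n))
  (P : forall n, probability (T n) R)
  (p : nat -> nat) (Sigma0 : forall n, 'M[R]_(p n))
  (x : forall n, 'I_n -> 'I_(p n) -> {RV (P n) >-> R})
  (* the variable orders and the true Cholesky factors *)
  (M : nat) (pi : forall n, 'I_M -> 'S_(p n))
  (L0 : forall n, 'I_M -> 'M[R]_(p n)) (D0 : forall n, 'I_M -> 'rV[R]_(p n))
  (* tuning parameters and outputs of the penalized regressions *)
  (eta : forall n, 'I_M -> 'I_(p n) -> R)
  (Lhat : forall n, 'I_M -> T n -> 'M[R]_(p n))
  (Dhat : forall n, 'I_M -> T n -> 'rV[R]_(p n))
  (theta rho K m : R)
  (p_gt0 : forall n, (0 < p n)%N)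
  (M_gt0 : (0 < M)%N)
  (sample : forall n, iid_centered_gaussian (@x n) (Sigma0 n))
  (pi_inj : forall n, injective (@pi n))
  (mcd0 : forall n k, mcd (permuted (@pi n k) (Sigma0 n)) (@L0 n k) (@D0 n k))
  (eta_ge0 : forall n k j, 0 <= @eta n k j)
  (Lhat_meas : forall n k, random_matrix (@Lhat n k))
  (regression : forall n k w,
    cholesky_regression (@eta n k)
      (data_matrix (@x n) w *m perm_mx (@pi n k)) (@Lhat n k w) (@Dhat n k w))
  (theta_gt1 : 1 < theta) (rho_gt0 : 0 < rho) (K_gt0 : 0 < K) (m_gt0 : 0 < m)
  (cond1 : forall n, [/\ theta^-1 < sv (Sigma0 n) (p n),
                         sv (Sigma0 n) (p n) <= sv (Sigma0 n) 1
                       & sv (Sigma0 n) 1 < theta])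
  (cond2a : forall k : 'I_M,
    (fun n : nat => \sum_(j < p n) @eta n k j)
      =O_\oo (fun n : nat => ln (p n)%:R / n%:R : R))
  (cond2b :
    (fun n : nat =>
       ((\max_(k < M) strict_lower_nnz (@L0 n k)) + p n)%:R * ln (p n)%:R : R)
      =o_\oo (fun n : nat => n%:R : R))
  (cond3 :
    (fun n : nat => penalty K rho m (max_variance (Sigma0 n)) n (p n))
      =o_\oo (fun n : nat => (Num.sqrt (offdiag_nnz (Sigma0 n) + p n)%:R)^-1 : R))
  (cond4 : forall t : R, `|t| <= rho -> forall n (i : 'I_n) (j : 'I_(p n)),
    ('E_(P n)[fun w => expR (t * @x n i j w ^+ 2)] <= K%:E)%E) :
  exists nu0 : R, 0 < nu0 /\
    forall nu : R, 0 < nu < nu0 ->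
    forall Splus : forall n, T n -> 'M[R]_(p n),
      (forall n, random_matrix (@Splus n)) ->
      (forall n w,
        ensemble_estimator nu
          (penalty K rho m (max_variance (Sigma0 n)) n (p n))
          (fun k => perm_mx (@pi n k) *m
                    (@Lhat n k w *m diag_mx (@Dhat n k w) *m (@Lhat n k w)^T) *m
                    (perm_mx (@pi n k))^T)
          (@Splus n w)) ->
      cvg_in_probability P (fun n w => frobenius (@Splus n w - Sigma0 n)) 0.

Proof.
have th0 : 0 < theta by exact: lt_trans theta_gt1.
exists theta^-1; split; first by rewrite invr_gt0.
move=> nu /andP[nu_gt0 nu_lt] Splus Splus_meas est eps eps0.
pose s n := offdiag_nnz (Sigma0 n).
pose lam n := penalty K rho m (max_variance (Sigma0 n)) n (p n).
pose c := 2 * rho^-1 * (m + 2).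
have c_gt0 : 0 < c by rewrite mulr_gt0// ?addr_gt0// mulr_gt0// invr_gt0.
have lam_ge n : c * Num.sqrt (ln (p n)%:R / n%:R) <= lam n.
  apply: le_trans (penalty_ge m (max_variance (Sigma0 n)) n K_gt0 rho_gt0 (p_gt0 n)).
  by apply: ler_wpM2r; [exact: sqrtr_ge0|exact: const_c1_ge].
have loadS e : 0 < e -> \forall n \near \oo, load R (s n) (p n) n <= e.
  exact: (load_small c_gt0 p_gt0 lam_ge cond3).
have lamS e : 0 < e -> \forall n \near \oo, lam n ^+ 2 * (s n + p n)%:R <= e.
  exact: (penalty_sqr_small c_gt0 p_gt0 lam_ge cond3).
pose v n : R := n%:R^-1 + load R (s n) (p n) n.
have vS e : 0 < e -> \forall n \near \oo, v n <= e.
  move=> e0; have e2 : 0 < e / 2 by rewrite divr_gt0.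
  apply: filterS2 (inv_nat_small e2) (loadS _ e2) => n; rewrite /v; lra.
have v0 n : 0 <= v n by rewrite addr_ge0 ?invr_ge0 ?load_ge0.
pose pw n k : R := (p n)%:R * ((\sum_j eta n k j) / (2 * n%:R)).
have pw0 n k : 0 <= pw n k.
  by rewrite mulr_ge0// divr_ge0 ?mulr_ge0// sumr_ge0.
have pwS k e : 0 < e -> \forall n \near \oo, pw n k <= e.
  move=> e0; have [b b0 hb] := bigO_le (cond2a k).
  have eb : 0 < e / b by rewrite divr_gt0.
  apply: filterS3 (nbhs_infty_gt 0) hb (loadS _ eb) => n n0.
  have d0 : 0 <= ln (p n)%:R / n%:R :> R by rewrite divr_ge0// ln_ge0// ler1n.
  rewrite ger0_norm ?sumr_ge0// ger0_norm// => h1 h2.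
  have nr1 : 1 <= n%:R :> R by rewrite ler1n.
  have h3 : pw n k <= (p n)%:R * (b * (ln (p n)%:R / n%:R)).
    apply: ler_wpM2l => //; apply: le_trans h1.
    by rewrite ler_piMr ?sumr_ge0// invf_le1; lra.
  have h4 : (p n)%:R * (ln (p n)%:R / n%:R) <= load R (s n) (p n) n.
    by apply: ler_wpM2r => //; rewrite ler_nat leq_addl.
  have := ler_wpM2l (ltW b0) (le_trans h4 h2).
  have -> : b * (e / b) = e by field; rewrite gt_eqF.
  by apply: le_trans; rewrite mulrCA.
set C := 8 * theta ^+ 2.
have C0 : 0 < C by rewrite mulr_gt0// exprn_gt0.
set rate := concentration_rate theta rho K.
have rate0 : 0 < rate by exact: concentration_rate_gt0.
have k0 : 0 < load_const R by rewrite addr_gt0// invr_gt0 ln2_gt0.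
have l2 := ln2_gt0 R.
pose e1 := Num.min (4 * theta)^-1 (eps / (16 * C)).
have e1_gt0 : 0 < e1 by rewrite lt_min invr_gt0 mulr_gt0//= divr_gt0// mulr_gt0.
pose e2 := eps ^+ 2 / (128 * (128 * (C ^+ 2 * theta ^+ 2 * load_const R))).
have e2_gt0 : 0 < e2.
  apply: divr_gt0; first exact: exprn_gt0.
  by do 4?[apply: mulr_gt0 => //]; exact: exprn_gt0.
pose e3 := rate / (54 * ln 2 * load_const R).
have e3_gt0 : 0 < e3 by rewrite divr_gt0// !mulr_gt0.
have e4_gt0 : 0 < eps ^+ 2 / 128 by rewrite divr_gt0// exprn_gt0.
have pw_near : \forall n \near \oo, forall k, pw n k <= e1.
  by apply: filter_forall => k; exact: pwS.
have bound : \forall n \near \oo,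
    (P n [set w | (eps < `|frobenius (Splus n w - Sigma0 n) - 0|)%R] <=
     (error_const theta rho K eps * v n)%:E)%E.
  near=> n.
  have n1 : (1 < n)%N by near: n; exact: nbhs_infty_gt.
  have n0 : (0 < n)%N by exact: ltn_trans n1.
  have nr0 : 0 < n%:R :> R by rewrite ltr0n.
  have ld : load R (s n) (p n) n <= 1 by near: n; exact: loadS.
  have pwn : forall k, pw n k <= e1 by near: n.
  have v2 : v n <= e2 by near: n; exact: vS.
  have v3 : v n <= e3 by near: n; exact: vS.
  have l4 : lam n ^+ 2 * (s n + p n)%:R <= eps ^+ 2 / 128 by near: n; exact: lamS.
  have pn : (p n)%:R / n%:R <= load_const R * v n.
    by apply: dim_le_load => //; [rewrite leq_addl|move=> ->].
  have pS := iid_psd (sample n) n0.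
  have Sb : forall u, theta^-1 * sqn u <= bil (Sigma0 n) u u <= theta * sqn u.
    have [c1 _ c3] := cond1 n.
    by apply: sv_form_bounds => //; rewrite invr_ge0 ltW.
  have xK : forall t, `|t| <= rho -> forall i j,
      (\int[P n]_w (expR (t * @x n i j w ^+ 2))%:E <= K%:E)%E.
    by move=> t tr i j; have := cond4 t tr n i j; rewrite unlock.
  have lnp : ln (p n)%:R <= n%:R :> R.
    rewrite -[leRHS]mul1r -ler_pdivrMr//; apply: (le_trans _ ld).
    rewrite /load ler_peMl ?divr_ge0// ?ln_ge0 ?ler1n// addn_gt0 p_gt0 orbT//.
  apply: le_trans (sample_error_bound (sample n) (p_gt0 n) n1 M_gt0 theta_gt1 rho_gt0 K_gt0 m_gt0
    Sb xK (@eta_ge0 n) (@regression n) nu_lt (Splus_meas n) (@est n) eps0 lnp _ _ _ _) _.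
  - by move=> k; apply: le_trans (pwn k) _; rewrite ge_min lexx.
  - move=> k; have h : pw n k <= eps / (16 * C).
      by apply: le_trans (pwn k) _; rewrite ge_min lexx orbT.
    have h2 : pw n k ^+ 2 <= (eps / (16 * C)) ^+ 2.
      by rewrite ler_sqr ?nnegrE// ltW// divr_gt0// mulr_gt0.
    have cE a : 0 < a -> 16 * (a ^+ 2 * (2 * (eps / (16 * a)) ^+ 2)) = eps ^+ 2 / 8.
      by move=> a0; field; rewrite gt_eqF.
    rewrite -(cE C C0) -/(pw n k) ler_pM2l// ler_wpM2l ?sqr_ge0// ler_pM2l//.
  - have nn : n%:R = n.-1%:R + 1 :> R by rewrite natr1 prednK.
    have n10 : 1 <= n.-1%:R :> R by rewrite ler1n -subn1 subn_gt0.
    set a := n.-1%:R in nn n10 *.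
    have pa : (p n)%:R / a ^+ 2 <= 2 * ((p n)%:R / n%:R).
      rewrite mulrCA; apply: ler_wpM2l => //.
      have -> : 2 / n%:R = (n%:R / 2)^-1 :> R by field; rewrite gt_eqF.
      rewrite lef_pV2 ?posrE ?exprn_gt0 ?divr_gt0//; last by lra.
      by rewrite nn expr2; nra.
    have pe : (p n)%:R / n%:R <= eps ^+ 2 / (128 * (128 * (C ^+ 2 * theta ^+ 2))).
      apply: le_trans pn _; apply: le_trans (ler_wpM2l (ltW k0) v2) _.
      rewrite le_eqVlt; apply/orP; left; apply/eqP; rewrite /e2.
      by field; rewrite !gt_eqF.
    have cE b : 0 < b -> 512 * (b ^+ 2 * theta ^+ 2) *
        (2 * (eps ^+ 2 / (128 * (128 * (b ^+ 2 * theta ^+ 2))))) = eps ^+ 2 / 16.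
      by move=> b0; field; rewrite !gt_eqF.
    have a0 : 0 < a by lra.
    have -> : 16 * ((8 * theta ^+ 2) ^+ 2 * (8 * (p n)%:R * (2 * theta / a) ^+ 2)) =
        512 * (C ^+ 2 * theta ^+ 2) * ((p n)%:R / a ^+ 2).
      by rewrite -/C; field; rewrite gt_eqF.
    apply: (@le_trans _ _ (eps ^+ 2 / 16)); last by have := exprn_gt0 2 eps0; lra.
    rewrite -(cE C C0); apply: ler_wpM2l.
      apply: mulr_ge0; first exact: ler0n.
      by apply: mulr_ge0; exact: sqr_ge0.
    by apply: le_trans pa _; rewrite ler_pM2l.
  - rewrite -/(lam n) -/(s n).
    have h : lam n ^+ 2 * (s n)%:R <= lam n ^+ 2 * (s n + p n)%:R.
      by apply: ler_wpM2l; [exact: sqr_ge0|rewrite ler_nat leq_addr].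
    by have := le_trans h l4; lra.
  rewrite lee_fin; apply: sample_error_probability_le => //.
  rewrite -/rate.
  have h : (p n)%:R / n%:R <= rate / (54 * ln 2).
    apply: le_trans pn _; apply: le_trans (ler_wpM2l (ltW k0) v3) _.
    rewrite le_eqVlt; apply/orP; left; apply/eqP; rewrite /e3.
    by field; rewrite !gt_eqF.
  have l27 : 0 <= 27 * ln 2 :> R by rewrite mulr_ge0// ltW.
  apply: le_trans (ler_wpM2r l27 h) _.
  by rewrite le_eqVlt; apply/orP; left; apply/eqP; field; rewrite gt_eqF.
apply: (@squeeze_cvge _ _ _ _ (fun=> 0%E) _ (fun n => (error_const theta rho K eps * v n)%:E)).
- by apply: filterS bound => n h; rewrite h andbT.
- exact: cvg_cst.
apply: cvg_EFin; first exact: nearW.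
have vc : v n @[n --> \oo] --> 0.
  apply/cvgrPdist_le => e e_gt0; apply: filterS (vS e e_gt0) => n vn.
  by rewrite sub0r normrN ger0_norm.
by rewrite -[X in _ --> X](mulr0 (error_const theta rho K eps)); apply: cvgMr.
Unshelve. all: by end_near. Qed.
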